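(* Let $2<p<\infty$. For every fixed integer $K_0\ge1$ there is $\phi\in\mathrm{Hol}(\mathbb D)$ such that $$\sup_{h\in\mathcal A_{K_0}}\Bigl(\sum_{j\ge0}\|X_jh\|_2^t\Bigr)^{1/t}<\infty,$$ with a uniformly vanishing coordinate tail, i.e. $\lim_{N\to\infty}\sup_{h\in\mathcal A_{K_0}}\bigl(\sum_{j>N}\|X_jh\|_2^t\bigr)^{1/t}=0$, while $T_\phi:H^p\to H^p$ is unbounded. Also, for this $\phi$, $(\|X_j\|_2)_j\in\ell^t$ (so that its $\ell^t$ tail vanishes). For $K_0=1$, the test family $\mathcal A_1$ consists precisely, up to unimodular constant factors, of the normalized kernels $$\kappa_{a,t}(z)=\frac{(1-|a|^2)^{1/t}}{(1-\overline az)^{2/t}},\quad a\in\mathbb D,\qquad |\kappa_{a,t}|^t=P_a\ \text{on }\mathbb T.$$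
   Context: $\mathbb D$ is the open unit disc, $\mathbb T$ the unit circle with normalized Haar measure $m$; $H^u$ is the Hardy space identified with boundary functions, $\|\cdot\|_u$ the norm of $L^u(\mathbb T,m)$; $\mathrm{Hol}(\mathbb D)$ is the space of holomorphic functions on $\mathbb D$. Exponents: $1/p+1/p'=1$, $t=2p/(p-2)$. For $\phi\in\mathrm{Hol}(\mathbb D)$ with Taylor coefficients $\widehat\phi(n)$: $T_\phi f(z)=\int_0^1f(s)\phi(sz)\,ds$; $\Delta_j\phi(z)=\sum_{2^j\le n<2^{j+1}}\widehat\phi(n)z^n$ and $X_j=2^{-j/p'}\Delta_j\phi$, $j\ge0$. For $a\in\mathbb D$, $P_a(\zeta)=\frac{1-|a|^2}{|1-\overline a\zeta|^2}$. $\mathcal A_K$ is the set of outer functions $h\in H^t$ such that on $\mathbb T$ (a.e.) $|h|^t=\sum_{\nu=1}^Kc_\nu P_{a_\nu}$ for some $a_\nu\in\mathbb D$, $c_\nu\ge0$, $\sum_{\nu=1}^Kc_\nu=1$. *)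

(* Defs.v *)
From HB Require Import structures.
From mathcomp Require Import all_boot all_order all_algebra.
From mathcomp Require Import complex.
From mathcomp Require Import all_classical all_reals all_analysis.

Set Implicit Arguments.
Unset Strict Implicit.
Unset Printing Implicit Defensive.

Import Order.TTheory GRing.Theory Num.Theory.
Import numFieldNormedType.Exports.

Local Open Scope classical_set_scope.
Local Open Scope ring_scope.
Local Open Scope complex_scope.

(* The order of R[i] only relates numbers with equal imaginary parts and its
   norm [`|z|] lives in R[i]; [cabs] is the modulus as an element of R. *)
Definition cabs (R : realType) (z : R[i]) : R := ComplexField.Normc.normc z.

Definition disc (R : realType) : set R[i] := [set z | cabs z < 1].

Definition cis (R : realType) (theta : R) : R[i] := cos theta +i* sin theta.

Definition cexp (R : realType) (z : R[i]) : R[i] :=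
  (expR (complex.Re z))%:C * cis (complex.Im z).

(* Principal argument, with values in ]-pi, pi] for z != 0. *)
Definition carg (R : realType) (z : R[i]) : R :=
  if 0 <= complex.Im z then acos (complex.Re z / cabs z)
  else - acos (complex.Re z / cabs z).

Definition clog (R : realType) (z : R[i]) : R[i] := ln (cabs z) +i* carg z.

(* Principal power z^s with a real exponent, meaningful for z != 0. *)
Definition cpow (R : realType) (z : R[i]) (s : R) : R[i] :=
  cexp (s%:C * clog z).

Definition cintegral (d : measure_display) (T : measurableType d)
    (R : realType) (mu : {measure set T -> \bar R}) (D : set T)
    (f : T -> R[i]) : R[i] :=
  (\int[mu]_(x in D) complex.Re (f x)) +i* (\int[mu]_(x in D) complex.Im (f x)).

(* R[i]^o carries the normed-module structure of R[i] over itself, so that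
   [derivable] and [derive1n] below are complex differentiation.  Functions on
   the disc are total functions whose values off the disc are irrelevant. *)
Definition holomorphic_on_disc (R : realType) (f : R[i]^o -> R[i]^o) : Prop :=
  forall z : R[i], disc z -> derivable f z 1.

Definition taylor_coef (R : realType) (f : R[i]^o -> R[i]^o) (n : nat) : R[i] :=
  (derive1n n f 0 : R[i]) / (n`!)%:R.

Lemma two_pi_gt0 (R : realType) : (0 : R) < 2 * pi.
Proof. by rewrite mulr_gt0 ?pi_gt0. Qed.

(* The unit circle is parametrized by theta |-> cis theta; normalized Haar
   measure becomes the uniform probability on [0, 2 pi]. *)
Definition haar (R : realType) : probability _ R :=
  uniform_prob (two_pi_gt0 R).

Definition circle_norm (R : realType) (u : R) (g : R[i] -> R[i]) : \bar R :=
  Lnorm (haar R) u%:E (fun theta => (cabs (g (cis theta)))%:E).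

(* Radial boundary function (0 where the radial limit does not exist). *)
Definition boundary (R : realType) (f : R[i] -> R[i]) (zeta : R[i]) : R[i] :=
  lim ((f (r%:C * zeta) : R[i]^o) @[r --> (1 : R)^'-]).

Definition hardy (R : realType) (u : R) : set (R[i] -> R[i]) :=
  [set f | holomorphic_on_disc f /\
    (ereal_sup [set circle_norm u (fun zeta => f (r%:C * zeta)%R)
               | r in [set r : R | (0 <= r < 1)%R]] < +oo)%E].

Definition hardy_norm (R : realType) (u : R) (f : R[i] -> R[i]) : \bar R :=
  circle_norm u (boundary f).

(* Since [ln 0 = 0], the condition log |h| > -oo a.e. is stated separately. *)
Definition outer (R : realType) (h : R[i] -> R[i]) : Prop :=
  exists lambda : R[i],
    [/\ cabs lambda = 1,
        {ae haar R, forall theta, boundary h (cis theta) != 0},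
        (haar R).-integrable setT
          (fun theta => (ln (cabs (boundary h (cis theta))))%:E) &
        forall z, disc z ->
          h z = lambda * cexp (cintegral (haar R) setT (fun theta =>
                  (cis theta + z) / (cis theta - z)
                  * (ln (cabs (boundary h (cis theta))))%:C))].

Definition poisson (R : realType) (a zeta : R[i]) : R :=
  (1 - cabs a ^+ 2) / cabs (1 - a^* * zeta) ^+ 2.

Definition test_family (R : realType) (t : R) (K : nat) : set (R[i] -> R[i]) :=
  [set h | [/\ hardy t h, outer h &
    exists (a : 'I_K -> R[i]) (c : 'I_K -> R),
      [/\ forall nu, disc (a nu),
          forall nu, 0 <= c nu,
          \sum_(nu < K) c nu = 1 &
          {ae haar R, forall theta,
            cabs (boundary h (cis theta)) `^ t
            = \sum_(nu < K) c nu * poisson (a nu) (cis theta)}]]].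

Definition kernel_fun (R : realType) (t : R) (a z : R[i]) : R[i] :=
  ((1 - cabs a ^+ 2) `^ t^-1)%:C / cpow (1 - a^* * z) (2 / t).

Definition Top (R : realType) (phi f : R[i] -> R[i]) (z : R[i]) : R[i] :=
  cintegral lebesgue_measure `[0, 1]%classic
    (fun s : R => f s%:C * phi (s%:C * z)).

Definition bounded_on_hardy (R : realType) (p : R)
    (T : (R[i] -> R[i]) -> (R[i] -> R[i])) : Prop :=
  exists M : R, forall f, hardy p f ->
    hardy p (T f) /\ (hardy_norm p (T f) <= M%:E * hardy_norm p f)%E.

Definition dyadic_block (R : realType) (phi : R[i] -> R[i]) (j : nat)
    (z : R[i]) : R[i] :=
  \sum_(2 ^ j <= n < 2 ^ j.+1) taylor_coef phi n * z ^+ n.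

Definition Xblock (R : realType) (p' : R) (phi : R[i] -> R[i]) (j : nat)
    (z : R[i]) : R[i] :=
  (2 `^ (- (j%:R / p')))%:C * dyadic_block phi j z.

(* (sum_{j >= N} ||X_j h||_2^t)^(1/t) *)
Definition block_sum (R : realType) (p' t : R) (phi : R[i] -> R[i]) (N : nat)
    (h : R[i] -> R[i]) : \bar R :=
  ((\sum_(N <= j <oo)
      hardy_norm 2 (fun z => Xblock p' phi j z * h z)%R `^ t) `^ t^-1)%E.

(* Main.v *)
Require Import Defs.
From HB Require Import structures.
From mathcomp Require Import all_boot all_order all_algebra.
From mathcomp Require Import complex.
From mathcomp Require Import all_classical all_reals all_analysis.
From mathcomp Require Import measurable_realfun.
From mathcomp Require Import ring lra zify.

Set Implicit Arguments.
Unset Strict Implicit.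
Unset Printing Implicit Defensive.

Import Order.TTheory GRing.Theory Num.Theory.
Import numFieldNormedType.Exports.

Local Open Scope classical_set_scope.
Local Open Scope ring_scope.
Local Open Scope complex_scope.

(** A test function [h] carries a density [|h|^t], and [||X_j h||_2^2] is the
    integral of [|X_j|^2] against the power [2 / t < 1] of that density.  A
    polynomial whose mass sits on [N] equally spaced, very narrow peaks is badly
    seen by a bounded number of Poisson kernels: a kernel wide compared with
    [1 / N] averages over many peaks and sees only the mean, and a narrow kernel
    has a small power mean.  The best density for such a polynomial is spread over
    all the peaks, and no combination of [K0] Poisson kernels, with [K0] fixed,
    comes near it.

    The symbol [phi] is therefore a sum of combs [z^(2^j) D(z^N)], with [D] a
    Dirichlet sum, one in each of a sparse sequence of dyadic blocks [j = J k].
    Lemma [spread_test] gives the bound for one kernel, uniformly in its position;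
    it only uses the Fourier coefficients of Poisson kernels and Jensen's formula
    for [1 - a z].  Lemma [test_block] extends it to convex combinations, whose
    power is at most the sum of the powers.  The amplitudes are chosen so that the
    [k]-th comb contributes [2^-k] to the sums of the tests, up to a constant:
    this gives the boundedness, the uniform tail, and, with [h = 1], the sum of
    the norms of the [X_j].

    The operator is unbounded because of the same combs ([phi_unbounded]).  On the
    polynomial [1 + z + ... + z^(m-1)] with [m = 2 ^ J k] it multiplies the
    coefficients of the [k]-th block by factors comparable to one, and
    Hoelder's inequality against the square of a Dirichlet sum in [z^N] bounds the
    [p]-norm of the image from below by [2^(k/t)] times the norm of the polynomial.
    The later combs have frequencies so high that the image has absolutely
    summable coefficients, hence is continuous on the closed disc and its boundary
    function is given by its series.

    For one Poisson kernel the test functions are determined by their modulus,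
    because an outer function is the exponential of the Schwarz integral of the
    logarithm of its boundary modulus ([outer_modulus]).  That integral is computed
    for [ln |1 - a z|] in [schwarz_log], by truncating the Taylor series of the
    logarithm. *)

(** * Complex numbers in coordinates *)

Section cplx.
Variable R : realType.
Implicit Types (z w : R[i]) (x y : R).
Local Notation cj z := (@Num.conj R[i] z).

Lemma ReD z w : complex.Re (z + w) = complex.Re z + complex.Re w.
Proof. by case: z; case: w. Qed.
Lemma ImD z w : complex.Im (z + w) = complex.Im z + complex.Im w.
Proof. by case: z; case: w. Qed.
Lemma ReN z : complex.Re (- z) = - complex.Re z. Proof. by case: z. Qed.
Lemma ImN z : complex.Im (- z) = - complex.Im z. Proof. by case: z. Qed.
Lemma ReM z w : complex.Re (z * w) =
  complex.Re z * complex.Re w - complex.Im z * complex.Im w.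
Proof. by case: z; case: w. Qed.
Lemma ImM z w : complex.Im (z * w) =
  complex.Re z * complex.Im w + complex.Im z * complex.Re w.
Proof. by case: z; case: w. Qed.
Lemma Re_conj z : complex.Re (cj z) = complex.Re z. Proof. by case: z. Qed.
Lemma Im_conj z : complex.Im (cj z) = - complex.Im z. Proof. by case: z. Qed.
Lemma complex_eq z w : complex.Re z = complex.Re w ->
  complex.Im z = complex.Im w -> z = w.
Proof. by case: z; case: w => /= a b c d -> ->. Qed.
Lemma Re_sum I (r : seq I) (P : pred I) (F : I -> R[i]) :
  complex.Re (\sum_(i <- r | P i) F i) = \sum_(i <- r | P i) complex.Re (F i).
Proof. by elim/big_rec2: _ => // i y1 y2 _ <-; rewrite ReD. Qed.
Lemma Im_sum I (r : seq I) (P : pred I) (F : I -> R[i]) :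
  complex.Im (\sum_(i <- r | P i) F i) = \sum_(i <- r | P i) complex.Im (F i).
Proof. by elim/big_rec2: _ => // i y1 y2 _ <-; rewrite ImD. Qed.

Lemma cabsE z : cabs z = Num.sqrt (complex.Re z ^+ 2 + complex.Im z ^+ 2).
Proof. by case: z. Qed.
Lemma cabs_ge0 z : 0 <= cabs z.
Proof. by rewrite cabsE sqrtr_ge0. Qed.
Lemma cabs_sqr z : cabs z ^+ 2 = complex.Re z ^+ 2 + complex.Im z ^+ 2.
Proof. by rewrite cabsE sqr_sqrtr// addr_ge0// sqr_ge0. Qed.
Lemma cabsM z w : cabs (z * w) = cabs z * cabs w.
Proof. exact: ComplexField.Normc.normcM. Qed.
Lemma cabsV z : cabs z^-1 = (cabs z)^-1.
Proof. exact: ComplexField.Normc.normcV. Qed.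
Lemma cabsf z w : cabs (z / w) = cabs z / cabs w.
Proof. by rewrite cabsM cabsV. Qed.
Lemma cabs0 : cabs (0 : R[i]) = 0.
Proof. exact: ComplexField.Normc.normc0. Qed.
Lemma cabs1 : cabs (1 : R[i]) = 1.
Proof. exact: ComplexField.Normc.normc1. Qed.
Lemma cabsX z n : cabs (z ^+ n) = cabs z ^+ n.
Proof. by elim: n => [|n IH]; rewrite ?expr0 ?cabs1// !exprS cabsM IH. Qed.
Lemma cabsN z : cabs (- z) = cabs z.
Proof. by rewrite !cabsE ReN ImN !sqrrN. Qed.
Lemma cabsB z w : cabs (z - w) = cabs (w - z).
Proof. by rewrite -cabsN opprB. Qed.
Lemma cabs_conj z : cabs (cj z) = cabs z.
Proof. by rewrite !cabsE Re_conj Im_conj sqrrN. Qed.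
Lemma cabs_real x : cabs x%:C = `|x|.
Proof. by rewrite cabsE/= expr0n/= addr0 sqrtr_sqr. Qed.
Lemma cabs_ge0_real x : 0 <= x -> cabs x%:C = x.
Proof. by move=> x0; rewrite cabs_real ger0_norm. Qed.
Lemma cabs_nat n : cabs (n%:R : R[i]) = n%:R.
Proof.
by rewrite -(rmorph_nat (real_complex R)) cabs_real ger0_norm.
Qed.
Lemma normE z : `|z| = (cabs z)%:C. Proof. by []. Qed.
Lemma cabsD z w : cabs (z + w) <= cabs z + cabs w.
Proof.
have := ler_normD z w.
by rewrite !normE -rmorphD lecR.
Qed.
Lemma cabs_sub_ge z w : cabs z - cabs w <= cabs (z - w).
Proof. by have := cabsD (z - w) w; rewrite subrK; lra. Qed.
Lemma cabs_sum I (r : seq I) (P : pred I) (F : I -> R[i]) :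
  cabs (\sum_(i <- r | P i) F i) <= \sum_(i <- r | P i) cabs (F i).
Proof.
elim/big_rec2: _ => [|i y1 y2 _ h]; first by rewrite cabs0.
by apply: le_trans (cabsD _ _) _; rewrite lerD2l.
Qed.
Lemma cabs_eq0 z : (cabs z == 0) = (z == 0).
Proof.
apply/eqP/eqP => [|->]; last exact: cabs0.
exact: ComplexField.Normc.eq0_normc.
Qed.
Lemma cabs_gt0 z : (0 < cabs z) = (z != 0).
Proof. by rewrite lt_def cabs_ge0 andbT cabs_eq0. Qed.
Lemma normRe_le z : `|complex.Re z| <= cabs z.
Proof. by rewrite cabsE -sqrtr_sqr ler_wsqrtr// lerDl sqr_ge0. Qed.
Lemma normIm_le z : `|complex.Im z| <= cabs z.
Proof. by rewrite cabsE -sqrtr_sqr ler_wsqrtr// lerDr sqr_ge0. Qed.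
Lemma Re_le_cabs z : complex.Re z <= cabs z.
Proof. exact: le_trans (ler_norm _) (normRe_le z). Qed.
Lemma cabs_le_ReIm z : cabs z <= `|complex.Re z| + `|complex.Im z|.
Proof.
rewrite -(@ler_pXn2r _ 2) ?nnegrE ?cabs_ge0 ?addr_ge0//.
rewrite cabs_sqr sqrrD !real_normK ?num_real//.
by rewrite addrAC lerDl mulrn_wge0// mulr_ge0.
Qed.
Lemma mul_conj z : z * cj z = (cabs z ^+ 2)%:C.
Proof.
rewrite cabs_sqr; apply: complex_eq; rewrite ?ReM ?ImM Re_conj Im_conj/=.
  by rewrite mulrN opprK !expr2.
by rewrite mulrN mulrC addNr.
Qed.
Lemma conj_real x : cj x%:C = x%:C.
Proof. by apply: complex_eq; rewrite ?Re_conj ?Im_conj/= ?oppr0. Qed.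
Lemma cjM z w : cj (z * w) = cj z * cj w. Proof. exact: rmorphM. Qed.
Lemma cjB z w : cj (z - w) = cj z - cj w. Proof. exact: rmorphB. Qed.
Lemma cj1 : cj 1 = 1. Proof. exact: rmorph1. Qed.
Lemma cjX z n : cj (z ^+ n) = cj z ^+ n. Proof. exact: rmorphXn. Qed.
Lemma cjV z : cj z^-1 = (cj z)^-1. Proof. exact: fmorphV. Qed.
Lemma cjK z : cj (cj z) = z. Proof. exact: conjCK. Qed.
Lemma cj_sum I (r : seq I) (P : pred I) (F : I -> R[i]) :
  cj (\sum_(i <- r | P i) F i) = \sum_(i <- r | P i) cj (F i).
Proof. exact: rmorph_sum. Qed.
Lemma ReZ x z : complex.Re (x%:C * z) = x * complex.Re z.
Proof. by rewrite ReM/= mul0r subr0. Qed.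
Lemma ImZ x z : complex.Im (x%:C * z) = x * complex.Im z.
Proof. by rewrite ImM/= mul0r addr0. Qed.

Lemma cabs_cis x : cabs (cis x) = 1.
Proof. by rewrite cabsE/= cos2Dsin2 sqrtr1. Qed.
Lemma cis0 : cis (0 : R) = 1.
Proof. by rewrite /cis cos0 sin0. Qed.
Lemma cis_D x y : cis (x + y) = cis x * cis y.
Proof.
apply: complex_eq; rewrite ?(ReM, ImM)/=; first by rewrite cosD.
by rewrite sinD; ring.
Qed.
Lemma cis_X x n : cis x ^+ n = cis (n%:R * x).
Proof.
elim: n => [|n IH]; first by rewrite mul0r cis0 expr0.
by rewrite exprS IH -cis_D -natr1; congr cis; ring.
Qed.
Lemma cis_neq0 x : cis x != 0.
Proof. by rewrite -cabs_eq0 cabs_cis oner_neq0. Qed.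
Lemma cis_mul_conj x : cis x * cj (cis x) = 1.
Proof. by rewrite mul_conj cabs_cis expr1n. Qed.

(** Bridge between the topology of [R[i]^o], whose norm takes values in
    [R[i]], and estimates with the real modulus. *)
Lemma ccvgP T (F : set_system T) (FF : Filter F) (f : T -> R[i]^o) (l : R[i]^o) :
  f @ F --> l <-> forall e : R, 0 < e -> \forall x \near F, cabs (l - f x) < e.
Proof.
split=> [/cvgrPdist_lt h e e0|h].
  have e0' : (0 : R[i]) < e%:C by rewrite ltcR.
  by apply: filterS (h _ e0') => x; rewrite normE ltcR.
apply/cvgrPdist_lt => e e0.
have eE : e = (complex.Re e)%:C.
  by apply: complex_eq => //=; move: e0; rewrite ltcE/= => /andP[/eqP].
have e0' : 0 < complex.Re e by move: e0; rewrite ltcE => /andP[].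
by rewrite eE; apply: filterS (h _ e0') => x; rewrite normE ltcR.
Qed.

End cplx.

(** * Complex derivatives and power series *)

Section cder.
Variable R : realType.
Implicit Types (z w h : R[i]).

Lemma cvg_cabs_unique (T : Type) (F : set_system T) (FF : ProperFilter F)
    (f : T -> R[i]^o) (l : R[i]^o) :
  (forall e : R, 0 < e -> \forall x \near F, cabs (l - f x) < e) -> lim (f @ F) = l.
Proof. by move=> H; apply: cvg_lim => //; apply/ccvgP. Qed.

Lemma near_ball_c z (e : R) (P : R[i]^o -> Prop) : 0 < e ->
  (forall w, cabs (z - w) < e -> P w) -> \forall w \near (z : R[i]^o), P w.
Proof.
move=> e0 H; apply/nbhs_ballP; exists e%:C => /=; first by rewrite ltcR.
by move=> w; rewrite -ball_normE /ball_/= normE ltcR; apply: H.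
Qed.

(** Explicit quadratic remainders replace limits of quotients; they are what
    power series, the logarithm and the exponential all provide. *)
Lemma deriv_quad (f : R[i]^o -> R[i]^o) z (D : R[i]) (K e : R) : 0 < e ->
  (forall h, cabs h < e -> cabs (f (z + h) - f z - h * D) <= K * cabs h ^+ 2) ->
  derivable f z 1 /\ derive1 f z = D.
Proof.
move=> e0 H.
have key : h^-1 *: (f (h *: (1 : R[i]^o) + z) - f z) @[h --> (0 : R[i]^o)^'] --> (D : R[i]^o).
  apply/ccvgP => e1 e10.
  have K1 : 0 < `|K| + 1 by rewrite ltr_wpDl.
  have m0 : 0 < Num.min e (e1 / (`|K| + 1)) by rewrite lt_min e0 divr_gt0.
  apply: (@near_ball_c 0 _ _ m0) => w; rewrite sub0r cabsN => we w0.
  rewrite [w *: _]mulr1 [w + z]addrC.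
  rewrite [X in cabs X](_ : _ = - (w^-1 * (f (z + w) - f z - w * D))); last first.
    rewrite /GRing.scale/=; set u := f (z + w); set v := f z.
    by rewrite !mulrBr mulKf// !opprD !opprK addrC.
  rewrite cabsN cabsM cabsV mulrC ltr_pdivrMr ?cabs_gt0//.
  move: we; rewrite lt_min => /andP[we]; rewrite ltr_pdivlMr// => we1.
  apply: le_lt_trans (H _ we) _.
  apply: le_lt_trans (_ : _ <= (`|K| + 1) * cabs w ^+ 2) _.
    rewrite ler_wpM2r ?sqr_ge0//.
    by rewrite (le_trans (ler_norm K)) ?lerDl.
  by rewrite expr2 mulrA ltr_pM2r ?cabs_gt0// mulrC.
split; first by apply/cvg_ex; exists (D : R[i]^o).
rewrite derive1E; apply: cvg_lim key => //.
Qed.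

(** Differentiability at a point ignores the values far from it, in
    particular those off the disc. *)
Lemma deriv_loc (f g : R[i]^o -> R[i]^o) z (D : R[i]) (e : R) : 0 < e ->
  (forall h, cabs h < e -> f (z + h) = g (z + h)) ->
  derivable f z 1 /\ derive1 f z = D -> derivable g z 1 /\ derive1 g z = D.
Proof.
move=> e0 H; have H0 : f z = g z by have := H 0; rewrite addr0; apply; rewrite cabs0.
rewrite !derive1E => -[df Df].
have key : h^-1 *: (g (h *: (1 : R[i]^o) + z) - g z) @[h --> (0 : R[i]^o)^'] --> (D : R[i]^o).
  have := (df : cvg _); rewrite -Df; apply: cvg_trans.
  apply: near_eq_cvg; apply: (@near_ball_c 0 _ _ e0) => w; rewrite sub0r cabsN => we w0 /=.
  by rewrite -H0 [w *: _]mulr1 [w + z]addrC H.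
split; first by apply/cvg_ex; exists (D : R[i]^o).
by apply: cvg_lim key.
Qed.
End cder.

Section cpseries.
Variable R : realType.
Implicit Types (z w h : R[i]) (c : nat -> R[i]).

Definition cpartial c n z : R[i] := \sum_(i < n) c i * z ^+ i.

(** The limits are taken in each coordinate, where completeness of the reals
    applies. *)
Definition cpseries c z : R[i] :=
  limn (fun n => complex.Re (cpartial c n z)) +i* limn (fun n => complex.Im (cpartial c n z)).

Lemma cvg_sum_of_norm (u b : nat -> R) (B : R) :
  (forall i, `|u i| <= b i) -> (fun n => \sum_(i < n) b i) @ \oo --> B ->
  cvgn (fun n => \sum_(i < n) u i).
Proof.
move=> ub bB.
have seriesE (v : nat -> R) : (fun n => \sum_(i < n) v i) = series v.
  by apply/funext => n; rewrite /series/= big_mkord.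
rewrite seriesE; apply: normed_cvg.
apply: (@series_le_cvg _ _ b) => [i||i|]; rewrite /= ?normr_ge0//.
- by move=> i; exact: le_trans (normr_ge0 _) (ub i).
- by apply/cvg_ex; exists B; move: bB; rewrite seriesE.
Qed.

(** One majorant controls the truncation error at every point where it
    dominates the terms: this single estimate gives the uniform convergence
    used for continuity, differentiation and interchange with integrals. *)
Lemma cpseries_tail c z (b : nat -> R) (B : R) n :
  (forall i, cabs (c i) * cabs z ^+ i <= b i) ->
  (fun n => \sum_(i < n) b i) @ \oo --> B ->
  cabs (cpseries c z - cpartial c n z) <= B - \sum_(i < n) b i.
Proof.
move=> cb bB.
have cbi i : cabs (c i * z ^+ i) <= b i by rewrite cabsM cabsX.
have b0 i : 0 <= b i by apply: le_trans (cbi i); rewrite cabs_ge0.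
have cR : cvgn (fun n => complex.Re (cpartial c n z)).
  rewrite (_ : (fun _ => _) = fun n => \sum_(i < n) complex.Re (c i * z ^+ i)).
    apply: (@cvg_sum_of_norm (fun i => complex.Re (c i * z ^+ i)) b B _ bB) => i.
    exact: le_trans (normRe_le _) (cbi i).
  by apply/funext => m; rewrite Re_sum.
have cI : cvgn (fun n => complex.Im (cpartial c n z)).
  rewrite (_ : (fun _ => _) = fun n => \sum_(i < n) complex.Im (c i * z ^+ i)).
    apply: (@cvg_sum_of_norm (fun i => complex.Im (c i * z ^+ i)) b B _ bB) => i.
    exact: le_trans (normIm_le _) (cbi i).
  by apply/funext => m; rewrite Im_sum.
have nd : nondecreasing_seq (fun n => \sum_(i < n) b i).
  by apply/nondecreasing_seqP => m; rewrite big_ord_recr/= lerDl.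
have sB m : \sum_(i < m) b i <= B.
  have cvb : cvgn (fun n => \sum_(i < n) b i) by apply/cvg_ex; exists B.
  by rewrite -(cvg_lim _ bB)//; apply: nondecreasing_cvgn_le.
have diff m : cabs (cpartial c (n + m) z - cpartial c n z) <= B - \sum_(i < n) b i.
  rewrite /cpartial big_split_ord/= addrAC subrr add0r.
  apply: le_trans (cabs_sum _ _ _) _.
  rewrite lerBrDl (le_trans _ (sB (n + m)%N))// big_split_ord/= lerD2l.
  exact: ler_sum.
apply/ler_addgt0Pr => e e0.
have e2 : 0 < e / 2 by rewrite divr_gt0.
move/cvgrPdist_lt: (cR) => /(_ _ e2)[N1 _ H1].
move/cvgrPdist_lt: (cI) => /(_ _ e2)[N2 _ H2].
pose m := (N1 + N2)%N.
have h1 := H1 (n + m)%N; have h2 := H2 (n + m)%N.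
have {h1} h1 := h1 (leq_trans (leq_addr N2 N1) (leq_addl n _)).
have {h2} h2 := h2 (leq_trans (leq_addl N1 N2) (leq_addl n _)).
have -> : cpseries c z - cpartial c n z =
   (cpseries c z - cpartial c (n + m) z) + (cpartial c (n + m) z - cpartial c n z) by ring.
apply: le_trans (cabsD _ _) _; rewrite addrC lerD//.
apply: le_trans (cabs_le_ReIm _) _; rewrite ReD ReN ImD ImN/=.
by move: h1 h2 => /=; lra.
Qed.

(** Radius of convergence at least one, in the form that is stable under
    termwise differentiation. *)
Definition disc_summable c := forall r : R, 0 <= r < 1 ->
  exists B, forall n, \sum_(i < n) cabs (c i) * r ^+ i <= B.

Lemma disc_summable_cvg c r : disc_summable c -> 0 <= r < 1 ->
  exists B : R, (fun n => \sum_(i < n) cabs (c i) * r ^+ i) @ \oo --> B.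
Proof.
move=> ac r01; have [B HB] := ac r r01.
apply/cvg_ex; apply: nondecreasing_is_cvgn.
  apply/nondecreasing_seqP => m; rewrite big_ord_recr/= lerDl.
  by rewrite mulr_ge0 ?cabs_ge0// exprn_ge0//; case/andP: r01.
by exists B => _ [n _ <-].
Qed.

Lemma cpseries_approx c r (e : R) : disc_summable c -> 0 <= r < 1 -> 0 < e ->
  exists N, forall n z, (N <= n)%N -> cabs z <= r -> cabs (cpseries c z - cpartial c n z) < e.
Proof.
move=> ac r01 e0; have [B HB] := disc_summable_cvg ac r01.
move/cvgrPdist_lt: (HB) => /(_ _ e0)[N _ HN]; exists N => n z Nn zr.
apply: le_lt_trans (@cpseries_tail c z (fun i => cabs (c i) * r ^+ i) B n _ HB) _.
  move=> i; rewrite ler_wpM2l ?cabs_ge0// lerXn2r ?nnegrE ?cabs_ge0//.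
  by case/andP: r01.
exact: le_lt_trans (ler_norm _) (HN n Nn).
Qed.

Definition deriv_coef c : nat -> R[i] := fun n => n.+1%:R * c n.+1.

(** Enlarging the radius from [r] to [s] pays for the factor [i + 1], because
    [(i + 1) r^i (s - r) <= s^(i+1) - r^(i+1)]. *)
Lemma disc_summable_deriv c : disc_summable c -> disc_summable (deriv_coef c).
Proof.
move=> ac r /andP[r0 r1].
pose s := (1 + r) / 2.
have rs : r < s by rewrite /s; lra.
have s1 : s < 1 by rewrite /s; lra.
have s0 : 0 <= s by lra.
have [|B HB] := ac s; first by rewrite s0.
exists (B / (s - r)) => n.
rewrite ler_pdivlMr ?subr_gt0//.
apply: le_trans (HB n.+1).
rewrite [leRHS]big_ord_recl/=; apply: ler_wpDl; first by rewrite mulr_ge0 ?cabs_ge0 ?exprn_ge0.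
  rewrite mulr_suml; apply: ler_sum => i _; rewrite /deriv_coef cabsM cabs_nat.
  rewrite -!mulrA mulrCA ler_wpM2l ?cabs_ge0//.
  have := subrXX s r i.+1.
  have : i.+1%:R * r ^+ i <= \sum_(j < i.+1) s ^+ (i.+1.-1 - j) * r ^+ j.
    rewrite mulr_natl -[X in _ *+ X]card_ord -sumr_const; apply: ler_sum => j _.
    rewrite -{1}(subnK (leq_ord j)) exprD ler_wpM2r ?exprn_ge0//.
    by rewrite lerXn2r ?nnegrE// ltW.
  move=> h e; have sr : 0 <= s - r by lra.
  have := ler_wpM2l sr h; rewrite -e => h'.
  rewrite mulrA mulrC; apply: le_trans h' _.
  by rewrite gerBl exprn_ge0.
Qed.

(** Induction on [n]; the constant is the second derivative of [r^n], so that
    the bounds sum up to the second formal derivative of a power series. *)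
Lemma pow_quad z h (r : R) n : cabs z <= r -> cabs (z + h) <= r ->
  cabs ((z + h) ^+ n - z ^+ n - h * (n%:R * z ^+ n.-1))
   <= cabs h ^+ 2 * (n%:R * n.-1%:R * r ^+ n.-2).
Proof.
move=> zr zhr; have r0 : 0 <= r by apply: le_trans zr; rewrite cabs_ge0.
elim: n => [|n IH].
  by rewrite !expr0 subrr !mul0r mulr0 subrr cabs0 mulr0.
have -> : (z + h) ^+ n.+1 - z ^+ n.+1 - h * (n.+1%:R * z ^+ n.+1.-1) =
  (z + h) * ((z + h) ^+ n - z ^+ n - h * (n%:R * z ^+ n.-1))
  + h ^+ 2 * (n%:R * z ^+ n.-1).
  case: n {IH} => [|n]; first by rewrite /= !expr1 !expr0; ring.
  by rewrite /= -[n.+2%:R]natr1 !exprS; ring.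
apply: le_trans (cabsD _ _) _; rewrite cabsM [cabs (h ^+ 2 * _)]cabsM cabsX.
apply: le_trans (_ : _ <= r * (cabs h ^+ 2 * (n%:R * n.-1%:R * r ^+ n.-2)) +
   cabs h ^+ 2 * (n%:R * r ^+ n.-1)) _.
  apply: lerD; first by apply: ler_pM => //; rewrite cabs_ge0.
  rewrite ler_wpM2l ?sqr_ge0// cabsM cabs_nat ler_wpM2l// cabsX.
  by rewrite lerXn2r ?nnegrE ?cabs_ge0.
rewrite mulrCA -mulrDr ler_wpM2l ?sqr_ge0//=.
case: n {IH} => [|[|n]] /=; rewrite ?mul0r ?mulr0 ?addr0 ?expr0//.
  by rewrite mul0r mulr0 add0r !mulr1 ler_nat.
rewrite mulrCA -exprS -mulrDl ler_wpM2r ?exprn_ge0//.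
rewrite -!natrM -natrD ler_nat; lia.
Qed.

Lemma cabs_combine (u u' v v' w w' h : R[i]) (A B C D : R) :
  cabs (u - u') <= A -> cabs (v - v') <= B -> cabs (h * (w - w')) <= C ->
  cabs (u' - v' - h * w') <= D -> cabs (u - v - h * w) <= D + (A + B + C).
Proof.
move=> hA hB hC hD.
have -> : u - v - h * w =
  (u' - v' - h * w') + ((u - u') + - (v - v') + - (h * (w - w'))) by ring.
apply: le_trans (cabsD _ _) _; rewrite lerD//.
apply: le_trans (cabsD _ _) _; rewrite cabsN lerD//.
by apply: le_trans (cabsD _ _) _; rewrite cabsN lerD.
Qed.

(** Summing [pow_quad] over the partial sums and letting their length grow
    gives a quadratic remainder for the whole series. *)
Lemma cpseries_deriv c z : disc_summable c -> cabs z < 1 ->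
  derivable (cpseries c : R[i]^o -> R[i]^o) z 1 /\
  derive1 (cpseries c : R[i]^o -> R[i]^o) z = cpseries (deriv_coef c) z.
Proof.
move=> ac z1.
pose r := (1 + cabs z) / 2.
have z0 := cabs_ge0 z.
have r0 : 0 <= r by rewrite /r; lra.
have r1 : r < 1 by rewrite /r; lra.
have r01 : 0 <= r < 1 by rewrite r0.
have adc := disc_summable_deriv ac.
have [B HB] := disc_summable_deriv adc r01.
apply: (@deriv_quad _ _ _ _ B (r - cabs z)); first by rewrite /r; lra.
move=> h hr.
have zr : cabs z <= r by rewrite /r; lra.
have zhr : cabs (z + h) <= r by have := cabsD z h; lra.
apply/ler_addgt0Pr => e e0.
have e3 : 0 < e / 3 by rewrite divr_gt0.
have [N1 H1] := cpseries_approx ac r01 e3.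
have h1 : 0 < e / 3 / (cabs h + 1) by rewrite divr_gt0// ltr_wpDl ?cabs_ge0.
have [N2 H2] := cpseries_approx adc r01 h1.
pose n := (N1 + N2)%N.
have b1 := ltW (H1 n.+1 (z + h) (leq_trans (leq_addr _ _) (leqnSn _)) zhr).
have b2 := ltW (H1 n.+1 z (leq_trans (leq_addr _ _) (leqnSn _)) zr).
have b3 : cabs (h * (cpseries (deriv_coef c) z - cpartial (deriv_coef c) n z)) <= e / 3.
  rewrite cabsM; apply: le_trans (ler_wpM2l (cabs_ge0 h) (ltW (H2 n z (leq_addl _ _) zr))) _.
  rewrite mulrA ler_pdivrMr ?ltr_wpDl ?cabs_ge0// mulrC ler_wpM2l ?(ltW e3)//.
  by rewrite lerDl.
have b4 : cabs (cpartial c n.+1 (z + h) - cpartial c n.+1 z - h * cpartial (deriv_coef c) n z) <= B * cabs h ^+ 2.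
  have -> : cpartial c n.+1 (z + h) - cpartial c n.+1 z - h * cpartial (deriv_coef c) n z =
    \sum_(i < n.+1) c i * ((z + h) ^+ i - z ^+ i - h * (i%:R * z ^+ i.-1)).
    rewrite [RHS](eq_bigr (fun i : 'I__ => c i * (z + h) ^+ i - c i * z ^+ i
      - h * (c i * (i%:R * z ^+ i.-1)))); last by move=> i _; ring.
    rewrite !sumrB -mulr_sumr; congr (_ - _ - _ * _).
    rewrite big_ord_recl/= !mul0r mulr0 add0r; apply: eq_bigr => i _.
    by rewrite /deriv_coef /bump/= add1n mulrCA mulrA.
  apply: le_trans (cabs_sum _ _ _) _.
  apply: le_trans (_ : _ <= \sum_(i < n.+1) cabs h ^+ 2 * (cabs (c i) * (i%:R * i.-1%:R * r ^+ i.-2))) _.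
    apply: ler_sum => i _; rewrite cabsM [leRHS]mulrCA ler_wpM2l ?cabs_ge0//.
    exact: pow_quad.
  rewrite -mulr_sumr mulrC ler_wpM2r ?sqr_ge0//.
  apply: le_trans (HB n).
  rewrite big_ord_recl/= mul0r mul0r mulr0 add0r.
  case: (n) => [|k]; first by rewrite !big_ord0.
  rewrite big_ord_recl/= mulr0 mul0r mulr0 add0r [leRHS]big_ord_recr/=.
  rewrite -[leLHS]addr0 lerD ?mulr_ge0 ?cabs_ge0 ?exprn_ge0//.
  apply: ler_sum => i _; rewrite /bump/= !add1n /deriv_coef !cabsM !cabs_nat.
  by rewrite le_eqVlt; apply/orP; left; apply/eqP; ring.
apply: le_trans (cabs_combine b1 b2 b3 b4) _.
by clear -e0; rewrite lerD2l; lra.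
Qed.

Lemma cpseries0 c : cpseries c 0 = c 0%N.
Proof.
have H n : cpartial c n.+1 0 = c 0%N.
  rewrite /cpartial big_ord_recl expr0 mulr1 big1 ?addr0// => i _.
  by rewrite exprS mul0r mulr0.
apply: complex_eq => /=; apply: cvg_lim => //; apply/cvg_ballP => e e0;
  by exists 1%N => // -[//|n] _ /=; rewrite H; exact: ballxx.
Qed.

Lemma cpseries_holo c : disc_summable c -> holomorphic_on_disc (cpseries c : R[i]^o -> R[i]^o).
Proof. by move=> ac z /= z1; have [] := cpseries_deriv ac z1. Qed.

Lemma derive1n_cpseries c n : disc_summable c -> disc_summable (iter n deriv_coef c) /\
  forall z, cabs z < 1 -> derive1n n (cpseries c : R[i]^o -> R[i]^o) z = cpseries (iter n deriv_coef c) z.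
Proof.
move=> ac; elim: n => [|n [IHa IH]]; first by rewrite derive1n0.
split=> [|z z1]; first exact: disc_summable_deriv.
rewrite derive1nS -[iter n.+1 _ _]/(deriv_coef (iter n deriv_coef c)).
have z1' : 0 < 1 - cabs z by rewrite subr_gt0.
have [|_ ->] // := @deriv_loc R (cpseries (iter n deriv_coef c)) (derive1n n (cpseries c : R[i]^o -> R[i]^o)) z _ _ z1' _ (cpseries_deriv IHa z1).
move=> h hz; rewrite IH//; have := cabsD z h; lra.
Qed.

Lemma iter_deriv_coef0 c n m : m`!%:R * iter n deriv_coef c m = (n + m)`!%:R * c (n + m)%N.
Proof.
elim: n m => [|n IH] m; first by rewrite add0n.
by rewrite iterS /deriv_coef mulrA -natrM mulnC -factS IH addSnnS.
Qed.

Lemma taylor_cpseries c n : disc_summable c -> taylor_coef (cpseries c) n = c n.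
Proof.
move=> ac; rewrite /taylor_coef (derive1n_cpseries n ac).2 ?cabs0//.
rewrite cpseries0; have := iter_deriv_coef0 c n 0; rewrite addn0 fact0 mul1r => ->.
by rewrite mulrC mulKf// pnatr_eq0 -lt0n fact_gt0.
Qed.

End cpseries.

(** * Integration of bounded complex functions *)

Section cint.
Context d (T : measurableType d) (R : realType).
Variables (mu : {measure set T -> \bar R}) (D : set T).
Hypotheses (mD : measurable D) (fD : (mu D < +oo)%E).
Local Notation cj z := (@Num.conj R[i] z).
Implicit Types (f g : T -> R[i]) (u v : T -> R).

(** On a set of finite measure this class is an algebra of integrable
    functions, so integrability never has to be discussed separately. *)
Definition bounded_meas u := measurable_fun D u /\ exists B, forall x, D x -> `|u x| <= B.
Definition cbounded_meas f := [/\ measurable_fun D (fun x => complex.Re (f x)),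
  measurable_fun D (fun x => complex.Im (f x)) &
  exists B, forall x, D x -> cabs (f x) <= B].

Lemma bounded_meas_integrable u : bounded_meas u -> mu.-integrable D (EFin \o u).
Proof.
move=> [mu_ [B HB]]; apply: measurable_bounded_integrable => //.
exists B; split; first exact: num_real.
by move=> M BM x Dx /=; apply: le_trans (HB x Dx) (ltW BM).
Qed.

Lemma cbounded_meas_Re f : cbounded_meas f -> bounded_meas (fun x => complex.Re (f x)).
Proof.
move=> [mr mi [B HB]]; split=> //; exists B => x Dx.
exact: le_trans (normRe_le _) (HB x Dx).
Qed.
Lemma cbounded_meas_Im f : cbounded_meas f -> bounded_meas (fun x => complex.Im (f x)).
Proof.
move=> [mr mi [B HB]]; split=> //; exists B => x Dx.
exact: le_trans (normIm_le _) (HB x Dx).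
Qed.
Lemma cbounded_meas_of f : bounded_meas (fun x => complex.Re (f x)) ->
  bounded_meas (fun x => complex.Im (f x)) -> cbounded_meas f.
Proof.
move=> [mr [B HB]] [mi [B' HB']]; split=> //; exists (B + B') => x Dx.
by apply: le_trans (cabs_le_ReIm _) _; rewrite lerD ?HB ?HB'.
Qed.
Lemma bounded_meas_cst (r : R) : bounded_meas (fun=> r).
Proof. by split; [exact: measurable_cst|exists `|r|]. Qed.
Lemma bounded_measD u v : bounded_meas u -> bounded_meas v -> bounded_meas (fun x => u x + v x).
Proof.
move=> [mu_ [B HB]] [mv [B' HB']]; split; first exact: measurable_funD.
by exists (B + B') => x Dx; apply: le_trans (ler_normD _ _) _; rewrite lerD ?HB ?HB'.
Qed.
Lemma bounded_measM u v : bounded_meas u -> bounded_meas v -> bounded_meas (fun x => u x * v x).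
Proof.
move=> [mu_ [B HB]] [mv [B' HB']]; split; first exact: measurable_funM.
by exists (B * B') => x Dx; rewrite normrM ler_pM ?HB ?HB'.
Qed.
Lemma bounded_measN u : bounded_meas u -> bounded_meas (fun x => - u x).
Proof.
move=> [mu_ [B HB]]; split; first exact: measurable_funN.
by exists B => x Dx; rewrite normrN HB.
Qed.
Lemma bounded_measB u v : bounded_meas u -> bounded_meas v -> bounded_meas (fun x => u x - v x).
Proof. by move=> hu hv; apply: bounded_measD hu (bounded_measN hv). Qed.
Lemma bounded_meas_sum n (F : nat -> T -> R) : (forall i, bounded_meas (F i)) ->
  bounded_meas (fun x => \sum_(i < n) F i x).
Proof.
move=> H; elim: n => [|n IH].
  by under eq_fun do rewrite big_ord0; exact: bounded_meas_cst.
by under eq_fun do rewrite big_ord_recr/=; exact: bounded_measD.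
Qed.
Lemma bounded_meas_bigsum I (l : seq I) (F : I -> T -> R) : (forall i, bounded_meas (F i)) ->
  bounded_meas (fun x => \sum_(i <- l) F i x).
Proof.
move=> H; elim: l => [|i l IH].
  by under eq_fun do rewrite big_nil; exact: bounded_meas_cst.
by under eq_fun do rewrite big_cons; exact: bounded_measD.
Qed.
Lemma bounded_meas_eq u v : (forall x, u x = v x) -> bounded_meas u -> bounded_meas v.
Proof. by move=> /funext ->. Qed.
Lemma cbounded_meas_eq f g : (forall x, f x = g x) -> cbounded_meas f -> cbounded_meas g.
Proof. by move=> /funext ->. Qed.

Lemma cbounded_meas_cst (c : R[i]) : cbounded_meas (fun=> c).
Proof. by apply: cbounded_meas_of; exact: bounded_meas_cst. Qed.
Lemma cbounded_measD f g : cbounded_meas f -> cbounded_meas g -> cbounded_meas (fun x => f x + g x).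
Proof.
move=> hf hg; apply: cbounded_meas_of.
  by under eq_fun do rewrite ReD; apply: bounded_measD; exact: cbounded_meas_Re.
by under eq_fun do rewrite ImD; apply: bounded_measD; exact: cbounded_meas_Im.
Qed.
Lemma cbounded_measM f g : cbounded_meas f -> cbounded_meas g -> cbounded_meas (fun x => f x * g x).
Proof.
move=> hf hg; apply: cbounded_meas_of.
  under eq_fun do rewrite ReM.
  by apply: bounded_measB; apply: bounded_measM; (exact: cbounded_meas_Re || exact: cbounded_meas_Im).
under eq_fun do rewrite ImM.
by apply: bounded_measD; apply: bounded_measM; (exact: cbounded_meas_Re || exact: cbounded_meas_Im).
Qed.
Lemma cbounded_measN f : cbounded_meas f -> cbounded_meas (fun x => - f x).
Proof.
move=> hf; apply: cbounded_meas_of.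
  by under eq_fun do rewrite ReN; apply: bounded_measN; exact: cbounded_meas_Re.
by under eq_fun do rewrite ImN; apply: bounded_measN; exact: cbounded_meas_Im.
Qed.
Lemma cbounded_measB f g : cbounded_meas f -> cbounded_meas g -> cbounded_meas (fun x => f x - g x).
Proof. by move=> hu hv; apply: cbounded_measD hu (cbounded_measN hv). Qed.
Lemma cbounded_meas_conj f : cbounded_meas f -> cbounded_meas (fun x => cj (f x)).
Proof.
move=> hf; apply: cbounded_meas_of.
  by under eq_fun do rewrite Re_conj; exact: cbounded_meas_Re.
by under eq_fun do rewrite Im_conj; apply: bounded_measN; exact: cbounded_meas_Im.
Qed.
Lemma cbounded_measX f n : cbounded_meas f -> cbounded_meas (fun x => f x ^+ n).
Proof.
move=> hf; elim: n => [|n IH]; first exact: cbounded_meas_cst.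
by under eq_fun do rewrite exprS; exact: cbounded_measM.
Qed.
Lemma cbounded_meas_sum n (F : nat -> T -> R[i]) : (forall i, cbounded_meas (F i)) ->
  cbounded_meas (fun x => \sum_(i < n) F i x).
Proof.
move=> H; elim: n => [|n IH].
  by under eq_fun do rewrite big_ord0; exact: cbounded_meas_cst.
by under eq_fun do rewrite big_ord_recr/=; exact: cbounded_measD.
Qed.
Lemma cbounded_meas_real u : bounded_meas u -> cbounded_meas (fun x => (u x)%:C).
Proof. by move=> hu; apply: cbounded_meas_of => //=; exact: bounded_meas_cst. Qed.

Lemma measurable_cabs f : measurable_fun D (fun x => complex.Re (f x)) ->
  measurable_fun D (fun x => complex.Im (f x)) ->
  measurable_fun D (fun x => cabs (f x)).
Proof.
move=> mr mi; rewrite (_ : (fun _ => _) = (fun s : R => s `^ (2^-1)) \o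
   (fun x => complex.Re (f x) ^+ 2 + complex.Im (f x) ^+ 2)).
  apply: (@measurableT_comp _ _ _ _ _ _ (fun s : R => s `^ (2^-1))).
    exact: measurable_powR.
  by apply: measurable_funD; exact: measurable_funX.
by apply/funext => x /=; rewrite cabsE powR12_sqrt// addr_ge0// sqr_ge0.
Qed.
Lemma bounded_meas_cabs f : cbounded_meas f -> bounded_meas (fun x => cabs (f x)).
Proof.
move=> [mr mi [B HB]]; split; first exact: measurable_cabs.
by exists B => x Dx; rewrite ger0_norm ?cabs_ge0// HB.
Qed.
Lemma bounded_measX u n : bounded_meas u -> bounded_meas (fun x => u x ^+ n).
Proof.
move=> hf; elim: n => [|n IH]; first exact: bounded_meas_cst.
by under eq_fun do rewrite exprS; exact: bounded_measM.
Qed.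
Lemma bounded_measV u (e : R) : 0 < e -> (forall x, e <= u x) -> bounded_meas u ->
  bounded_meas (fun x => (u x)^-1).
Proof.
move=> e0 eu [mu_ _]; split.
  rewrite (_ : (fun _ => _) = (fun s : R => s `^ (-1)) \o u).
    by apply: (@measurableT_comp _ _ _ _ _ _ (fun s : R => s `^ (-1))).
  by apply/funext => x /=; rewrite powR_inv1// (le_trans (ltW e0)).
exists e^-1 => x Dx.
have ux : 0 < u x by apply: lt_le_trans e0 (eu x).
by rewrite ger0_norm; [rewrite lef_pV2|rewrite invr_ge0 ltW].
Qed.
Lemma cbounded_meas_V f (e : R) : 0 < e -> (forall x, e <= cabs (f x)) -> cbounded_meas f ->
  cbounded_meas (fun x => (f x)^-1).
Proof.
move=> e0 ef hf.
apply: (@cbounded_meas_eq (fun x => ((cabs (f x) ^+ 2)^-1)%:C * cj (f x))) => [x|].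
  have f0 : f x != 0 by rewrite -cabs_gt0; apply: lt_le_trans e0 (ef x).
  apply: (mulIf f0); rewrite mulVf// -mulrA [cj _ * _]mulrC mul_conj -rmorphM.
  by rewrite mulVf// expf_neq0// cabs_eq0.
apply: cbounded_measM; last exact: cbounded_meas_conj.
apply: cbounded_meas_real; apply: (@bounded_measV _ (e ^+ 2)); rewrite ?exprn_gt0//.
  by move=> x; rewrite lerXn2r ?nnegrE ?cabs_ge0// ltW.
exact: (@bounded_measX (fun x => cabs (f x)) 2 (bounded_meas_cabs hf)).
Qed.

Local Notation RI u := (\int[mu]_(x in D) u x)%R.
Local Notation cI f := (cintegral mu D f).

Lemma RID u v : bounded_meas u -> bounded_meas v -> RI (fun x => u x + v x) = RI u + RI v.
Proof. by move=> hu hv; rewrite RintegralD//; exact: bounded_meas_integrable. Qed.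
Lemma RIZ (r : R) u : bounded_meas u -> RI (fun x => r * u x) = r * RI u.
Proof. by move=> hu; rewrite RintegralZl//; exact: bounded_meas_integrable. Qed.
Lemma RIN u : bounded_meas u -> RI (fun x => - u x) = - RI u.
Proof.
by move=> hu; under eq_Rintegral do rewrite -mulN1r; rewrite RIZ// mulN1r.
Qed.
Lemma RIB u v : bounded_meas u -> bounded_meas v -> RI (fun x => u x - v x) = RI u - RI v.
Proof. by move=> hu hv; rewrite RID ?RIN//; exact: bounded_measN. Qed.
Lemma RI_cst (r : R) : RI (fun=> r) = r * fine (mu D).
Proof. by rewrite Rintegral_cst. Qed.
Lemma RI_le u v : bounded_meas u -> bounded_meas v -> (forall x, D x -> u x <= v x) -> RI u <= RI v.
Proof. by move=> hu hv H; apply: le_Rintegral => //; exact: bounded_meas_integrable. Qed.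
Lemma RI_sum n (F : nat -> T -> R) : (forall i, bounded_meas (F i)) ->
  RI (fun x => \sum_(i < n) F i x) = \sum_(i < n) RI (F i).
Proof.
move=> H; elim: n => [|n IH].
  by under eq_Rintegral do rewrite big_ord0; rewrite RI_cst mul0r big_ord0.
under eq_Rintegral do rewrite big_ord_recr/=.
by rewrite RID//; [rewrite IH big_ord_recr|exact: bounded_meas_sum].
Qed.
Lemma RI_bigsum I (l : seq I) (F : I -> T -> R) : (forall i, bounded_meas (F i)) ->
  RI (fun x => \sum_(i <- l) F i x) = \sum_(i <- l) RI (F i).
Proof.
move=> H; elim: l => [|i l IH].
  by under eq_Rintegral do rewrite big_nil; rewrite RI_cst mul0r big_nil.
under eq_Rintegral do rewrite big_cons.
by rewrite RID//; [rewrite IH big_cons|exact: bounded_meas_bigsum].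
Qed.
Lemma RI_ext u v : (forall x, D x -> u x = v x) -> RI u = RI v.
Proof. by move=> H; apply: eq_Rintegral => x; rewrite inE => /H. Qed.

Lemma cI_ext f g : (forall x, D x -> f x = g x) -> cI f = cI g.
Proof. by move=> H; rewrite /cintegral; congr (_ +i* _); apply: RI_ext => x /H ->. Qed.
Lemma cID f g : cbounded_meas f -> cbounded_meas g -> cI (fun x => f x + g x) = cI f + cI g.
Proof.
move=> hf hg; rewrite /cintegral; apply: complex_eq => /=.
  by rewrite -RID; [apply: RI_ext => x _; rewrite ReD|exact: cbounded_meas_Re..].
by rewrite -RID; [apply: RI_ext => x _; rewrite ImD|exact: cbounded_meas_Im..].
Qed.
Lemma cIZ (c : R[i]) f : cbounded_meas f -> cI (fun x => c * f x) = c * cI f.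
Proof.
move=> hf; have hr := cbounded_meas_Re hf; have hi := cbounded_meas_Im hf.
rewrite /cintegral; apply: complex_eq; rewrite ?ReM ?ImM/=.
  rewrite -!RIZ// -RIB; try (by apply: bounded_measM => //; exact: bounded_meas_cst).
  by apply: RI_ext => x _; rewrite ReM.
rewrite -!RIZ// -RID; try (by apply: bounded_measM => //; exact: bounded_meas_cst).
by apply: RI_ext => x _; rewrite ImM.
Qed.
Lemma cIN f : cbounded_meas f -> cI (fun x => - f x) = - cI f.
Proof. by move=> hf; rewrite -mulN1r -cIZ//; apply: cI_ext => x _; rewrite mulN1r. Qed.
Lemma cIB f g : cbounded_meas f -> cbounded_meas g -> cI (fun x => f x - g x) = cI f - cI g.
Proof. by move=> hu hv; rewrite cID ?cIN//; exact: cbounded_measN. Qed.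
Lemma cI_cst (c : R[i]) : cI (fun=> c) = c * (fine (mu D))%:C.
Proof.
by rewrite /cintegral !RI_cst; apply: complex_eq; rewrite ?ReM ?ImM/=; ring.
Qed.
Lemma cI_conj f : cbounded_meas f -> cI (fun x => cj (f x)) = cj (cI f).
Proof.
move=> hf; apply: complex_eq; rewrite ?Re_conj ?Im_conj/=.
  by apply: RI_ext => x _; rewrite Re_conj.
by rewrite -RIN; [apply: RI_ext => x _; rewrite Im_conj|exact: cbounded_meas_Im].
Qed.
Lemma cI_sum n (F : nat -> T -> R[i]) : (forall i, cbounded_meas (F i)) ->
  cI (fun x => \sum_(i < n) F i x) = \sum_(i < n) cI (F i).
Proof.
move=> H; elim: n => [|n IH].
  rewrite (cI_ext (g := fun=> 0)) => [|x _]; last by rewrite big_ord0.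
  by rewrite cI_cst mul0r big_ord0.
rewrite (cI_ext (g := fun x => \sum_(i < n) F i x + F n x)) => [|x _].
  by rewrite cID//; [rewrite IH big_ord_recr|exact: cbounded_meas_sum].
by rewrite big_ord_recr.
Qed.
(** Rotating the integral onto the positive real axis loses no constant. *)
Lemma cI_le f u : cbounded_meas f -> bounded_meas u -> (forall x, D x -> cabs (f x) <= u x) ->
  cabs (cI f) <= RI u.
Proof.
move=> hf hu H.
have [->|I0] := eqVneq (cI f) 0.
  by rewrite cabs0; apply: Rintegral_ge0 => x Dx; apply: le_trans (H x Dx); rewrite cabs_ge0.
have Ip : 0 < cabs (cI f) by rewrite cabs_gt0.
pose e := cj (cI f) / (cabs (cI f))%:C.
have e1 : cabs e = 1 by rewrite cabsf cabs_conj cabs_real gtr0_norm// divff// gt_eqF.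
have : complex.Re (cI (fun x => e * f x)) <= RI u.
  apply: RI_le => //; first by apply: cbounded_meas_Re; apply: cbounded_measM => //; exact: cbounded_meas_cst.
  by move=> x Dx; apply: le_trans (Re_le_cabs _) _; rewrite cabsM e1 mul1r H.
rewrite cIZ// /e mulrAC [cj _ * _]mulrC mul_conj -fmorphV -rmorphM/=.
by rewrite expr2 mulfK// gt_eqF.
Qed.
Lemma cI_abs f (B : R) : cbounded_meas f -> (forall x, D x -> cabs (f x) <= B) ->
  cabs (cI f) <= B * fine (mu D).
Proof. by move=> hf H; rewrite -RI_cst; apply: cI_le => //; exact: bounded_meas_cst. Qed.
Lemma cI_real u : bounded_meas u -> cI (fun x => (u x)%:C) = (RI u)%:C.
Proof.
move=> hu; rewrite /cintegral; apply: complex_eq => //=.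
by rewrite RI_cst mul0r.
Qed.
End cint.

(** * Fourier integrals on the circle *)

(** Makes a quantity vanish when arbitrarily long geometric decay bounds it. *)
Lemma le0_geom (R : realType) (q x C : R) : 0 <= q < 1 ->
  (forall k, x <= q ^+ k * C) -> x <= 0.
Proof.
move=> /andP[q0 q1] H; apply: (@cvgr_to_ge _ \oo _ _ (fun k => q ^+ k * C)).
  rewrite -[X in _ --> X](mul0r C); apply: cvgMl.
  by apply: cvg_expr; rewrite ger0_norm.
by near=> k; exact: H.
Unshelve. all: by end_near.
Qed.

Section circle.
Variable R : realType.
Local Notation cj z := (@Num.conj R[i] z).
Local Notation mu := (haar R).
Local Notation T := (measurableTypeR R).
Local Notation nice f := (@cbounded_meas _ T R setT f).
Local Notation rn f := (@bounded_meas _ T R setT f).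
Local Notation hI f := (cintegral mu setT f).
Local Notation RI u := (\int[mu]_x u x)%R.

Lemma haar_fin : (mu setT < +oo)%E.
Proof. by rewrite probability_setT ltry. Qed.
Lemma haar_fine1 : fine (mu setT) = 1.
Proof. by rewrite probability_setT. Qed.
Hint Resolve haar_fin : core.

(** The integral against the uniform law reduces to Lebesgue measure only for
    nonnegative functions, hence the shift by one in the proof. *)
Lemma haar_FTC (u F : R -> R) : (forall x : R, {for x, continuous u}) ->
  (forall x : R, is_derive x 1 F (u x)) -> (forall x, `|u x| <= 1) ->
  RI u = (F (2 * pi) - F 0) / (2 * pi).
Proof.
move=> cu dF u1.
have mu_ : measurable_fun [set: T] u by exact: continuous_measurable_fun.
have ru : rn u by split=> //; exists 1.
have p0 : (0 : R) < 2 * pi := two_pi_gt0 R.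
pose G (x : R) : R := F x + x.
have dG (x : R) : is_derive x 1 G (u x + 1) by apply: is_deriveD.
have cG (x : R) : {for x, continuous G}.
  by apply/differentiable_continuous; rewrite -derivable1_diffP; case: (dG x).
have : (\int[mu]_x (u x + 1)%:E = ((2 * pi)^-1 * (G (2 * pi) - G 0))%:E)%E.
  rewrite integral_uniform/=.
  - rewrite subr0 EFinM; congr (_ * _)%E.
    rewrite (@continuous_FTC2 _ _ G)//.
    + apply: continuous_subspaceT => x; apply: cvgD; [exact: cu|exact: cvg_cst].
    + split.
      * by move=> x _; case: (dG x).
      * by apply: cvg_at_right_filter; exact: cG.
      * by apply: cvg_at_left_filter; exact: cG.
    + by move=> x _; rewrite derive1E; case: (dG x).
  - by apply/measurable_EFinP; apply: measurable_funD.
  - by move=> x; rewrite lee_fin; have := u1 x; rewrite ler_norml; lra.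
move=> /(congr1 fine)/= h.
have : RI (fun x => u x + 1) = (2 * pi)^-1 * (G (2 * pi) - G 0) by exact: h.
rewrite RID//; last exact: bounded_meas_cst.
rewrite RI_cst// haar_fine1 mul1r => e.
have -> : RI u = (2 * pi)^-1 * (G (2 * pi) - G 0) - 1 by rewrite -e; ring.
rewrite /G; move: {e h} p0; move: (2 * pi) => q q0; field; exact: lt0r_neq0 q0.
Qed.

Lemma cos_2pi_nat n : cos (n%:R * (2 * pi)) = 1 :> R.
Proof.
have -> : n%:R * (2 * pi) = 0 + (pi *+ 2) *+ n :> R.
  by rewrite add0r !mulr_natl.
by rewrite (periodicn (@cosD2pi R)) cos0.
Qed.
Lemma sin_2pi_nat n : sin (n%:R * (2 * pi)) = 0 :> R.
Proof.
have -> : n%:R * (2 * pi) = 0 + (pi *+ 2) *+ n :> R.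
  by rewrite add0r !mulr_natl.
by rewrite (periodicn (@sinD2pi R)) sin0.
Qed.

Lemma RI_cos n : (0 < n)%N -> RI (fun x => cos (n%:R * x)) = 0.
Proof.
move=> n0; have n0' : (n%:R : R) != 0 by rewrite pnatr_eq0 -lt0n.
have dF (x : R) : is_derive x 1 (fun x => n%:R^-1 * sin (n%:R * x) : R) (cos (n%:R * x)).
  by apply: is_derive_eq; rewrite /GRing.scale/=; field.
rewrite (haar_FTC _ dF).
- by rewrite sin_2pi_nat !mulr0 sin0 mulr0 subrr mul0r.
- move=> x; apply: continuous_comp; last exact: continuous_cos.
  by apply: cvgM; [exact: cvg_cst|exact: cvg_id].
- by move=> x; rewrite ler_norml cos_geN1 cos_le1.
Qed.
Lemma RI_sin n : (0 < n)%N -> RI (fun x => sin (n%:R * x)) = 0.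
Proof.
move=> n0; have n0' : (n%:R : R) != 0 by rewrite pnatr_eq0 -lt0n.
have dF (x : R) : is_derive x 1 (fun x => - (n%:R^-1 * cos (n%:R * x)) : R) (sin (n%:R * x)).
  by apply: is_derive_eq; rewrite /GRing.scale/=; field.
rewrite (haar_FTC _ dF).
- by rewrite cos_2pi_nat mulr0 cos0 subrr mul0r.
- move=> x; apply: continuous_comp; last exact: continuous_sin.
  by apply: cvgM; [exact: cvg_cst|exact: cvg_id].
- by move=> x; rewrite ler_norml sin_geN1 sin_le1.
Qed.

Lemma nice_cis : nice (@cis R).
Proof.
apply: cbounded_meas_of => /=; split.
- by apply: continuous_measurable_fun; exact: continuous_cos.
- by exists 1 => x _; rewrite ler_norml cos_geN1 cos_le1.
- by apply: continuous_measurable_fun; exact: continuous_sin.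
- by exists 1 => x _; rewrite ler_norml sin_geN1 sin_le1.
Qed.
Lemma nice_cisX n : nice (fun x => cis x ^+ n).
Proof. exact: cbounded_measX nice_cis. Qed.

Lemma hI_ext (f g : T -> R[i]) : (forall x, f x = g x) -> hI f = hI g.
Proof. by move=> /funext ->. Qed.
Lemma hI_cst (c : R[i]) : hI (fun=> c) = c.
Proof. by rewrite cI_cst// haar_fine1 mulr1. Qed.

Lemma hI_sum n (F : nat -> T -> R[i]) : (forall i, nice (F i)) ->
  hI (fun x => \sum_(i < n) F i x) = \sum_(i < n) hI (F i).
Proof. by move=> nF; exact: cI_sum. Qed.
Lemma hI_abs (f : T -> R[i]) (B : R) : nice f -> (forall x, cabs (f x) <= B) ->
  cabs (hI f) <= B.
Proof.
by move=> nf H; have := cI_abs measurableT haar_fin nf (fun x _ => H x);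
  rewrite haar_fine1 mulr1.
Qed.

Lemma hI_cisX n : hI (fun x => cis x ^+ n) = (n == 0)%:R.
Proof.
case: n => [|n]; first exact: (hI_cst 1).
rewrite /cintegral; apply: complex_eq => /=.
  by under eq_Rintegral do rewrite cis_X; exact: RI_cos.
by under eq_Rintegral do rewrite cis_X; exact: RI_sin.
Qed.

Lemma hI_cis_conjX n : hI (fun x => cj (cis x) ^+ n) = (n == 0)%:R.
Proof.
rewrite -[RHS]conjC_nat -hI_cisX -cI_conj//; last exact: nice_cisX.
by apply: cI_ext => x _; rewrite cjX.
Qed.

Definition geom_ker (b : R[i]) (x : R) : R[i] := (1 - b * cis x)^-1.

Lemma geom_ker_low (b : R[i]) x : 1 - cabs b <= cabs (1 - b * cis x).
Proof. by have := cabs_sub_ge 1 (b * cis x); rewrite cabs1 cabsM cabs_cis mulr1. Qed.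
Lemma geom_ker_neq0 (b : R[i]) x : cabs b < 1 -> 1 - b * cis x != 0.
Proof. by move=> b1; rewrite -cabs_gt0; have := geom_ker_low b x; lra. Qed.
Lemma nice_geom_ker b : cabs b < 1 -> nice (geom_ker b).
Proof.
move=> b1; apply: (@cbounded_meas_V _ _ _ _ _ (1 - cabs b)).
- by rewrite subr_gt0.
- by move=> x; exact: geom_ker_low.
- apply: cbounded_measB; first exact: cbounded_meas_cst.
  by apply: cbounded_measM nice_cis; exact: cbounded_meas_cst.
Qed.

Lemma geom_ker_rec b x : cabs b < 1 -> geom_ker b x = 1 + b * cis x * geom_ker b x.
Proof. by move=> b1; rewrite /geom_ker; have := geom_ker_neq0 x b1 => h; field. Qed.

(** The identity [geom_ker_rec] trades a factor [b] for one more frequency; iterating,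
    the integral with a positive frequency is at most [|b|^k] times a constant
    for every [k]. *)
Lemma hI_geom_ker b n : cabs b < 1 -> hI (fun x => cis x ^+ n * geom_ker b x) = (n == 0)%:R.
Proof.
move=> b1.
have step m : hI (fun x => cis x ^+ m * geom_ker b x) =
    (m == 0)%:R + b * hI (fun x => cis x ^+ m.+1 * geom_ker b x).
  have nm : nice (fun x => cis x ^+ m.+1 * geom_ker b x) by apply: cbounded_measM (nice_cisX _) (nice_geom_ker b1).
  have nb : nice (fun x => b * (cis x ^+ m.+1 * geom_ker b x)) by apply: cbounded_measM nm; exact: cbounded_meas_cst.
  rewrite -hI_cisX -cIZ// -cID//; last exact: nice_cisX.
  by apply: cI_ext => x _; rewrite {1}geom_ker_rec// exprS; ring.
suff pos m : hI (fun x => cis x ^+ m.+1 * geom_ker b x) = 0.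
  by case: n => [|n]; [rewrite step pos mulr0 addr0|rewrite pos].
have bd k : cabs (hI (fun x => cis x ^+ m.+1 * geom_ker b x)) <= cabs b ^+ k / (1 - cabs b).
  have -> : hI (fun x => cis x ^+ m.+1 * geom_ker b x) =
     b ^+ k * hI (fun x => cis x ^+ (k + m.+1) * geom_ker b x).
    elim: k => [|k IH]; first by rewrite mul1r.
    by rewrite IH step addSn addnS/= add0r mulrA -exprSr.
  rewrite cabsM cabsX ler_wpM2l ?exprn_ge0 ?cabs_ge0//.
  apply: hI_abs => [|x].
    by apply: cbounded_measM (nice_cisX _) (nice_geom_ker b1).
  rewrite cabsM cabsX cabs_cis expr1n mul1r /geom_ker cabsV.
  have h := geom_ker_low b x.
  have h2 : 0 < 1 - cabs b by lra.
  by rewrite lef_pV2 ?posrE//; exact: lt_le_trans h2 h.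
apply/eqP; rewrite -cabs_eq0 eq_le cabs_ge0 andbT.
by apply: (@le0_geom _ (cabs b) _ (1 - cabs b)^-1) => //; rewrite cabs_ge0.
Qed.

(** Here the same identity lowers the negative frequency until it is zero. *)
Lemma hI_geom_kerN b n : cabs b < 1 -> hI (fun x => cj (cis x) ^+ n * geom_ker b x) = b ^+ n.
Proof.
move=> b1; elim: n => [|n IH].
  by rewrite expr0 -[RHS](hI_geom_ker 0 b1); apply: cI_ext => x _; rewrite !expr0.
have nc m : nice (fun x => cj (cis x) ^+ m).
  by apply: cbounded_measX; apply: cbounded_meas_conj; exact: nice_cis.
transitivity (hI (fun x => cj (cis x) ^+ n.+1 + b * (cj (cis x) ^+ n * geom_ker b x))).
  apply: cI_ext => x _; rewrite {1}geom_ker_rec// mulrDr mulr1; congr (_ + _).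
  rewrite exprSr; transitivity (cis x * cj (cis x) * (b * (cj (cis x) ^+ n * geom_ker b x))).
    by ring.
  by rewrite cis_mul_conj mul1r.
rewrite cID//; first by rewrite cIZ ?IH ?hI_cis_conjX ?add0r ?exprS//; apply: cbounded_measM (nc _) (nice_geom_ker b1).
by apply: cbounded_measM; [exact: cbounded_meas_cst|apply: cbounded_measM (nc _) (nice_geom_ker b1)].
Qed.

(** Separates the analytic and the antianalytic part, which gives the Fourier
    coefficients. *)
Lemma poissonE (a : R[i]) x : cabs a < 1 ->
  (poisson a (cis x))%:C = geom_ker (cj a) x + cj (geom_ker (cj a) x) - 1.
Proof.
move=> a1; have ca1 : cabs (cj a) < 1 by rewrite cabs_conj.
have h := geom_ker_neq0 x ca1.
rewrite /poisson /geom_ker; set w := 1 - cj a * cis x.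
have -> : ((1 - cabs a ^+ 2) / cabs w ^+ 2)%:C = (1 - cabs a ^+ 2)%:C / (w * cj w).
  by rewrite mul_conj -fmorphV -rmorphM.
have cw : cj w != 0 by rewrite fmorph_eq0.
have -> : (1 - cabs a ^+ 2)%:C = w + cj w - w * cj w.
  have -> : (1 - cabs a ^+ 2)%:C = 1 - a * cj a.
    by rewrite mul_conj; apply: complex_eq; rewrite ?ReD ?ImD ?ReN ?ImN/=; ring.
  rewrite /w cjB cj1 cjM cjK.
  have := cis_mul_conj x; set u := cis x; set u' := cj u => uu.
  have -> : a * cj a = (a * cj a) * (u * u') by rewrite uu mulr1.
  by ring.
rewrite cjV; field; by rewrite cw h.
Qed.

Lemma nice_poisson a : cabs a < 1 -> rn (fun x => poisson a (cis x)).
Proof.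
move=> a1; have ca1 : cabs (cj a) < 1 by rewrite cabs_conj.
rewrite (_ : (fun x => _) = fun x => complex.Re ((poisson a (cis x))%:C))//.
apply: cbounded_meas_Re; apply: (@cbounded_meas_eq _ _ _ _ (fun x => geom_ker (cj a) x + cj (geom_ker (cj a) x) - 1)).
  by move=> x; rewrite poissonE.
apply: cbounded_measB; last exact: cbounded_meas_cst.
by apply: cbounded_measD; [|apply: cbounded_meas_conj]; exact: nice_geom_ker.
Qed.

Lemma hI_poisson a n : cabs a < 1 ->
  hI (fun x => cis x ^+ n * (poisson a (cis x))%:C) = a ^+ n.
Proof.
move=> a1; have ca1 : cabs (cj a) < 1 by rewrite cabs_conj.
have ng := nice_geom_ker ca1.
transitivity (hI (fun x => cis x ^+ n * geom_ker (cj a) x + cj (cj (cis x) ^+ n * geom_ker (cj a) x) - cis x ^+ n)).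
  by apply: cI_ext => x _; rewrite poissonE// cjM cjX cjK; ring.
have nc m : nice (fun x => cj (cis x) ^+ m).
  by apply: cbounded_measX; apply: cbounded_meas_conj; exact: nice_cis.
have n1 : nice (fun x => cis x ^+ n * geom_ker (cj a) x) by apply: cbounded_measM ng; exact: nice_cisX.
have n2 : nice (fun x => cj (cis x) ^+ n * geom_ker (cj a) x) by exact: cbounded_measM.
rewrite cIB//; [|by apply: cbounded_measD => //; exact: cbounded_meas_conj|exact: nice_cisX].
rewrite cID//; last exact: cbounded_meas_conj.
rewrite cI_conj// hI_geom_ker// hI_geom_kerN// hI_cisX cjX cjK.
by rewrite addrAC subrr add0r.
Qed.

Lemma RI_poisson a : cabs a < 1 -> RI (fun x => poisson a (cis x)) = 1.
Proof.
move=> a1; have := hI_poisson 0 a1; rewrite expr0.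
rewrite (@hI_ext _ ( fun x => (poisson a (cis x))%:C)); last by move=> x; rewrite mul1r.
by rewrite cI_real//; [case|exact: nice_poisson].
Qed.

Lemma poisson_ge0 (a z : R[i]) : cabs a < 1 -> 0 <= poisson a z.
Proof.
move=> a1; rewrite divr_ge0 ?sqr_ge0// subr_ge0 expr_le1// ?cabs_ge0//.
exact: ltW.
Qed.

Definition schwarz_ker (z : R[i]) (x : R) : R[i] := (cis x + z) / (cis x - z).

(** The Schwarz kernel is antianalytic in the circle variable up to a constant,
    so it reproduces positive frequencies and annihilates negative ones. *)
Lemma schwarz_kerE z x : cabs z < 1 -> schwarz_ker z x = 2 * cj (geom_ker (cj z) x) - 1.
Proof.
move=> z1; have cz1 : cabs (cj z) < 1 by rewrite cabs_conj.
have h := geom_ker_neq0 x cz1.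
rewrite /schwarz_ker /geom_ker cjV cjB cj1 cjM cjK.
have uu := cis_mul_conj x; have u0 := cis_neq0 x.
have -> : cj (cis x) = (cis x)^-1.
  by apply: (mulfI u0); rewrite uu divff.
have h2 : cis x - z != 0.
  rewrite -cabs_gt0; have := cabs_sub_ge (cis x) z; rewrite cabs_cis; lra.
by field; rewrite h2 u0.
Qed.

Lemma nice_schwarz_ker z : cabs z < 1 -> nice (schwarz_ker z).
Proof.
move=> z1; have cz1 : cabs (cj z) < 1 by rewrite cabs_conj.
apply: (@cbounded_meas_eq _ _ _ _ (fun x => 2 * cj (geom_ker (cj z) x) - 1)); first by move=> x; rewrite schwarz_kerE.
apply: cbounded_measB; last exact: cbounded_meas_cst.
apply: cbounded_measM; first exact: cbounded_meas_cst.
by apply: cbounded_meas_conj; exact: nice_geom_ker.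
Qed.

Lemma hI_schwarz_ker z : cabs z < 1 -> hI (schwarz_ker z) = 1.
Proof.
move=> z1; have cz1 : cabs (cj z) < 1 by rewrite cabs_conj.
have ng := cbounded_meas_conj (nice_geom_ker cz1).
rewrite (@hI_ext _ ( fun x => 2 * cj (geom_ker (cj z) x) - 1)); last by move=> x; rewrite schwarz_kerE.
rewrite cIB//; [|apply: cbounded_measM => //; exact: cbounded_meas_cst|exact: cbounded_meas_cst].
rewrite cIZ// cI_conj// ?hI_cst; last exact: nice_geom_ker.
have := hI_geom_ker 0 cz1; rewrite (@hI_ext _ ( geom_ker (cj z))) => [->|x]; last by rewrite mul1r.
by rewrite cj1; ring.
Qed.

Lemma hI_schwarz_kerX (z : R[i]) n : (0 < n)%N -> cabs z < 1 -> hI (fun x => cis x ^+ n * schwarz_ker z x) = 2 * z ^+ n.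
Proof.
move=> n0 z1; have cz1 : cabs (cj z) < 1 by rewrite cabs_conj.
have nc : nice (fun x => cj (cis x) ^+ n * geom_ker (cj z) x).
  by apply: cbounded_measM (nice_geom_ker cz1); apply: cbounded_measX; apply: cbounded_meas_conj; exact: nice_cis.
rewrite (@hI_ext _ ( fun x => 2 * cj (cj (cis x) ^+ n * geom_ker (cj z) x) - cis x ^+ n)).
  rewrite cIB//; [|apply: cbounded_measM; [exact: cbounded_meas_cst|exact: cbounded_meas_conj]|exact: nice_cisX].
  rewrite cIZ ?cI_conj ?hI_geom_kerN ?hI_cisX//; last exact: cbounded_meas_conj.
  by rewrite cjX cjK gtn_eqF// subr0.
by move=> x; rewrite schwarz_kerE// cjM cjX cjK; ring.
Qed.

Lemma hI_schwarz_kerN (z : R[i]) n : (0 < n)%N -> cabs z < 1 -> hI (fun x => cj (cis x) ^+ n * schwarz_ker z x) = 0.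
Proof.
move=> n0 z1; have cz1 : cabs (cj z) < 1 by rewrite cabs_conj.
have nc : nice (fun x => cis x ^+ n * geom_ker (cj z) x).
  by apply: cbounded_measM (nice_geom_ker cz1); exact: nice_cisX.
have ncx : nice (fun x => cj (cis x) ^+ n).
  by apply: cbounded_measX; apply: cbounded_meas_conj; exact: nice_cis.
rewrite (@hI_ext _ ( fun x => 2 * cj (cis x ^+ n * geom_ker (cj z) x) - cj (cis x) ^+ n)).
  rewrite cIB//; [|apply: cbounded_measM; [exact: cbounded_meas_cst|exact: cbounded_meas_conj]].
  rewrite cIZ ?cI_conj ?hI_geom_ker ?hI_cis_conjX//; last exact: cbounded_meas_conj.
  by rewrite gtn_eqF// conjC0 mulr0 subr0.
by move=> x; rewrite schwarz_kerE// cjM cjX; ring.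
Qed.
End circle.
#[export] Hint Resolve haar_fin : core.

(** * The principal logarithm along segments *)

Section clog.
Variable R : realType.
Local Notation cj z := (@Num.conj R[i] z).
Implicit Types (z w : R[i]) (x y : R).

Lemma acos_atan x y : 0 < x -> 0 <= y -> acos (x / Num.sqrt (x ^+ 2 + y ^+ 2)) = atan (y / x).
Proof.
move=> x0 y0.
have yx0 : 0 <= y / x by rewrite divr_ge0// ltW.
have -> : x / Num.sqrt (x ^+ 2 + y ^+ 2) = cos (atan (y / x)).
  rewrite cos_atan; have -> : 1 + (y / x) ^+ 2 = (x ^+ 2 + y ^+ 2) / x ^+ 2.
    by field; exact: lt0r_neq0.
  rewrite sqrtrM ?addr_ge0 ?sqr_ge0// sqrtrV ?sqr_ge0// sqrtr_sqr gtr0_norm//.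
  by rewrite invfM invrK mulrC.
rewrite cosK// in_itv/= (le_trans (ltW (atan_ltpi2 _))) ?andbT.
  by rewrite -[X in X <= _](atan0 R) le_atan.
by have := pi_gt0 R; lra.
Qed.

(** On the right half-plane the argument is smooth; the formula with [atan]
    makes it differentiable by the usual rules. *)
Lemma carg_atan z : 0 < complex.Re z -> carg z = atan (complex.Im z / complex.Re z).
Proof.
move=> x0; rewrite /carg cabsE; case: ifPn => [y0|]; first exact: acos_atan.
rewrite -ltNge => y0; rewrite -[X in _ + X]sqrrN acos_atan// ?oppr_ge0; last exact: ltW.
by rewrite mulNr atanN opprK.
Qed.

Lemma ln_cabs z : z != 0 -> ln (cabs z) = 2^-1 * ln (complex.Re z ^+ 2 + complex.Im z ^+ 2).
Proof.
by move=> z0; rewrite -cabs_sqr lnXn ?cabs_gt0// -[ln _ *+ 2]mulr_natl mulKf ?pnatr_eq0.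
Qed.

Lemma Re_neq0 z : 0 < complex.Re z -> z != 0.
Proof. by apply: contraTneq => ->; rewrite ltxx. Qed.

Lemma clogE z : 0 < complex.Re z -> clog z =
  (2^-1 * ln (complex.Re z ^+ 2 + complex.Im z ^+ 2)) +i* atan (complex.Im z / complex.Re z).
Proof. by move=> x0; rewrite /clog carg_atan// ln_cabs// Re_neq0. Qed.

Lemma Re_div w z : complex.Re (w / z) =
  (complex.Re w * complex.Re z + complex.Im w * complex.Im z) / (complex.Re z ^+ 2 + complex.Im z ^+ 2).
Proof. by rewrite ReM; case: w => a b; case: z => c d /=; ring. Qed.
Lemma Im_div w z : complex.Im (w / z) =
  (complex.Im w * complex.Re z - complex.Re w * complex.Im z) / (complex.Re z ^+ 2 + complex.Im z ^+ 2).
Proof. by rewrite ImM; case: w => a b; case: z => c d /=; ring. Qed.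

Lemma mvt_bound (G : R -> R) (g : R -> R) (E : R) :
  (forall x, 0 <= x <= 1 -> is_derive x 1 G (g x)) ->
  (forall x, 0 <= x <= 1 -> `|g x| <= E) -> `|G 1 - G 0| <= E.
Proof.
move=> dG gE.
have [||c /[!in_itv]/= /andP[c0 c1]] := @MVT R G g 0 1 ltr01.
- by move=> x /[!in_itv]/= /andP[x0 x1]; apply: dG; rewrite !ltW.
- apply: derivable_within_continuous => x /[!in_itv]/= x01.
  by case: (dG _ x01).
by rewrite subr0 mulr1 => ->; apply: gE; rewrite !ltW.
Qed.

Lemma is_derive_pow (f : R -> R) x (df : R) n : is_derive x 1 f df ->
  is_derive x 1 (fun u => f u ^+ n) (n%:R * f x ^+ n.-1 * df).
Proof.
move=> h; have := is_deriveX n h.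
rewrite (_ : f ^+ n = fun u => f u ^+ n)//; apply/funext => u.
by elim: n => [|n IH]; rewrite ?expr0// !exprS -IH.
Qed.
Lemma is_derive_mul (f g : R -> R) x (df dg : R) : is_derive x 1 f df ->
  is_derive x 1 g dg -> is_derive x 1 (fun u => f u * g u) (f x * dg + g x * df).
Proof. by move=> hf hg; exact: is_deriveM. Qed.
Lemma is_derive_scale (a : R) (f : R -> R) x (df : R) : is_derive x 1 f df ->
  is_derive x 1 (fun u => a * f u) (a * df).
Proof. by move=> hf; exact: is_deriveZ. Qed.

Lemma is_derive_affine (a b : R) x : is_derive x 1 (fun u : R => a + u * b) b.
Proof.
have h := is_deriveD (is_derive_cst a x 1) (is_derive_scale b (is_derive_id x 1)).
rewrite (_ : (fun u => _) = (cst a + (fun u : R => b * id u))%R); last first.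
  by apply/funext => u /=; rewrite mulrC.
by apply: (is_derive_eq h); rewrite add0r mulr1.
Qed.

Definition rpol (a : nat -> R) M x := \sum_(n < M) a n / n.+1%:R * x ^+ n.+1.
Lemma is_derive_rpol a M x : is_derive x 1 (rpol a M) (\sum_(n < M) a n * x ^+ n).
Proof.
rewrite (_ : rpol a M = \sum_(n < M) (fun x => a n / n.+1%:R * x ^+ n.+1)); last first.
  by apply/funext => u; rewrite fct_sumE.
apply: is_derive_sum => n.
have -> : a n * x ^+ n = (a n / n.+1%:R) * (n.+1%:R * x ^+ n * 1).
  by rewrite mulr1 -!mulrA mulKf// pnatr_eq0.
by apply: is_derive_scale; exact: (@is_derive_pow id x 1 n.+1).
Qed.

(** The logarithm is compared with a polynomial along a segment: by the mean
    value theorem the error is at most the error between the derivatives.  With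
    [M = 1] this gives the derivative of the logarithm, and with general [M]
    its Taylor expansion. *)
Lemma clog_path z0 z1 (c : nat -> R[i]) M (E : R) :
  0 < complex.Re z0 -> 0 < complex.Re z1 ->
  (forall x, 0 <= x <= 1 ->
    cabs ((z1 - z0) / (z0 + x%:C * (z1 - z0)) - \sum_(n < M) c n * x%:C ^+ n) <= E) ->
  cabs (clog z1 - clog z0 - \sum_(n < M) c n / n.+1%:R) <= 2 * E.
Proof.
move=> h0 h1 H.
pose X x := complex.Re z0 + x * complex.Re (z1 - z0).
pose Y x := complex.Im z0 + x * complex.Im (z1 - z0).
have X0 x : 0 <= x <= 1 -> 0 < X x.
  move=> /andP[x0 x1]; rewrite /X ReD ReN.
  have -> : complex.Re z0 + x * (complex.Re z1 - complex.Re z0) =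
    (1 - x) * complex.Re z0 + x * complex.Re z1 by ring.
  move: x0; rewrite le_eqVlt => /predU1P[<-|x0]; first by rewrite subr0 mul1r mul0r addr0.
  by apply: ltr_wpDl; [apply: mulr_ge0; lra|exact: mulr_gt0].
have ReZ' x : complex.Re (z0 + x%:C * (z1 - z0)) = X x by rewrite ReD ReZ.
have ImZ' x : complex.Im (z0 + x%:C * (z1 - z0)) = Y x by rewrite ImD ImZ.
have Re_c x n : complex.Re (c n * x%:C ^+ n) = complex.Re (c n) * x ^+ n.
  by rewrite -rmorphXn mulrC ReZ mulrC.
have Im_c x n : complex.Im (c n * x%:C ^+ n) = complex.Im (c n) * x ^+ n.
  by rewrite -rmorphXn mulrC ImZ mulrC.
have dX (x : R) : is_derive x 1 X (complex.Re (z1 - z0)).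
  exact: is_derive_affine.
have dY (x : R) : is_derive x 1 Y (complex.Im (z1 - z0)).
  exact: is_derive_affine.
have kR : `|complex.Re (clog z1 - clog z0 - \sum_(n < M) c n / n.+1%:R)| <= E.
  pose G x := 2^-1 * ln (X x ^+ 2 + Y x ^+ 2) - rpol (fun n => complex.Re (c n)) M x.
  have -> : complex.Re (clog z1 - clog z0 - \sum_(n < M) c n / n.+1%:R) = G 1 - G 0.
    rewrite !clogE// !ReD !ReN/= Re_sum /G /X /Y !mul1r !mul0r !addr0 /rpol.
    rewrite [X in _ - (_ - X)]big1 => [|i _]; last by rewrite expr0n mulr0.
    rewrite !ReD !ImD !ReN !ImN !subrKC subr0 addrAC; congr (_ - _ - _).
    apply: eq_bigr => i _; rewrite expr1n mulr1.
    by rewrite -(rmorph_nat (real_complex R)) -fmorphV mulrC ReZ mulrC.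
  apply: (@mvt_bound G (fun x => complex.Re ((z1 - z0) / (z0 + x%:C * (z1 - z0)) - \sum_(n < M) c n * x%:C ^+ n))).
    move=> x x01; have Xp := X0 x x01.
    have q0 : 0 < X x ^+ 2 + Y x ^+ 2 by rewrite ltr_wpDr ?sqr_ge0 ?exprn_gt0.
    rewrite ReD ReN Re_sum Re_div ReZ' ImZ'.
    under eq_bigr do rewrite Re_c.
    apply: is_deriveB; last exact: is_derive_rpol.
    have dq : is_derive x 1 (fun x => X x ^+ 2 + Y x ^+ 2)
       (2 * (complex.Re (z1 - z0) * X x + complex.Im (z1 - z0) * Y x)).
      have := is_deriveD (is_derive_pow 2 (dX x)) (is_derive_pow 2 (dY x)).
      by move=> h; apply: (is_derive_eq h); rewrite /= !expr1; ring.
    have dl : is_derive x 1 (fun x => ln (X x ^+ 2 + Y x ^+ 2)) ((X x ^+ 2 + Y x ^+ 2)^-1 *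
      (2 * (complex.Re (z1 - z0) * X x + complex.Im (z1 - z0) * Y x))).
      exact: (@is_derive1_comp _ (@ln R) (fun x => X x ^+ 2 + Y x ^+ 2) x _ _ (is_derive1_ln q0) dq).
    by apply: (is_derive_eq (is_derive_scale 2^-1 dl)); field; exact: lt0r_neq0.
  by move=> x x01; apply: le_trans (normRe_le _) (H x x01).
have kI : `|complex.Im (clog z1 - clog z0 - \sum_(n < M) c n / n.+1%:R)| <= E.
  pose G x := atan (Y x / X x) - rpol (fun n => complex.Im (c n)) M x.
  have -> : complex.Im (clog z1 - clog z0 - \sum_(n < M) c n / n.+1%:R) = G 1 - G 0.
    rewrite !clogE// !ImD !ImN/= Im_sum /G /X /Y !mul1r !mul0r !addr0 /rpol.
    rewrite [X in _ - (_ - X)]big1 => [|i _]; last by rewrite expr0n mulr0.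
    rewrite !ReD !ImD !ReN !ImN !subrKC subr0 addrAC; congr (_ - _ - _).
    apply: eq_bigr => i _; rewrite expr1n mulr1.
    by rewrite -(rmorph_nat (real_complex R)) -fmorphV mulrC ImZ mulrC.
  apply: (@mvt_bound G (fun x => complex.Im ((z1 - z0) / (z0 + x%:C * (z1 - z0)) - \sum_(n < M) c n * x%:C ^+ n))).
    move=> x x01; have Xp := X0 x x01.
    have q0 : 0 < X x ^+ 2 + Y x ^+ 2 by rewrite ltr_wpDr ?sqr_ge0 ?exprn_gt0.
    rewrite ImD ImN Im_sum Im_div ReZ' ImZ'.
    under eq_bigr do rewrite Im_c.
    apply: is_deriveB; last exact: is_derive_rpol.
    have Xn : X x != 0 by exact: lt0r_neq0.
    have dq : is_derive x 1 (fun x => Y x / X x)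
       ((complex.Im (z1 - z0) * X x - complex.Re (z1 - z0) * Y x) / X x ^+ 2).
      have dV : is_derive x 1 (fun x => (X x)^-1) (- (X x) ^- 2 *: complex.Re (z1 - z0)).
        exact: is_deriveV.
      by apply: (is_derive_eq (is_derive_mul (dY x) dV)); rewrite /GRing.scale/=; field.
    have dl : is_derive x 1 (fun x => atan (Y x / X x)) ((1 + (Y x / X x) ^+ 2)^-1 *
       ((complex.Im (z1 - z0) * X x - complex.Re (z1 - z0) * Y x) / X x ^+ 2)).
      exact: (@is_derive1_comp _ (@atan R) (fun x => Y x / X x) x _ _ (is_derive1_atan _) dq).
    by apply: (is_derive_eq dl); field; rewrite Xn/= lt0r_neq0.
  by move=> x x01; apply: le_trans (normIm_le _) (H x x01).
by apply: le_trans (cabs_le_ReIm _) _; rewrite mulr_natl mulr2n lerD.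
Qed.
End clog.

(** * Schwarz' formula for a linear factor, and complex powers *)

Section clog2.
Variable R : realType.
Local Notation cj z := (@Num.conj R[i] z).
Implicit Types (z w : R[i]) (x y : R).
Local Notation mu := (haar R).
Local Notation T := (measurableTypeR R).
Local Notation nice f := (@cbounded_meas _ T R setT f).
Local Notation rn f := (@bounded_meas _ T R setT f).
Local Notation hI f := (cintegral mu setT f).
Local Notation RI u := (\int[mu]_x u x)%R.

Lemma clog1 : clog (1 : R[i]) = 0.
Proof. by rewrite clogE ?ltr01//= expr1n expr0n/= addr0 ln1 mulr0 mul0r atan0. Qed.

Lemma Re_1sub w : cabs w < 1 -> 0 < complex.Re (1 - w).
Proof. by move=> w1; rewrite ReD ReN/= subr_gt0; apply: le_lt_trans (Re_le_cabs _) w1. Qed.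

(** The remainder of the geometric series bounds the derivative of the error
    along the segment from [1] to [1 - w]. *)
Lemma clog_taylor w M : cabs w < 1 ->
  cabs (clog (1 - w) + \sum_(n < M) w ^+ n.+1 / n.+1%:R) <= 2 * (cabs w ^+ M.+1 / (1 - cabs w)).
Proof.
move=> w1.
have -> : clog (1 - w) + \sum_(n < M) w ^+ n.+1 / n.+1%:R =
   clog (1 - w) - clog 1 - \sum_(n < M) (- w ^+ n.+1) / n.+1%:R.
  rewrite clog1 subr0; congr (_ + _); rewrite -sumrN; apply: eq_bigr => n _.
  by rewrite mulNr opprK.
apply: (@clog_path _ _ _ (fun n => - w ^+ n.+1)); [exact: ltr01|exact: Re_1sub|].
move=> x /andP[x0 x1].
have xw : cabs (x%:C * w) <= cabs w.
  by rewrite cabsM cabs_ge0_real// ler_piMl ?cabs_ge0.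
have d0 : 0 < 1 - cabs w by lra.
have dl : 1 - cabs w <= cabs (1 - x%:C * w).
  by have := cabs_sub_ge 1 (x%:C * w); rewrite cabs1; lra.
have dn : 1 - x%:C * w != 0 by rewrite -cabs_gt0; lra.
have -> : (1 - w - 1) / (1 + x%:C * (1 - w - 1)) - \sum_(n < M) (- w ^+ n.+1) * x%:C ^+ n
   = - w * (x%:C * w) ^+ M / (1 - x%:C * w).
  have -> : 1 - w - 1 = - w by rewrite addrAC subrr add0r.
  have -> : \sum_(n < M) (- w ^+ n.+1) * x%:C ^+ n = - w * \sum_(n < M) (x%:C * w) ^+ n.
    rewrite mulr_sumr; apply: eq_bigr => n _; rewrite exprMn exprS; ring.
  have -> : \sum_(n < M) (x%:C * w) ^+ n = (1 - (x%:C * w) ^+ M) / (1 - x%:C * w).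
    apply: (mulIf dn); rewrite mulfVK//.
    by rewrite -[RHS]opprB subrX1; set W := x%:C * w; set s := \sum_(_ < _) _; ring.
  have -> : 1 + x%:C * - w = 1 - x%:C * w by rewrite mulrN.
  by field.
rewrite cabsf cabsM cabsN cabsX exprS.
apply: ler_pM; rewrite ?invr_ge0 ?mulr_ge0 ?exprn_ge0 ?cabs_ge0//.
  by rewrite ler_wpM2l ?cabs_ge0// lerXn2r ?nnegrE ?cabs_ge0.
by rewrite lef_pV2 ?posrE//; exact: lt_le_trans d0 dl.
Qed.

Lemma cabs_1sub_le a x : cabs a < 1 -> cabs (1 - cj a * cis x) <= 2.
Proof.
move=> a1; apply: le_trans (cabsD _ _) _; rewrite cabs1 cabsN cabsM cabs_conj cabs_cis.
lra.
Qed.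
Lemma cabs_1sub_ge a x : 1 - cabs a <= cabs (1 - cj a * cis x).
Proof. by have := geom_ker_low (cj a) x; rewrite cabs_conj. Qed.

Lemma nice_1sub a : nice (fun x => 1 - cj a * cis x).
Proof.
apply: cbounded_measB; first exact: cbounded_meas_cst.
by apply: cbounded_measM (nice_cis R); exact: cbounded_meas_cst.
Qed.

Lemma rn_ln1sub a : cabs a < 1 -> rn (fun x => ln (cabs (1 - cj a * cis x))).
Proof.
move=> a1; have [mR mI _] := nice_1sub a; split.
  apply: (@measurableT_comp _ _ _ _ _ _ (@ln R)); first exact: measurable_ln.
  exact: measurable_cabs.
have d0 : 0 < 1 - cabs a by lra.
exists (`|ln (1 - cabs a)| + ln 2) => x _.
have h1 := cabs_1sub_ge a x; have h2 := cabs_1sub_le x a1.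
have c0 : 0 < cabs (1 - cj a * cis x) := lt_le_trans d0 h1.
have l1 : ln (1 - cabs a) <= ln (cabs (1 - cj a * cis x)) by rewrite ler_ln ?posrE.
have l2 : ln (cabs (1 - cj a * cis x)) <= ln 2 by rewrite ler_ln ?posrE.
have l3 : 0 <= ln 2 :> R by rewrite ln_ge0// ler1n.
have := ler_norm (- ln (1 - cabs a)); rewrite normrN => l4.
by rewrite ler_norml; have := normr_ge0 (ln (1 - cabs a)); lra.
Qed.

(** Replace the logarithm by its Taylor polynomial [P].  The Schwarz kernel maps
    [Re P] to [P] exactly, by the moments [hI_schwarz_kerX] and [hI_schwarz_kerN], and both
    truncation errors decay geometrically. *)
Lemma schwarz_log a z : cabs a < 1 -> cabs z < 1 ->
  hI (fun x => schwarz_ker z x * (ln (cabs (1 - cj a * cis x)))%:C) = clog (1 - cj a * z).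
Proof.
move=> a1 z1; have ca1 : cabs (cj a) < 1 by rewrite cabs_conj.
have az1 : cabs (cj a * z) <= cabs (cj a).
  by rewrite cabsM ler_piMr ?cabs_ge0// ltW.
have [_ _ [S HS]] := nice_schwarz_ker z1.
have S0 : 0 <= S by apply: le_trans (HS 0 I); rewrite cabs_ge0.
pose q := cabs (cj a).
have q0 : 0 <= q by exact: cabs_ge0.
pose D := hI (fun x => schwarz_ker z x * (ln (cabs (1 - cj a * cis x)))%:C) - clog (1 - cj a * z).
suff : cabs D <= 0 by rewrite le_eqVlt ltNge cabs_ge0 orbF cabs_eq0 subr_eq0 => /eqP.
apply: (@le0_geom R q _ (q * (2 * S + 2) / (1 - q))); first by rewrite q0.
move=> M.
pose P w := \sum_(n < M) w ^+ n.+1 / n.+1%:R : R[i].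
(* [r] is the real part of the Taylor remainder on the circle. *)
pose r x := ln (cabs (1 - cj a * cis x)) + complex.Re (P (cj a * cis x)).
have nP : nice (fun x => P (cj a * cis x)).
  apply: (@cbounded_meas_sum _ _ _ _ _ (fun n x => (cj a * cis x) ^+ n.+1 / n.+1%:R)) => n.
  apply: cbounded_measM; last exact: cbounded_meas_cst.
  by apply: cbounded_measX; apply: cbounded_measM (nice_cis R); exact: cbounded_meas_cst.
have nr : rn r by apply: bounded_measD (rn_ln1sub a1) (cbounded_meas_Re nP).
have E : q ^+ M.+1 / (1 - q) = q ^+ M * (q / (1 - q)) by rewrite exprSr mulrA.
have rb x : cabs (r x)%:C <= 2 * (q ^+ M.+1 / (1 - q)).
  have qx : cabs (cj a * cis x) = q by rewrite cabsM cabs_cis mulr1.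
  have := @clog_taylor (cj a * cis x) M; rewrite qx => /(_ ca1).
  by apply: le_trans; rewrite cabs_real; apply: le_trans (normRe_le _); rewrite ReD.
have nskr : nice (fun x => schwarz_ker z x * (r x)%:C) by apply: cbounded_measM (nice_schwarz_ker z1) (cbounded_meas_real nr).
have b1 : cabs (hI (fun x => schwarz_ker z x * (r x)%:C)) <= S * (2 * (q ^+ M.+1 / (1 - q))).
  apply: hI_abs nskr _ => x; rewrite cabsM; apply: ler_pM; rewrite ?cabs_ge0//.
  exact: HS.
have b2 : cabs (clog (1 - cj a * z) + P (cj a * z)) <= 2 * (q ^+ M.+1 / (1 - q)).
  have az1' : cabs (cj a * z) < 1 by apply: le_lt_trans ca1.
  apply: le_trans (clog_taylor M az1') _.
  rewrite ler_wpM2l//; apply: ler_pM; rewrite ?exprn_ge0 ?invr_ge0 ?cabs_ge0 ?subr_ge0//.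
  - exact: ltW.
  - by rewrite lerXn2r ?nnegrE ?cabs_ge0.
  - by rewrite lef_pV2 ?posrE ?subr_gt0// lerD2l lerN2.
have eP : hI (fun x => schwarz_ker z x * (complex.Re (P (cj a * cis x)))%:C) = P (cj a * z).
  pose F n x := (2^-1 / n.+1%:R) * (cj a ^+ n.+1 * (cis x ^+ n.+1 * schwarz_ker z x)
       + a ^+ n.+1 * (cj (cis x) ^+ n.+1 * schwarz_ker z x)).
  have n1 n : nice (fun x => cis x ^+ n.+1 * schwarz_ker z x) by apply: cbounded_measM (nice_schwarz_ker z1); exact: nice_cisX.
  have n2 n : nice (fun x => cj (cis x) ^+ n.+1 * schwarz_ker z x).
    by apply: cbounded_measM (nice_schwarz_ker z1); apply: cbounded_measX; apply: cbounded_meas_conj; exact: nice_cis.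
  have n1' n : nice (fun x => cj a ^+ n.+1 * (cis x ^+ n.+1 * schwarz_ker z x)).
    by apply: cbounded_measM (n1 n); exact: cbounded_meas_cst.
  have n2' n : nice (fun x => a ^+ n.+1 * (cj (cis x) ^+ n.+1 * schwarz_ker z x)).
    by apply: cbounded_measM (n2 n); exact: cbounded_meas_cst.
  have nF n : nice (F n) by apply: cbounded_measM; [exact: cbounded_meas_cst|exact: cbounded_measD].
  rewrite (@hI_ext _ _ (fun x => \sum_(n < M) F n x)) => [|x].
    rewrite cI_sum// /P; apply: eq_bigr => n _.
    rewrite /F cIZ//; last exact: cbounded_measD.
    rewrite cID// cIZ// cIZ// hI_schwarz_kerX// hI_schwarz_kerN// mulr0 addr0 exprMn.
    have n0 : (n.+1%:R : R[i]) != 0 by rewrite pnatr_eq0.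
    have t0 : (2 : R[i]) != 0 by rewrite pnatr_eq0.
    by field; rewrite addrC natr1.
  have -> : (complex.Re (P (cj a * cis x)))%:C = 2^-1 * (P (cj a * cis x) + cj (P (cj a * cis x))).
    have -> : (2^-1 : R[i]) = (2^-1)%:C by rewrite fmorphV rmorph_nat.
    by apply: complex_eq; rewrite ?ReZ ?ImZ ?ReD ?ImD ?Re_conj ?Im_conj/=; lra.
  rewrite /P cj_sum -big_split/= !mulr_sumr; apply: eq_bigr => n _.
  rewrite cjM cjX cjM cjK cjV conjC_nat /F !exprMn.
  set u := cis x ^+ _; set v := cj (cis x) ^+ _; set s := schwarz_ker z x.
  have n0 : (n.+1%:R : R[i]) != 0 by rewrite pnatr_eq0.
  have t0 : (2 : R[i]) != 0 by rewrite pnatr_eq0.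
  by field; rewrite addrC natr1.
have ED : D = hI (fun x => schwarz_ker z x * (r x)%:C) - (clog (1 - cj a * z) + P (cj a * z)).
  rewrite opprD addrA addrAC /D; congr (_ - _).
  rewrite -[in RHS]eP -cIB//; last first.
    by apply: cbounded_measM (nice_schwarz_ker z1) (cbounded_meas_real (cbounded_meas_Re nP)).
  apply: hI_ext => x; rewrite /r rmorphD/= -mulrBr; congr (_ * _).
  by rewrite addrK.
have b1' : cabs D <= 2 * S * (q ^+ M * (q / (1 - q))) + 2 * (q ^+ M * (q / (1 - q))).
  rewrite -E ED; apply: le_trans (cabsD _ _) _; rewrite cabsN; lra.
apply: le_trans b1' _; rewrite le_eqVlt; apply/orP; left; apply/eqP; ring.
Qed.

(** Jensen's formula, as the value of [schwarz_log] at the origin. *)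
Lemma RI_log1sub a : cabs a < 1 -> RI (fun x => ln (cabs (1 - cj a * cis x))) = 0.
Proof.
move=> a1; have := @schwarz_log a 0 a1; rewrite cabs0 ltr01 mulr0 subr0 clog1 => /(_ isT).
rewrite (@hI_ext _ _ (fun x => (ln (cabs (1 - cj a * cis x)))%:C)); last first.
  by move=> x; rewrite /schwarz_ker addr0 subr0 divff ?mul1r// cis_neq0.
by rewrite cI_real//; [case|exact: rn_ln1sub].
Qed.

(** The radius [Re z / 2] keeps the whole segment away from the origin. *)
Lemma clog_quad z : 0 < complex.Re z -> exists e K : R, 0 < e /\
  forall h, cabs h < e -> cabs (clog (z + h) - clog z - h * z^-1) <= K * cabs h ^+ 2.
Proof.
move=> z0; pose e := complex.Re z / 2.
have e0 : 0 < e by rewrite divr_gt0.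
exists e, (2 / (cabs z * e)); split=> // h he.
have zn := Re_neq0 z0.
have Reh : - e < complex.Re h by have := le_lt_trans (normRe_le h) he; rewrite ltr_norml => /andP[].
have Rezh : 0 < complex.Re (z + h) by rewrite ReD; rewrite /e in Reh *; lra.
have -> : clog (z + h) - clog z - h * z^-1 =
  clog (z + h) - clog z - \sum_(n < 1) (h / z) / n.+1%:R by rewrite big_ord1 divr1.
have zp : 0 < cabs z by rewrite cabs_gt0.
have -> : 2 / (cabs z * e) * cabs h ^+ 2 = 2 * (cabs h ^+ 2 / (cabs z * e)).
  by rewrite mulrAC mulrA.
apply: (@clog_path _ _ _ (fun=> h / z)) => // x /andP[x0 x1].
have -> : z + h - z = h by rewrite addrAC subrr add0r.
rewrite big_ord1 expr0 mulr1.
have el : e <= cabs (z + x%:C * h).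
  apply: le_trans (Re_le_cabs _); rewrite ReD ReZ.
  have : - e <= x * complex.Re h.
    have [h0|h0] := leP 0 (complex.Re h); first by have := mulr_ge0 x0 h0; lra.
    by have := ler_wnM2r (ltW h0) x1; rewrite mul1r; lra.
  by rewrite /e; lra.
have zx0 : z + x%:C * h != 0 by rewrite -cabs_gt0; exact: lt_le_trans e0 el.
have -> : h / (z + x%:C * h) - h / z = - (x%:C * h ^+ 2 / (z * (z + x%:C * h))).
  by field; rewrite zx0 zn.
rewrite cabsN cabsf [cabs (x%:C * _)]cabsM [cabs (z * _)]cabsM cabsX cabs_ge0_real//.
apply: ler_pM; rewrite ?mulr_ge0 ?invr_ge0 ?mulr_ge0 ?exprn_ge0 ?cabs_ge0//.
  by rewrite ler_piMl ?sqr_ge0.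
by rewrite lef_pV2 ?posrE ?mulr_gt0 ?cabs_gt0// ler_pM2l.
Qed.

Lemma clog_derivable z : 0 < complex.Re z -> derivable (@clog R : R[i]^o -> R[i]^o) z 1.
Proof. by move=> /clog_quad[e [K [e0 H]]]; have [] := deriv_quad e0 H. Qed.

Lemma cexp_D z w : cexp (z + w) = cexp z * cexp w.
Proof. by rewrite /cexp ReD ImD expRD cis_D rmorphM; ring. Qed.
Lemma cexp0 : cexp (0 : R[i]) = 1.
Proof. by rewrite /cexp/= expR0 cis0 mulr1. Qed.
Lemma cexp_neq0 z : cexp z != 0.
Proof.
by apply/eqP => h; have := cexp_D z (- z); rewrite subrr cexp0 h mul0r => /eqP; rewrite oner_eq0.
Qed.
Lemma cexpN z : cexp (- z) = (cexp z)^-1.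
Proof.
apply: (mulfI (cexp_neq0 z)); rewrite -cexp_D subrr cexp0 divff//; exact: cexp_neq0.
Qed.
Lemma cabs_cexp z : cabs (cexp z) = expR (complex.Re z).
Proof. by rewrite /cexp cabsM cabs_cis mulr1 cabs_ge0_real// expR_ge0. Qed.
Lemma cexp_real x : cexp x%:C = (expR x)%:C.
Proof. by rewrite /cexp/= cis0 mulr1. Qed.

Lemma cexp_ray w x : cexp (x%:C * w) = (expR (x * complex.Re w))%:C * cis (x * complex.Im w).
Proof. by rewrite /cexp ReZ ImZ. Qed.

(** Along [x |-> cexp (x * w)] the derivative is [w * cexp (x * w)]; the two
    coordinates are treated separately to use real calculus. *)
Lemma cexp_path_Re w x : is_derive x 1 (fun u : R => complex.Re (cexp (u%:C * w)))
  (complex.Re (w * cexp (x%:C * w))).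
Proof.
have dl (b : R) : is_derive x 1 (fun u : R => u * b) b.
  have := is_derive_affine 0 b x.
  by rewrite (_ : (fun u => 0 + u * b) = fun u => u * b)//; apply/funext => u; rewrite add0r.
have de := @is_derive1_comp _ (@expR R) _ x _ _ (is_derive_expR _) (dl (complex.Re w)).
have dcs := @is_derive1_comp _ (@cos R) _ x _ _ (is_derive_cos _) (dl (complex.Im w)).
have h := is_derive_mul de dcs.
rewrite (_ : (fun u => _) = (fun u => (expR \o (fun u => u * complex.Re w)) u * (cos \o (fun u => u * complex.Im w)) u)).
  by apply: (is_derive_eq h); rewrite ReM cexp_ray ReZ ImZ/=; ring.
by apply/funext => u; rewrite cexp_ray ReZ.
Qed.
Lemma cexp_path_Im w x : is_derive x 1 (fun u : R => complex.Im (cexp (u%:C * w)))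
  (complex.Im (w * cexp (x%:C * w))).
Proof.
have dl (b : R) : is_derive x 1 (fun u : R => u * b) b.
  have := is_derive_affine 0 b x.
  by rewrite (_ : (fun u => 0 + u * b) = fun u => u * b)//; apply/funext => u; rewrite add0r.
have de := @is_derive1_comp _ (@expR R) _ x _ _ (is_derive_expR _) (dl (complex.Re w)).
have dsn := @is_derive1_comp _ (@sin R) _ x _ _ (is_derive_sin _) (dl (complex.Im w)).
have h := is_derive_mul de dsn.
rewrite (_ : (fun u => _) = (fun u => (expR \o (fun u => u * complex.Re w)) u * (sin \o (fun u => u * complex.Im w)) u)).
  by apply: (is_derive_eq h); rewrite ImM cexp_ray ReZ ImZ/=; ring.
by apply/funext => u; rewrite cexp_ray ImZ.
Qed.

Lemma cexp_bound1 w : cabs w <= 1 -> cabs (cexp w - 1) <= 2 * (expR 1 * cabs w).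
Proof.
move=> w1.
have b x : 0 <= x <= 1 -> cabs (w * cexp (x%:C * w)) <= expR 1 * cabs w.
  move=> /andP[x0 x1]; rewrite cabsM mulrC ler_wpM2r ?cabs_ge0// cabs_cexp ler_expR.
  rewrite ReZ; apply: le_trans (ler_norm _) _; rewrite normrM (ger0_norm x0).
  by rewrite -[leRHS]mulr1 ler_pM//; apply: le_trans (normRe_le _) w1.
have hR := mvt_bound (fun x _ => cexp_path_Re w x) (fun x h => le_trans (normRe_le _) (b x h)).
have hI := mvt_bound (fun x _ => cexp_path_Im w x) (fun x h => le_trans (normIm_le _) (b x h)).
rewrite mul1r mul0r cexp0 in hR hI.
by apply: le_trans (cabs_le_ReIm _) _; rewrite !ReD !ImD !ReN !ImN; lra.
Qed.

(** The mean value theorem twice: [cexp_bound1] bounds the derivative of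
    [cexp (x * w) - x * w]. *)
Lemma cexp_bound2 w : cabs w <= 1 -> cabs (cexp w - 1 - w) <= 4 * expR 1 * cabs w ^+ 2.
Proof.
move=> w1.
have b x : 0 <= x <= 1 -> cabs (w * cexp (x%:C * w) - w) <= 2 * expR 1 * cabs w ^+ 2.
  move=> /andP[x0 x1]; have xw : cabs (x%:C * w) <= cabs w.
    by rewrite cabsM cabs_ge0_real// ler_piMl ?cabs_ge0.
  have -> : w * cexp (x%:C * w) - w = w * (cexp (x%:C * w) - 1) by rewrite mulrBr mulr1.
  rewrite cabsM; have := cexp_bound1 (le_trans xw w1).
  have := expR_ge0 (1 : R); have w0 := cabs_ge0 w => e0 h.
  apply: le_trans (ler_wpM2l w0 h) _.
  have -> : 2 * expR 1 * cabs w ^+ 2 = cabs w * (2 * (expR 1 * cabs w)) by ring.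
  by rewrite ler_wpM2l// ler_wpM2l// ler_wpM2l.
have dR x : is_derive x 1 (fun u : R => complex.Re (cexp (u%:C * w)) - u * complex.Re w)
   (complex.Re (w * cexp (x%:C * w) - w)).
  rewrite ReD ReN; apply: is_deriveB (cexp_path_Re w x) _.
  have := is_derive_affine 0 (complex.Re w) x.
  by rewrite (_ : (fun u => 0 + u * _) = fun u => u * complex.Re w)//; apply/funext => u; rewrite add0r.
have dI x : is_derive x 1 (fun u : R => complex.Im (cexp (u%:C * w)) - u * complex.Im w)
   (complex.Im (w * cexp (x%:C * w) - w)).
  rewrite ImD ImN; apply: is_deriveB (cexp_path_Im w x) _.
  have := is_derive_affine 0 (complex.Im w) x.
  by rewrite (_ : (fun u => 0 + u * _) = fun u => u * complex.Im w)//; apply/funext => u; rewrite add0r.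
have hR := mvt_bound (fun x _ => dR x) (fun x h => le_trans (normRe_le _) (b x h)).
have hI := mvt_bound (fun x _ => dI x) (fun x h => le_trans (normIm_le _) (b x h)).
rewrite !mul1r !mul0r cexp0 ?subr0 in hR; rewrite !mul1r !mul0r cexp0 ?subr0 in hI.
apply: le_trans (cabs_le_ReIm _) _; rewrite !ReD !ImD !ReN !ImN.
have eR : complex.Re (cexp w) - complex.Re w - complex.Re (1 : R[i]) =
  complex.Re (cexp w) - complex.Re 1 - complex.Re w by ring.
have eI : complex.Im (cexp w) - complex.Im w =
  complex.Im (cexp w) - complex.Im 1 - complex.Im w by rewrite /= subr0.
rewrite -eR -eI; lra.
Qed.

Lemma cexp_derivable z : derivable (@cexp R : R[i]^o -> R[i]^o) z 1.
Proof.
have e0 : (0 : R) < 1 by [].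
suff H (h : R[i]) : cabs h < 1 ->
    cabs (cexp (z + h) - cexp z - h * cexp z) <= cabs (cexp z) * (4 * expR 1) * cabs h ^+ 2.
  by have [] := deriv_quad e0 H.
move=> h1; have -> : cexp (z + h) - cexp z - h * cexp z = cexp z * (cexp h - 1 - h).
  by rewrite cexp_D; ring.
by rewrite cabsM -mulrA ler_wpM2l ?cabs_ge0// cexp_bound2// ltW.
Qed.

End clog2.

(** * Radial boundary values and circle norms *)

Import HBNNSimple.
(** The function [f] need not be measurable: its integral is a supremum over
    simple functions, each of which is below [g] almost everywhere.  This suits
    boundary functions, which are controlled only almost everywhere. *)
Lemma le_integral_ae d (T : measurableType d) (R : realType)
    (mu : {measure set T -> \bar R}) (f g : T -> \bar R) :
  (forall x, 0 <= f x)%E -> (forall x, 0 <= g x)%E -> measurable_fun setT g ->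
  {ae mu, forall x, (f x <= g x)%E} -> (\int[mu]_x f x <= \int[mu]_x g x)%E.
Proof.
move=> f0 g0 mg fg; rewrite [leLHS]ge0_integralTE//.
apply: ge_ereal_sup => _ [h /= hf <-]; rewrite -integralT_nnsfun.
apply: ae_ge0_le_integral => //.
- by move=> x _; rewrite lee_fin.
- by apply/measurable_EFinP.
- by apply: filterS fg => x fgx _; exact: le_trans (hf x) fgx.
Qed.

Lemma ae_mono d (T : measurableType d) (R : realType)
    (mu : {measure set T -> \bar R}) (P Q : T -> Prop) :
  {ae mu, forall x, P x} -> (forall x, P x -> Q x) -> {ae mu, forall x, Q x}.
Proof. by move=> H PQ; apply: filterS H. Qed.

Lemma ae_and d (T : measurableType d) (R : realType)
    (mu : {measure set T -> \bar R}) (P Q : T -> Prop) :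
  {ae mu, forall x, P x} -> {ae mu, forall x, Q x} -> {ae mu, forall x, P x /\ Q x}.
Proof. by move=> HP HQ; exact: (@filterI _ (almost_everywhere mu)). Qed.

Section boundary.
Variable R : realType.
Local Notation cj z := (@Num.conj R[i] z).
Implicit Types (z w zeta : R[i]) (x y r : R) (f g h : R[i] -> R[i]).
Local Notation mu := (haar R).
Local Notation T := (measurableTypeR R).

Lemma near_left1 (P : R -> Prop) (d : R) : 0 < d ->
  (forall r, 1 - d < r -> r < 1 -> P r) -> \forall r \near (1 : R)^'-, P r.
Proof.
move=> d0 H; near=> r; apply: H; near: r; last exact: nbhs_left_lt.
by apply: nbhs_left_gt; rewrite gtrBl.
Unshelve. all: by end_near.
Qed.

Lemma boundaryP f zeta (L : R[i]) :
  (forall e : R, 0 < e -> exists2 d : R, 0 < d & forall r, 1 - d < r -> r < 1 ->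
     cabs (L - f (r%:C * zeta)) < e) -> boundary f zeta = L.
Proof.
move=> H; rewrite /boundary; apply: cvg_cabs_unique => e /H[d d0 {}H].
exact: near_left1 d0 H.
Qed.

Lemma boundary_ext f g zeta : cabs zeta = 1 ->
  (forall z, disc z -> f z = g z) -> boundary f zeta = boundary g zeta.
Proof.
move=> z1 fg; rewrite /boundary.
have near_fg : \forall r \near (1 : R)^'-, f (r%:C * zeta) = g (r%:C * zeta).
  apply: (@near_left1 _ 1) => // r; rewrite subrr => r0 r1; apply: fg.
  by rewrite /disc/= cabsM z1 mulr1 cabs_ge0_real// ltW.
pose F f := fmap (fun r : R => f (r%:C * zeta) : R[i]^o) (nbhs (1 : R)^'-).
suff FG : F f = F g by rewrite -[fmap _ _]/(F f) FG.
by apply/seteqP; split; apply: near_eq_cvg; apply: filterS near_fg => r ->.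
Qed.

Lemma derivable_cont f zeta (e : R) : derivable (f : R[i]^o -> R[i]^o) zeta 1 -> 0 < e ->
  exists2 d : R, 0 < d & forall w, cabs (zeta - w) < d -> cabs (f zeta - f w) < e.
Proof.
move=> /derivable1_diffP/differentiable_continuous fc e0.
have /ccvgP := fc => /(_ e e0) /nbhs_ballP[d /= d0 H].
have dE : d = (complex.Re d)%:C.
  by apply: complex_eq => //=; move: d0; rewrite ltcE/= => /andP[/eqP].
exists (complex.Re d); first by move: d0; rewrite ltcE => /andP[].
move=> w wd; apply: H; rewrite -ball_normE /ball_/= dE normE ltcR//.
Qed.

Lemma boundary_derivable f zeta : cabs zeta = 1 ->
  derivable (f : R[i]^o -> R[i]^o) zeta 1 -> boundary f zeta = f zeta.
Proof.
move=> z1 df; apply: boundaryP => e e0; have [d d0 H] := derivable_cont df e0.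
exists (Num.min d 1); first by rewrite lt_min d0 ltr01.
move=> r dr r1; apply: H.
have -> : zeta - r%:C * zeta = (1 - r)%:C * zeta by rewrite rmorphB rmorph1 mulrBl mul1r.
have dd : Num.min d 1 <= d by rewrite ge_min lexx.
by rewrite cabsM z1 mulr1 cabs_ge0_real; lra.
Qed.

(** A radial limit that does not exist is given the value 0, so a nonzero
    boundary value is a genuine limit. *)
Lemma boundary_cvg h zeta : boundary h zeta != 0 ->
  (h (r%:C * zeta) : R[i]^o) @[r --> (1 : R)^'-] --> (boundary h zeta : R[i]^o).
Proof.
move=> h0; rewrite /boundary; apply/cvg_ex; apply: contrapT => H.
move: h0 => /eqP; apply; rewrite /boundary /lim /lim_in; case: xgetP => // l _ Hl.
by exfalso; apply: H; exists l.
Qed.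

Lemma boundary_mul p h zeta : cabs zeta = 1 ->
  derivable (p : R[i]^o -> R[i]^o) zeta 1 -> boundary h zeta != 0 ->
  boundary (fun z => p z * h z) zeta = p zeta * boundary h zeta.
Proof.
move=> z1 dp h0; rewrite [LHS]/boundary.
apply: (@cvg_lim (GRing.regular R[i])); first exact: norm_hausdorff.
apply: (@cvgM _ _ _ _ (fun r : R => p (r%:C * zeta) : R[i]^o) (fun r : R => h (r%:C * zeta) : R[i]^o)).
  apply/ccvgP => e e0; have [d d0 H] := derivable_cont dp e0.
  apply: (@near_left1 _ d) => // r dr r1; apply: H.
  have -> : zeta - r%:C * zeta = (1 - r)%:C * zeta by rewrite rmorphB rmorph1 mulrBl mul1r.
  by rewrite cabsM z1 mulr1 cabs_ge0_real; lra.
exact: boundary_cvg.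
Qed.

Lemma circle_normE (u : R) g : 0 < u ->
  circle_norm u g = ((\int[mu]_x ((cabs (g (cis x)) `^ u)%:E)) `^ u^-1)%E.
Proof.
move=> u0; rewrite /circle_norm unlock; congr (_ `^ _)%E.
by apply: eq_integral => x _ /=; rewrite ger0_norm ?cabs_ge0.
Qed.

Lemma circle_norm_ge0 (u : R) g : (0 <= circle_norm u g)%E.
Proof. exact: Lnorm_ge0. Qed.

Lemma circle_norm_pow_le (u : R) g (v : T -> R) : 0 < u ->
  (forall x, 0 <= v x) -> measurable_fun setT v ->
  {ae mu, forall x, cabs (g (cis x)) `^ u <= v x} ->
  (circle_norm u g `^ u <= \int[mu]_x (v x)%:E)%E.
Proof.
move=> u0 v0 mv H; rewrite circle_normE// -poweRrM mulVf ?gt_eqF// poweRe1.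
  apply: le_integral_ae => //.
  - by move=> x; rewrite lee_fin powR_ge0.
  - by apply/measurable_EFinP.
by apply: integral_ge0 => x _; rewrite lee_fin powR_ge0.
Qed.

Lemma circle_norm_le_bound (u : R) g (B : R) : 0 < u -> 0 <= B ->
  (forall x, cabs (g (cis x)) <= B) -> (circle_norm u g <= B%:E)%E.
Proof.
move=> u0 B0 H; rewrite circle_normE//.
have -> : B%:E = ((\int[mu]_x ((B `^ u)%:E)) `^ u^-1)%E.
  rewrite integral_cst// [X in (_ * X)%E](_ : _ = 1%E); last exact: probability_setT.
  by rewrite mule1 poweR_EFin -powRrM divff ?gt_eqF// powRr1.
rewrite gt0_ler_poweR ?invr_ge0 ?(ltW u0)//.
- by rewrite in_itv/= leey andbT integral_ge0// => x _; rewrite lee_fin powR_ge0.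
- by rewrite in_itv/= leey andbT integral_ge0// => x _; rewrite lee_fin powR_ge0.
apply: le_integral_ae => //.
- by move=> x; rewrite lee_fin powR_ge0.
- by move=> x; rewrite lee_fin powR_ge0.
apply: nearW => x; rewrite lee_fin ge0_ler_powR ?nnegrE ?cabs_ge0// ltW//.
Qed.

End boundary.

(** * The kernels, and outer functions with one Poisson kernel *)

Section kernel.
Variable R : realType.
Local Notation cj z := (@Num.conj R[i] z).
Implicit Types (a z w zeta : R[i]) (x y r s t : R) (f g h : R[i] -> R[i]).
Local Notation mu := (haar R).
Local Notation T := (measurableTypeR R).
Local Notation nice f := (@cbounded_meas _ T R setT f).
Local Notation rn f := (@bounded_meas _ T R setT f).
Local Notation hI f := (cintegral mu setT f).
Local Notation RI u := (\int[mu]_x u x)%R.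

Lemma Re_clog z : complex.Re (clog z) = ln (cabs z). Proof. by []. Qed.

Lemma one_sub_gt0 a : disc a -> 0 < 1 - cabs a ^+ 2.
Proof. by move=> a1; rewrite subr_gt0 expr_lt1// cabs_ge0. Qed.

(** Writing both powers as one exponential makes the modulus, the derivative and
    the Schwarz formula immediate. *)
Lemma kernelE t a z : disc a -> kernel_fun t a z =
  cexp ((t^-1 * ln (1 - cabs a ^+ 2))%:C - (2 / t)%:C * clog (1 - cj a * z)).
Proof.
move=> /one_sub_gt0 A0; rewrite /kernel_fun cexp_D cexpN cexp_real; congr (_%:C * _).
by rewrite /powR gt_eqF.
Qed.

Lemma cabs_kernel t a z : disc a ->
  cabs (kernel_fun t a z) = expR (t^-1 * (ln (1 - cabs a ^+ 2) - 2 * ln (cabs (1 - cj a * z)))).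
Proof.
by move=> a1; rewrite kernelE// cabs_cexp ReD ReN ReZ Re_clog/=; congr expR; ring.
Qed.

Lemma kernel_neq0 t a z : disc a -> kernel_fun t a z != 0.
Proof. by move=> a1; rewrite -cabs_gt0 cabs_kernel// expR_gt0. Qed.

Lemma kernel_pow t a z : t != 0 -> disc a -> 1 - cj a * z != 0 ->
  cabs (kernel_fun t a z) `^ t = poisson a z.
Proof.
move=> t0 a1 n0; have A0 := one_sub_gt0 a1.
have N0 : 0 < cabs (1 - cj a * z) by rewrite cabs_gt0.
rewrite cabs_kernel//.
have -> : 2 * ln (cabs (1 - cj a * z)) = ln (cabs (1 - cj a * z) ^+ 2).
  by rewrite lnXn// -[ln _ *+ 2]mulr_natl.
rewrite -expRM mulrAC mulVf// mul1r /poisson expRD lnK ?posrE//.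
by rewrite expRN lnK ?posrE ?exprn_gt0.
Qed.

Lemma disc_le1 a z : disc a -> cabs z <= 1 -> cabs (cj a * z) < 1.
Proof.
move=> a1 z1; rewrite cabsM cabs_conj.
have := cabs_ge0 a; have := cabs_ge0 z => z0 a0.
by apply: le_lt_trans a1; rewrite ler_piMr.
Qed.

Lemma lin_neq0 a z : disc a -> cabs z <= 1 -> 1 - cj a * z != 0.
Proof. by move=> a1 z1; apply: Re_neq0; apply: Re_1sub; exact: disc_le1. Qed.

Lemma kernel_derivable t a z : disc a -> cabs z <= 1 ->
  derivable (kernel_fun t a : R[i]^o -> R[i]^o) z 1.
Proof.
move=> a1 z1.
have -> : kernel_fun t a = fun z =>
  cexp ((t^-1 * ln (1 - cabs a ^+ 2))%:C - (2 / t)%:C * clog (1 - cj a * z)).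
  by apply/funext => w; rewrite kernelE.
pose lin (p q w : R[i]) : R[i] := p - q * w.
pose u : R[i] -> R[i] := lin 1 (cj a).
pose v : R[i] -> R[i] := lin (t^-1 * ln (1 - cabs a ^+ 2))%:C (2 / t)%:C.
have aff (p q w : R[i]) : differentiable (lin p q : R[i]^o -> R[i]^o) (w : R[i]^o).
  apply/derivable1_diffP.
  have e0 : (0 : R) < 1 by [].
  suff H (h : R[i]) : cabs h < 1 -> cabs (lin p q (w + h) - lin p q w - h * (- q)) <= 0 * cabs h ^+ 2.
    by have [] := @deriv_quad R (lin p q) w (- q) 0 1 e0 H.
  move=> _; rewrite /lin; have -> : p - q * (w + h) - (p - q * w) - h * (- q) = 0 by ring.
  by rewrite cabs0 mul0r.
apply/derivable1_diffP.
have d1 := aff 1 (cj a) z.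
have d2 : differentiable (@clog R : R[i]^o -> R[i]^o) (u z : R[i]^o).
  by apply/derivable1_diffP; apply: clog_derivable; apply: Re_1sub; exact: disc_le1.
have d3 := aff (t^-1 * ln (1 - cabs a ^+ 2))%:C (2 / t)%:C (clog (u z)).
have d4 : differentiable (@cexp R : R[i]^o -> R[i]^o) (v (clog (u z)) : R[i]^o).
  by apply/derivable1_diffP; exact: cexp_derivable.
have d12 := @differentiable_comp _ _ _ _ (u : R[i]^o -> R[i]^o) (@clog R : R[i]^o -> R[i]^o) z d1 d2.
have d123 := @differentiable_comp _ _ _ _ (_ : R[i]^o -> R[i]^o) (v : R[i]^o -> R[i]^o) z d12 d3.
exact: (@differentiable_comp _ _ _ _ (_ : R[i]^o -> R[i]^o) (@cexp R : R[i]^o -> R[i]^o) z d123 d4).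
Qed.

Lemma scale_derivable (lambda : R[i]) f z : derivable (f : R[i]^o -> R[i]^o) z 1 ->
  derivable ((fun w => lambda * f w) : R[i]^o -> R[i]^o) z 1.
Proof. by move=> df; exact: (@derivableZ _ _ _ (f : R[i]^o -> R[i]^o) lambda z 1). Qed.

Lemma ln_cabs_kernel t a x : disc a ->
  ln (cabs (kernel_fun t a (cis x))) =
   t^-1 * ln (1 - cabs a ^+ 2) - 2 / t * ln (cabs (1 - cj a * cis x)).
Proof. by move=> a1; rewrite cabs_kernel// expRK; ring. Qed.

(** Exponentiating the Schwarz integral of the logarithm of the modulus gives the
    kernel back: the kernels are outer. *)
Lemma schwarz_ln_kernel t a z : disc a -> disc z ->
  cexp (hI (fun x => schwarz_ker z x * (ln (cabs (kernel_fun t a (cis x))))%:C)) = kernel_fun t a z.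
Proof.
move=> a1 z1; rewrite kernelE//; congr cexp.
have n1 := nice_schwarz_ker z1.
have n2 : nice (fun x => schwarz_ker z x * (ln (cabs (1 - cj a * cis x)))%:C).
  by apply: cbounded_measM n1 (cbounded_meas_real _); exact: rn_ln1sub.
have n3 : nice (fun x => (2 / t)%:C * (schwarz_ker z x * (ln (cabs (1 - cj a * cis x)))%:C)).
  by apply: cbounded_measM n2; exact: cbounded_meas_cst.
have n4 : nice (fun x => (t^-1 * ln (1 - cabs a ^+ 2))%:C * schwarz_ker z x).
  by apply: cbounded_measM n1; exact: cbounded_meas_cst.
rewrite (@hI_ext _ _ (fun x => (t^-1 * ln (1 - cabs a ^+ 2))%:C * schwarz_ker z x -
   (2 / t)%:C * (schwarz_ker z x * (ln (cabs (1 - cj a * cis x)))%:C))).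
  by rewrite cIB// !cIZ// hI_schwarz_ker// mulr1 schwarz_log.
by move=> x; rewrite ln_cabs_kernel// rmorphB rmorphM/=; ring.
Qed.

Section scaled.
Variables (t : R) (a lambda : R[i]) (h : R[i] -> R[i]).
Hypotheses (t0 : 0 < t) (a1 : disc a) (l1 : cabs lambda = 1)
  (hE : forall z, disc z -> h z = lambda * kernel_fun t a z).

Lemma scaled_holo : holomorphic_on_disc (h : R[i]^o -> R[i]^o).
Proof.
move=> z /= z1; have z1' : 0 < 1 - cabs z by rewrite subr_gt0.
have d := @scale_derivable lambda _ _ (@kernel_derivable t _ _ a1 (ltW z1)).
have H k : cabs k < 1 - cabs z -> (fun w => lambda * kernel_fun t a w) (z + k) = h (z + k).
  by move=> kz; rewrite hE//=; have := cabsD z k; rewrite /disc/=; lra.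
by have [] := @deriv_loc R _ h z _ _ z1' H (conj d erefl).
Qed.

Lemma scaled_boundary x : boundary h (cis x) = lambda * kernel_fun t a (cis x).
Proof.
rewrite (@boundary_ext _ _ (fun w => lambda * kernel_fun t a w)) ?cabs_cis//.
rewrite boundary_derivable ?cabs_cis//.
by apply: scale_derivable; apply: kernel_derivable; rewrite ?cabs_cis.
Qed.

Lemma scaled_cabs_boundary x : cabs (boundary h (cis x)) = cabs (kernel_fun t a (cis x)).
Proof. by rewrite scaled_boundary cabsM l1 mul1r. Qed.

Lemma rn_ln_kernel : rn (fun x => ln (cabs (kernel_fun t a (cis x)))).
Proof.
apply: (@bounded_meas_eq _ _ _ _ (fun x => t^-1 * ln (1 - cabs a ^+ 2) - 2 / t * ln (cabs (1 - cj a * cis x)))).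
  by move=> x; rewrite ln_cabs_kernel.
apply: bounded_measB; first exact: bounded_meas_cst.
by apply: bounded_measM; [exact: bounded_meas_cst|exact: rn_ln1sub].
Qed.

Lemma scaled_hardy : hardy t h.
Proof.
split; first exact: scaled_holo.
pose B := expR (t^-1 * (ln (1 - cabs a ^+ 2) - 2 * ln (1 - cabs a))).
apply: (@le_lt_trans _ _ B%:E); last by rewrite ltry.
apply: ge_ereal_sup => _ [r /= /andP[r0 r1] <-].
apply: circle_norm_le_bound => //; first exact: expR_ge0.
move=> x.
have rx : cabs (r%:C * cis x) = r by rewrite cabsM cabs_cis mulr1 cabs_ge0_real.
rewrite hE; last by change (is_true (cabs (r%:C * cis x) < 1)); rewrite rx.
rewrite cabsM l1 mul1r cabs_kernel// ler_expR ler_wpM2l ?invr_ge0 ?(ltW t0)//.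
rewrite lerD2l lerN2 ler_wpM2l// ler_ln ?posrE ?subr_gt0//; last first.
  by rewrite cabs_gt0 lin_neq0// rx ltW.
have := cabs_sub_ge 1 (cj a * (r%:C * cis x)); rewrite cabs1 cabsM cabs_conj rx.
have : cabs a * r <= cabs a by rewrite ler_piMr ?cabs_ge0// ltW.
lra.
Qed.

Lemma scaled_outer : outer h.
Proof.
exists lambda; split=> //.
- by apply: nearW => x; rewrite scaled_boundary mulf_neq0 ?kernel_neq0// -cabs_eq0 l1 oner_neq0.
- under eq_fun do rewrite scaled_cabs_boundary.
  exact: bounded_meas_integrable rn_ln_kernel.
- move=> z z1; rewrite hE// -(@schwarz_ln_kernel t _ _ a1 z1); congr (_ * cexp _).
  by apply: hI_ext => x; rewrite scaled_cabs_boundary.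
Qed.

(** For several kernels, repeat the same point with equal weights. *)
Lemma scaled_test K : (0 < K)%N -> test_family t K h.
Proof.
move=> K0; split; [exact: scaled_hardy|exact: scaled_outer|].
have KR : (K%:R : R) != 0 by rewrite pnatr_eq0 -lt0n.
exists (fun=> a), (fun=> K%:R^-1); split=> //.
  by rewrite sumr_const card_ord -[K%:R^-1 *+ K]mulr_natl divff.
apply: nearW => x; rewrite scaled_cabs_boundary kernel_pow ?(gt_eqF t0) ?lin_neq0 ?cabs_cis//.
by rewrite sumr_const card_ord -mulrnAl -[K%:R^-1 *+ K]mulr_natl mulfV ?mul1r.
Qed.
End scaled.

(** The Schwarz integral does not see null sets, so a modulus known almost
    everywhere determines an outer function up to a unimodular factor. *)
Lemma outer_modulus h (u : T -> R) : outer h -> measurable_fun setT u ->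
  {ae mu, forall x, ln (cabs (boundary h (cis x))) = u x} ->
  exists lambda, cabs lambda = 1 /\
   forall z, disc z -> h z = lambda * cexp (hI (fun x => schwarz_ker z x * (u x)%:C)).
Proof.
move=> [lambda [l1 _ il hE]] mu_ H; exists lambda; split=> // w w1.
rewrite hE//; congr (_ * cexp _).
have ml : measurable_fun setT (fun x : T => ln (cabs (boundary h (cis x)))).
  by apply/measurable_EFinP; exact: measurable_int il.
have [mR mI _] := nice_schwarz_ker w1.
rewrite /cintegral; congr (_ +i* _); congr fine; apply: ae_eq_integral => //.
- apply/measurable_EFinP; under eq_fun do rewrite mulrC ReZ.
  exact: measurable_funM.
- apply/measurable_EFinP; under eq_fun do rewrite mulrC ReZ.
  exact: measurable_funM.
- by apply: ae_mono H _ => x e _; rewrite e.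
- apply/measurable_EFinP; under eq_fun do rewrite mulrC ImZ.
  exact: measurable_funM.
- apply/measurable_EFinP; under eq_fun do rewrite mulrC ImZ.
  exact: measurable_funM.
- by apply: ae_mono H _ => x e _; rewrite e.
Qed.

Lemma test_family1 t h : 0 < t -> test_family t 1 h <->
    exists a lambda : R[i],
      [/\ disc a, cabs lambda = 1 &
          forall z, disc z -> h z = lambda * kernel_fun t a z].
Proof.
move=> t0; split; last first.
  by move=> [a [lambda [a1 l1 hE]]]; exact: scaled_test t0 a1 l1 hE _ (ltn0Sn 0).
move=> [hh oh [a [c [a1 c0 c1 H]]]].
pose b := a ord0; have b1 : disc b := a1 ord0.
have cE : c ord0 = 1 by move: c1; rewrite big_ord1.
have H' : {ae mu, forall x, ln (cabs (boundary h (cis x))) = ln (cabs (kernel_fun t b (cis x)))}.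
  apply: ae_mono H _ => x; rewrite big_ord1 cE mul1r.
  rewrite -(@kernel_pow t) ?(gt_eqF t0) ?lin_neq0 ?cabs_cis// => e; congr ln.
  by have := congr1 (fun u => u `^ t^-1) e; rewrite -!powRrM divff ?(gt_eqF t0)// !powRr1 ?cabs_ge0.
have [mk _] := @rn_ln_kernel t _ b1.
have [lambda [l1 hE]] := outer_modulus oh mk H'.
by exists b, lambda; split=> // z z1; rewrite hE// schwarz_ln_kernel.
Qed.
End kernel.

(** * Spread Dirichlet sums against Poisson kernels *)

Section block.
Variable R : realType.
Local Notation cj z := (@Num.conj R[i] z).
Implicit Types (a z w zeta : R[i]) (x y r s t : R) (f g h : R[i] -> R[i]).
Local Notation mu := (haar R).
Local Notation T := (measurableTypeR R).
Local Notation nice f := (@cbounded_meas _ T R setT f).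
Local Notation rn f := (@bounded_meas _ T R setT f).
Local Notation hI f := (cintegral mu setT f).
Local Notation RI u := (\int[mu]_x u x)%R.

Definition dirichlet (L : nat) w : R[i] := \sum_(l < L) w ^+ l.

Lemma nice_cjX n : nice (fun x => cj (cis x) ^+ n).
Proof. by apply: cbounded_measX; apply: cbounded_meas_conj; exact: nice_cis. Qed.

Lemma cis_cjX x m n : cis x ^+ m * cj (cis x) ^+ n =
  if (n <= m)%N then cis x ^+ (m - n) else cj (cis x) ^+ (n - m).
Proof.
case: leqP => [nm|/ltnW mn].
  by rewrite -{1}(subnK nm) exprD -mulrA -exprMn cis_mul_conj expr1n mulr1.
by rewrite -{1}(subnK mn) exprD mulrCA -exprMn cis_mul_conj expr1n mulr1.
Qed.

Lemma hI_orth m n : hI (fun x => cis x ^+ m * cj (cis x) ^+ n) = (m == n)%:R.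
Proof.
rewrite (@hI_ext _ _ (fun x => if (n <= m)%N then cis x ^+ (m - n) else cj (cis x) ^+ (n - m))); last first.
  by move=> x; rewrite cis_cjX.
case: leqP => nm; first by rewrite hI_cisX subn_eq0 eqn_leq nm andbT.
by rewrite hI_cis_conjX subn_eq0 leqNgt nm eqn_leq [(n <= m)%N]leqNgt nm andbF.
Qed.

(** Poisson kernels damp the frequency [m - n] by [|a|^|m - n|]; the truncated
    subtractions below express that distance. *)
Lemma hI_orth_poisson a m n : cabs a < 1 ->
  cabs (hI (fun x => cis x ^+ m * cj (cis x) ^+ n * (poisson a (cis x))%:C))
   = cabs a ^+ ((m - n) + (n - m)).
Proof.
move=> a1; have np := nice_poisson a1.
rewrite (@hI_ext _ _ (fun x => if (n <= m)%N then cis x ^+ (m - n) * (poisson a (cis x))%:C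
   else cj (cis x ^+ (n - m) * (poisson a (cis x))%:C))); last first.
  by move=> x; rewrite cis_cjX; case: ifP => // _; rewrite cjM cjX conj_real.
case: leqP => nm; first by rewrite hI_poisson// cabsX (eqP nm) addn0.
have n1 : nice (fun x => cis x ^+ (n - m) * (poisson a (cis x))%:C).
  by apply: cbounded_measM (nice_cisX _ _) (cbounded_meas_real np).
rewrite cI_conj//.
by rewrite cabs_conj hI_poisson// cabsX (eqP (ltnW nm)).
Qed.

Lemma cabs_dirichlet L w : cabs w <= 1 -> cabs (dirichlet L w) <= L%:R.
Proof.
move=> w1; apply: le_trans (cabs_sum _ _ _) _.
rewrite -[X in _ <= X%:R]card_ord -sumr_const; apply: ler_sum => i _.
by rewrite cabsX exprn_ile1 ?cabs_ge0.
Qed.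

Lemma cabs_cisX x n : cabs (cis x ^+ n) = 1.
Proof. by rewrite cabsX cabs_cis expr1n. Qed.

Lemma nice_dirichlet L N : nice (fun x => dirichlet L (cis x ^+ N)).
Proof.
apply: (@cbounded_meas_sum _ _ _ _ _ (fun l x => (cis x ^+ N) ^+ l)) => l.
by apply: cbounded_measX; exact: nice_cisX.
Qed.

Lemma rn_dirichlet2 L N : rn (fun x => cabs (dirichlet L (cis x ^+ N)) ^+ 2).
Proof. exact: (@bounded_measX _ _ _ _ (fun x => cabs (dirichlet L (cis x ^+ N))) 2 (bounded_meas_cabs (nice_dirichlet L N))). Qed.

Lemma dirichlet_sqr L N x : (cabs (dirichlet L (cis x ^+ N)) ^+ 2)%:C =
  \sum_(i < L) \sum_(j < L) cis x ^+ (N * i) * cj (cis x) ^+ (N * j).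
Proof.
rewrite -mul_conj /dirichlet cj_sum mulr_suml; apply: eq_bigr => i _.
by rewrite mulr_sumr; apply: eq_bigr => j _; rewrite cjX cjX -!exprM.
Qed.

Lemma RI_real (u : T -> R) (r : R) : rn u -> hI (fun x => (u x)%:C) = r%:C -> RI u = r.
Proof. by move=> nu; rewrite cI_real// => -[]. Qed.

Lemma RI_dirichlet2 L N : (0 < N)%N -> RI (fun x => cabs (dirichlet L (cis x ^+ N)) ^+ 2) = L%:R.
Proof.
move=> N0; apply: RI_real; first exact: rn_dirichlet2.
have n1 i j : nice (fun x => cis x ^+ (N * i) * cj (cis x) ^+ (N * j)).
  by apply: cbounded_measM (nice_cisX _ _) (nice_cjX _).
rewrite (@hI_ext _ _ (fun x => \sum_(i < L) \sum_(j < L) cis x ^+ (N * i) * cj (cis x) ^+ (N * j))); last first.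
  by move=> x; rewrite dirichlet_sqr.
rewrite (@hI_sum _ _ (fun i x => \sum_(j < L) cis x ^+ (N * i) * cj (cis x) ^+ (N * j)))//; last first.
  by move=> i; apply: (@cbounded_meas_sum _ _ _ _ _ (fun j x => cis x ^+ (N * i) * cj (cis x) ^+ (N * j))) => j; exact: n1.
rewrite (eq_bigr (fun=> 1)); first by rewrite sumr_const card_ord rmorph_nat.
move=> i _.
rewrite (@hI_sum _ _ (fun j x => cis x ^+ (N * i) * cj (cis x) ^+ (N * j)))//.
under eq_bigr do rewrite hI_orth eqn_pmul2l//.
rewrite (bigD1 i)//= eqxx big1 ?addr0// => j ji.
by rewrite eq_sym (negbTE (ji : (j : nat) != i)).
Qed.

(** The diagonal terms give [L]; each of the other frequencies is a nonzero
    multiple of [N], so its contribution is at most [r^N]. *)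
Lemma RI_dirichlet2_poisson L N a r : (0 < N)%N -> cabs a <= r -> r < 1 -> L%:R * r ^+ N <= 1 ->
  RI (fun x => cabs (dirichlet L (cis x ^+ N)) ^+ 2 * poisson a (cis x)) <= 2 * L%:R.
Proof.
move=> N0 ar r1 Lr; have a1 : cabs a < 1 by apply: le_lt_trans r1.
have np := nice_poisson a1.
set F := fun x => cabs (dirichlet L (cis x ^+ N)) ^+ 2 * poisson a (cis x).
have nF : rn F by apply: bounded_measM (rn_dirichlet2 L N) np.
have n1 i j : nice (fun x => cis x ^+ (N * i) * cj (cis x) ^+ (N * j) * (poisson a (cis x))%:C).
  by apply: cbounded_measM (cbounded_meas_real np); apply: cbounded_measM (nice_cisX _ _) (nice_cjX _).
suff : cabs (hI (fun x => (F x)%:C)) <= 2 * L%:R.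
  by rewrite cI_real// cabs_real => /(le_trans (ler_norm _)).
rewrite (@hI_ext _ _ (fun x => \sum_(i < L) \sum_(j < L) cis x ^+ (N * i) * cj (cis x) ^+ (N * j) * (poisson a (cis x))%:C)); last first.
  by move=> x; rewrite rmorphM/= dirichlet_sqr mulr_suml; apply: eq_bigr => i _; rewrite mulr_suml.
rewrite (@hI_sum _ _ (fun i x => \sum_(j < L) cis x ^+ (N * i) * cj (cis x) ^+ (N * j) * (poisson a (cis x))%:C))//; last first.
  by move=> i; apply: (@cbounded_meas_sum _ _ _ _ _ (fun j x => cis x ^+ (N * i) * cj (cis x) ^+ (N * j) * (poisson a (cis x))%:C)) => j; exact: n1.
apply: le_trans (cabs_sum _ _ _) _.
have -> : 2 * L%:R = \sum_(i < L) 2 :> R by rewrite sumr_const card_ord mulr_natr.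
apply: ler_sum => i _.
rewrite (@hI_sum _ _ (fun j x => cis x ^+ (N * i) * cj (cis x) ^+ (N * j) * (poisson a (cis x))%:C))//.
apply: le_trans (cabs_sum _ _ _) _.
under eq_bigr do rewrite hI_orth_poisson//.
rewrite (bigD1 i)//= subnn addn0 expr0 lerD2l.
apply: le_trans Lr.
have r0 : 0 <= r by apply: le_trans ar; exact: cabs_ge0.
apply: (@le_trans _ _ (\sum_(j < L | j != i) r ^+ N)).
  apply: ler_sum => j ji; have aN := cabs_ge0 a.
  apply: (@le_trans _ _ (cabs a ^+ N)); last by rewrite lerXn2r ?nnegrE.
  apply: ler_wiXn2l; rewrite ?(ltW a1)//.
  have : (j : nat) != i by [].
  by rewrite -!mulnBr -mulnDr; case: (ltngtP j i) => // ij _; rewrite leq_pmulr// addn_gt0 !subn_gt0 ij ?orbT.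
rewrite sumr_const -[r ^+ N *+ _]mulr_natl ler_wpM2r ?exprn_ge0// ler_nat.
by apply: leq_trans (max_card _) _; rewrite card_ord.
Qed.

(** Separate the cases [x <= l] and [l < x]. *)
Lemma powR_le_lin x s l : 0 <= x -> 0 < s -> s < 1 -> 0 < l -> x `^ s <= l `^ s / l * x + l `^ s.
Proof.
move=> x0 s0 s1 l0; have [xl|lx] := leP x l.
  apply: ler_wpDl; first by rewrite mulr_ge0// divr_ge0 ?powR_ge0// ltW.
  by rewrite ge0_ler_powR ?nnegrE// ltW.
apply: ler_wpDr; first exact: powR_ge0.
have e : x = l * (x / l) by field; exact: lt0r_neq0.
have xl1 : 1 <= x / l by rewrite ler_pdivlMr// mul1r ltW.
rewrite {1}e powRM ?(ltW l0)//; last by rewrite divr_ge0// ltW.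
rewrite -mulrA [l^-1 * x]mulrC ler_wpM2l ?powR_ge0//.
rewrite -[leRHS]powRr1; last by rewrite divr_ge0// ltW.
by rewrite ler_powR// ltW.
Qed.

Lemma powR_le_1D x s : 0 <= x -> 0 < s -> s < 1 -> x `^ s <= x + 1.
Proof.
by move=> x0 s0 s1; have := @powR_le_lin x s 1 x0 s0 s1 ltr01; rewrite powR1 divr1 mul1r.
Qed.

Lemma rn_powR (u : T -> R) s : 0 <= s -> (forall x, 0 <= u x) -> rn u -> rn (fun x => u x `^ s).
Proof.
move=> s0 u0 [mu_ [B HB]]; split.
  by apply: (@measurableT_comp _ _ _ _ _ _ (fun y : R => y `^ s)) => //; exact: measurable_powR.
exists (B `^ s) => x _; rewrite ger0_norm ?powR_ge0//.
have b := HB x I; rewrite ger0_norm// in b.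
by rewrite ge0_ler_powR ?nnegrE//; apply: le_trans b.
Qed.

Lemma rn_poisson_pow a s : 0 <= s -> cabs a < 1 -> rn (fun x => poisson a (cis x) `^ s).
Proof.
move=> s0 a1; apply: rn_powR => //; last exact: nice_poisson.
by move=> x; exact: poisson_ge0.
Qed.

(** Poisson kernels concentrate as the point tends to the circle, so their powers
    with exponent below one become small in mean.  Far from the singularity
    (distance at least [tau]) the kernel itself is small.  Near it,
    [powR_le_lin] bounds the power by a small multiple of the kernel plus a
    constant, and the constant is charged to the logarithm of the distance,
    whose mean is zero by [RI_log1sub]. *)
Lemma RI_poisson_pow_small s e : 0 < s -> s < 1 -> 0 < e ->
  exists r, [/\ 0 <= r, r < 1 & forall a, cabs a < 1 -> r < cabs a ->
    RI (fun x => poisson a (cis x) `^ s) <= e].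
Proof.
move=> s0 s1 e0.
pose e3 := e / 3; have e30 : 0 < e3 by rewrite divr_gt0.
(* [l] solves [l^(s-1) = e / 3], the slope allowed in [powR_le_lin]. *)
pose l := expR (- ln e3 / (1 - s)).
have l0 : 0 < l by exact: expR_gt0.
have lE : l `^ s / l = e3.
  rewrite /l -expRM -expRN -expRD.
  have -> : - ln e3 / (1 - s) * s + - (- ln e3 / (1 - s)) = ln e3.
    by field; rewrite subr_eq0 gt_eqF.
  by rewrite lnK ?posrE.
have ls0 : 0 < l `^ s by rewrite powR_gt0.
have ln20 : 0 < ln 2 :> R by rewrite ln_gt0// ltr1n.
(* The mean of [l^s / k * (ln 2 - ln |1 - conj a z|)] is [l^s ln 2 / k = e / 3],
   and that function is at least [l^s] where the distance is below [tau]. *)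
pose k := l `^ s * ln 2 / e3.
have k0 : 0 < k by rewrite divr_gt0// mulr_gt0.
pose tau := 2 * expR (- k).
have tau0 : 0 < tau by rewrite mulr_gt0 ?expR_gt0.
(* If [1 - |a|^2 <= A0], the power of the kernel is at most [e / 3] beyond [tau]. *)
pose A0 := tau ^+ 2 * e3 `^ s^-1.
have A00 : 0 < A0 by rewrite mulr_gt0 ?exprn_gt0 ?powR_gt0.
exists (Num.max 0 (1 - A0 / 2)); split.
- by rewrite le_max lexx.
- by rewrite gt_max ltr01/=; lra.
move=> a a1; rewrite gt_max => /andP[_ aA].
have npp := rn_poisson_pow (ltW s0) a1; have np := nice_poisson a1.
have nl := rn_ln1sub a1.
pose m x := cabs (1 - cj a * cis x).
pose G x := e3 * poisson a (cis x) + (l `^ s / k * (ln 2 - ln (m x)) + e3).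
have m0 x : 0 < m x by apply: lt_le_trans (cabs_1sub_ge a x); rewrite subr_gt0.
have m2 x : m x <= 2 by exact: cabs_1sub_le.
have g0 x : 0 <= ln 2 - ln (m x) by rewrite subr_ge0 ler_ln ?posrE.
have n1 : rn (fun x => e3 * poisson a (cis x)) by apply: bounded_measM np; exact: bounded_meas_cst.
have n2 : rn (fun x => ln 2 - ln (m x)) by apply: bounded_measB nl; exact: bounded_meas_cst.
have n3 : rn (fun x => l `^ s / k * (ln 2 - ln (m x))) by apply: bounded_measM n2; exact: bounded_meas_cst.
have n4 : rn (fun x => l `^ s / k * (ln 2 - ln (m x)) + e3) by apply: bounded_measD n3 _; exact: bounded_meas_cst.
have nG : rn G by exact: bounded_measD.
have -> : e = RI G.
  rewrite RID// RIZ// RI_poisson// RID//; last exact: bounded_meas_cst.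
  rewrite RIZ// RIB//; last exact: bounded_meas_cst.
  rewrite RI_log1sub// !RI_cst// haar_fine1 !mulr1 subr0 /k /e3.
  by field; rewrite !gt_eqF//.
apply: RI_le => // x _.
have P0 := poisson_ge0 (cis x) a1.
have Q0 : 0 <= l `^ s / k * (ln 2 - ln (m x)) by rewrite mulr_ge0// divr_ge0 ?ltW.
have [tm|mt] := leP tau (m x).
  rewrite /G addrA; apply: ler_wpDl; first by rewrite addr_ge0// mulr_ge0// ltW.
  have -> : e3 = (e3 `^ s^-1) `^ s by rewrite -powRrM mulVf ?gt_eqF// powRr1// ltW.
  rewrite ge0_ler_powR ?nnegrE ?powR_ge0 ?(ltW s0)//.
  rewrite /poisson ler_pdivrMr; last by apply: exprn_gt0; exact: (m0 x).
  apply: (@le_trans _ _ A0).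
    have : (1 - cabs a) * (1 + cabs a) <= (1 - cabs a) * 2 by rewrite ler_wpM2l; lra.
    have -> : (1 - cabs a) * (1 + cabs a) = 1 - cabs a ^+ 2 by ring.
    lra.
  by rewrite /A0 mulrC ler_wpM2l ?powR_ge0// lerXn2r ?nnegrE ?cabs_ge0 ?(ltW tau0).
have h := powR_le_lin P0 s0 s1 l0; rewrite lE in h.
apply: le_trans h _; rewrite /G lerD2l.
apply: ler_wpDr; first exact: ltW.
have -> : l `^ s / k * (ln 2 - ln (m x)) = l `^ s * ((ln 2 - ln (m x)) / k) by rewrite mulrAC mulrA.
rewrite ler_peMr ?(ltW ls0)// ler_pdivlMr// mul1r.
have : ln (m x) <= ln tau by rewrite ler_ln ?posrE// ltW.
rewrite /tau lnM ?posrE ?expR_gt0// expRK; lra.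
Qed.

Lemma rn_dirichlet2_pow L N a s : 0 <= s -> cabs a < 1 ->
  rn (fun x => cabs (dirichlet L (cis x ^+ N)) ^+ 2 * poisson a (cis x) `^ s).
Proof. by move=> s0 a1; apply: bounded_measM (rn_dirichlet2 L N) (rn_poisson_pow s0 a1). Qed.

Lemma exists_geom_le r (L : nat) : 0 <= r -> r < 1 -> exists2 N, (0 < N)%N & L%:R * r ^+ N <= 1.
Proof.
move=> r0 r1; have [->|L0] := eqVneq L 0%N; first by exists 1%N => //; rewrite mul0r.
have Lp : (0 : R) < L%:R by rewrite ltr0n lt0n.
have : (fun n => r ^+ n) @ \oo --> (0 : R) by apply: cvg_expr; rewrite ger0_norm.
move=> /cvgrPdist_lt /(_ (L%:R^-1)); rewrite invr_gt0 => /(_ Lp) [N _ HN].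
exists N.+1 => //; have := HN N.+1 (leqnSn N); rewrite /= sub0r normrN ger0_norm ?exprn_ge0// => /ltW.
by rewrite -(ler_pM2l Lp) mulfV// gt_eqF.
Qed.

(** Kernels with [|a| > r] have small power means, which absorbs the trivial bound
    [|D|^2 <= L^2].  For the others [x^s <= x + 1] and, if [N] is large, the
    Poisson mean of [|D|^2] is comparable to [L]. *)
Lemma spread_test s L : 0 < s -> s < 1 -> (0 < L)%N -> exists2 N, (0 < N)%N &
  forall a, cabs a < 1 ->
   RI (fun x => cabs (dirichlet L (cis x ^+ N)) ^+ 2 * poisson a (cis x) `^ s) <= 3 * L%:R.
Proof.
move=> s0 s1 L0; have Lp : (0 : R) < L%:R by rewrite ltr0n.
have Li : (0 : R) < L%:R^-1 by rewrite invr_gt0.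
have [r [r0 r1 Hr]] := RI_poisson_pow_small s0 s1 Li.
have [N N0 HN] := exists_geom_le L r0 r1.
exists N => // a a1.
have npp := rn_poisson_pow (ltW s0) a1; have np := nice_poisson a1.
have nD := rn_dirichlet2 L N; have nDP := rn_dirichlet2_pow L N (ltW s0) a1.
have [ar|ra] := leP (cabs a) r.
  have n1 : rn (fun x => cabs (dirichlet L (cis x ^+ N)) ^+ 2 * poisson a (cis x)) by exact: bounded_measM.
  apply: (@le_trans _ _ (RI (fun x => cabs (dirichlet L (cis x ^+ N)) ^+ 2 * poisson a (cis x) + cabs (dirichlet L (cis x ^+ N)) ^+ 2))).
    apply: RI_le => // [|x _]; first exact: bounded_measD.
    rewrite -[X in _ + X]mulr1 -mulrDr ler_wpM2l ?sqr_ge0// powR_le_1D//.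
    exact: poisson_ge0.
  by rewrite RID// RI_dirichlet2//; have := RI_dirichlet2_poisson N0 ar r1 HN; lra.
have n2 : rn (fun x => L%:R ^+ 2 * poisson a (cis x) `^ s) by apply: bounded_measM npp; exact: bounded_meas_cst.
apply: (@le_trans _ _ (RI (fun x => L%:R ^+ 2 * poisson a (cis x) `^ s))).
  apply: RI_le => // x _; rewrite ler_wpM2r ?powR_ge0// lerXn2r ?nnegrE ?cabs_ge0//.
  by rewrite cabs_dirichlet// cabs_cisX.
rewrite RIZ//; apply: (@le_trans _ _ (L%:R ^+ 2 * L%:R^-1)).
  by rewrite ler_wpM2l ?sqr_ge0// Hr.
rewrite expr2 mulfK ?gt_eqF//; lra.
Qed.

Definition comb_block (al : R) (J L N : nat) z : R[i] := al%:C * (z ^+ J * dirichlet L (z ^+ N)).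

Lemma poly_derivable (n : nat) (e : nat -> nat) (c : nat -> R[i]) z :
  derivable ((fun w => \sum_(i < n) c i * w ^+ e i) : R[i]^o -> R[i]^o) z 1.
Proof.
have e0 : (0 : R) < 1 by [].
pose D := \sum_(i < n) c i * ((e i)%:R * z ^+ (e i).-1).
pose K := \sum_(i < n) cabs (c i) * ((e i)%:R * (e i).-1%:R * (cabs z + 1) ^+ (e i).-2).
have H (h : R[i]) : cabs h < 1 -> cabs (\sum_(i < n) c i * (z + h) ^+ e i
    - \sum_(i < n) c i * z ^+ e i - h * D) <= K * cabs h ^+ 2.
  move=> h1; rewrite /D mulr_sumr -!sumrB mulr_suml.
  apply: le_trans (cabs_sum _ _ _) _; apply: ler_sum => i _.
  rewrite mulrCA -!mulrBr cabsM -mulrA ler_wpM2l ?cabs_ge0// [leRHS]mulrC.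
  apply: pow_quad; first by rewrite lerDl.
  by apply: le_trans (cabsD _ _) _; rewrite lerD2l ltW.
by have [] := @deriv_quad R (fun w => \sum_(i < n) c i * w ^+ e i) z D K 1 e0 H.
Qed.

Lemma comb_block_derivable al J L N z : derivable (comb_block al J L N : R[i]^o -> R[i]^o) z 1.
Proof.
have -> : comb_block al J L N = fun w => \sum_(l < L) al%:C * w ^+ (J + N * l).
  apply/funext => w; rewrite /comb_block /dirichlet mulr_sumr mulr_sumr; apply: eq_bigr => l _.
  by rewrite exprD exprM.
exact: (@poly_derivable L (fun l => J + N * l)%N (fun=> al%:C)).
Qed.

(** A convex combination is at most one of its terms. *)
Lemma convex_le_sum K (c P : 'I_K -> R) s : 0 < s -> (forall i, 0 <= c i) ->
  (forall i, 0 <= P i) -> \sum_(i < K) c i = 1 ->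
  (\sum_(i < K) c i * P i) `^ s <= \sum_(i < K) P i `^ s.
Proof.
move=> s0 c0 P0 c1; set w := \sum_(i < K) c i * P i.
have w0 : 0 <= w by apply: sumr_ge0 => i _; exact: mulr_ge0.
have [i wi] : exists i, w <= P i.
  apply: contrapT => /forallNP H.
  have lt i : P i < w by rewrite ltNge; apply/negP/H.
  have [j cj0] : exists j, c j != 0.
    apply: contrapT => /forallNP H0.
    have := c1; rewrite big1 => [|j _]; first by move=> /esym/eqP; rewrite oner_eq0.
    by have := H0 j; move/negP; rewrite negbK => /eqP.
  suff : w < w by rewrite ltxx.
  rewrite -[X in _ < X]mul1r -c1 mulr_suml {1}/w.
  rewrite (bigD1 j)//= [X in _ < X](bigD1 j)//=.
  apply: ltr_leD; first by rewrite ltr_pM2l// lt_def cj0 c0.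
  by apply: ler_sum => k _; rewrite ler_wpM2l// ltW.
rewrite (bigD1 i)//=; apply: ler_wpDr; first by apply: sumr_ge0 => k _; exact: powR_ge0.
by rewrite ge0_ler_powR ?nnegrE// ltW.
Qed.

(** Since [|h|^t] is a convex combination of Poisson kernels, [|h|^2] is at most
    the sum of their powers with exponent [2 / t < 1], and each of them is
    controlled by the one-kernel test. *)
Lemma test_block t K h al J L N : 2 < t -> test_family t K h -> 0 <= al ->
  (forall a, cabs a < 1 ->
   RI (fun x => cabs (dirichlet L (cis x ^+ N)) ^+ 2 * poisson a (cis x) `^ (2 / t)) <= 3 * L%:R) ->
  (hardy_norm 2 (fun z => comb_block al J L N z * h z)%R `^ t <=
    ((al ^+ 2 * (K%:R * (3 * L%:R))) `^ (t / 2))%:E)%E.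
Proof.
move=> t2 [_ [lam [_ hnz il _]] [a [c [a1 c0 c1 H]]]] al0 HD.
have t0 : 0 < t by lra.
have s0 : 0 < 2 / t by rewrite divr_gt0.
pose V i x := cabs (dirichlet L (cis x ^+ N)) ^+ 2 * poisson (a i) (cis x) `^ (2 / t).
pose v x := al ^+ 2 * \sum_(i < K) V i x.
have nV i : rn (V i) by apply: rn_dirichlet2_pow; [exact: ltW|exact: a1].
have nS : rn (fun x => \sum_(i < K) V i x) by exact: bounded_meas_bigsum.
have nv : rn v by apply: bounded_measM nS; exact: bounded_meas_cst.
have v0 x : 0 <= v x.
  by rewrite mulr_ge0 ?sqr_ge0// sumr_ge0// => i _; rewrite mulr_ge0 ?sqr_ge0 ?powR_ge0.
set g := fun z => comb_block al J L N z * h z.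
have gv : {ae mu, forall x, cabs (boundary g (cis x)) `^ 2 <= v x}.
  apply: ae_mono (ae_and hnz H) _ => x [bh0 Hx].
  rewrite /g boundary_mul ?cabs_cis//; last exact: comb_block_derivable.
  rewrite -[X in _ `^ X]/(2%:R) powR_mulrn ?cabs_ge0// cabsM /comb_block cabsM cabs_ge0_real//.
  rewrite cabsM cabs_cisX mul1r !exprMn /v /V -mulrA ler_wpM2l ?sqr_ge0//.
  rewrite -mulr_sumr ler_wpM2l ?sqr_ge0//.
  have -> : cabs (boundary h (cis x)) ^+ 2 = (cabs (boundary h (cis x)) `^ t) `^ (2 / t).
    rewrite -powRrM mulrCA mulfV ?gt_eqF// mulr1 -[X in _ `^ X]/(2%:R) powR_mulrn ?cabs_ge0//.
  rewrite Hx; apply: convex_le_sum => // i; exact: poisson_ge0 (a1 i).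
have h1 := @circle_norm_pow_le R 2 (boundary g) v (ltr0n _ 2) v0 nv.1 gv.
have iv : (\int[mu]_x (v x)%:E = (RI v)%:E)%E.
  rewrite fineK//; have := integrable_fin_num measurableT (bounded_meas_integrable measurableT (haar_fin R) nv).
  by apply.
have vle : RI v <= al ^+ 2 * (K%:R * (3 * L%:R)).
  rewrite RIZ// ler_wpM2l ?sqr_ge0// RI_bigsum//.
  have -> : K%:R * (3 * L%:R) = \sum_(i < K) (3 * L%:R) :> R.
    by rewrite sumr_const card_ord -[RHS]mulr_natl.
  by apply: ler_sum => i _; apply: HD; exact: a1.
rewrite /hardy_norm -[X in (_ `^ X)%E](_ : 2 * (t / 2) = t); last by field.
rewrite poweRrM.
have le1 : (circle_norm 2 (boundary g) `^ 2 <= (al ^+ 2 * (K%:R * (3 * L%:R)))%:E)%E.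
  by apply: le_trans h1 _; rewrite iv lee_fin.
rewrite -poweR_EFin gt0_ler_poweR ?divr_ge0 ?(ltW t0)//.
- by rewrite in_itv/= leey andbT poweR_ge0.
- by rewrite in_itv/= leey andbT lee_fin !mulr_ge0 ?sqr_ge0.
Qed.
End block.

(** * The operator on power series *)

Section top.
Variable R : realType.
Local Notation cj z := (@Num.conj R[i] z).
Implicit Types (a z w zeta : R[i]) (x y r s t : R) (f g h : R[i] -> R[i]).
Implicit Types (c : nat -> R[i]).

Lemma cpseries_cvg c z (b : nat -> R) (B : R) :
  (forall i, cabs (c i) * cabs z ^+ i <= b i) ->
  (fun n => \sum_(i < n) b i) @ \oo --> B ->
  (fun n => complex.Re (cpartial c n z)) @ \oo --> complex.Re (cpseries c z) /\
  (fun n => complex.Im (cpartial c n z)) @ \oo --> complex.Im (cpseries c z).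
Proof.
move=> cb bB.
have small (e : R) : 0 < e -> \forall n \near \oo, cabs (cpseries c z - cpartial c n z) < e.
  move=> e0; move/cvgrPdist_lt: (bB) => /(_ _ e0); apply: filterS => n hn.
  by apply: le_lt_trans (cpseries_tail n cb bB) _; apply: le_lt_trans (ler_norm _) hn.
split; apply/cvgrPdist_lt => e /small; apply: filterS => n; apply: le_lt_trans.
  by rewrite -ReN -ReD; exact: normRe_le.
by rewrite -ImN -ImD; exact: normIm_le.
Qed.

Lemma cpseries_bound c z (b : nat -> R) (B : R) :
  (forall i, cabs (c i) * cabs z ^+ i <= b i) ->
  (fun n => \sum_(i < n) b i) @ \oo --> B -> cabs (cpseries c z) <= B.
Proof.
by move=> cb bB; have := cpseries_tail 0 cb bB; rewrite /cpartial !big_ord0 !subr0.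
Qed.

Lemma disc_summable_le c c' : (forall n, cabs (c n) <= cabs (c' n)) -> disc_summable c' -> disc_summable c.
Proof.
move=> cc ac r r01; have [B HB] := ac r r01; exists B => n; apply: le_trans (HB n).
by apply: ler_sum => i _; rewrite ler_wpM2r// exprn_ge0//; case/andP: r01.
Qed.

Lemma disc_summable_scale c (M : R) : 0 <= M -> disc_summable c -> disc_summable (fun n => M%:C * c n).
Proof.
move=> M0 ac r r01; have [B HB] := ac r r01; exists (M * B) => n.
apply: le_trans (ler_wpM2l M0 (HB n)); rewrite mulr_sumr; apply: ler_sum => i _.
by rewrite cabsM cabs_ge0_real// mulrA.
Qed.

Lemma disc_summable1 : disc_summable (fun=> 1 : R[i]).
Proof.
move=> r /andP[r0 r1]; exists (1 - r)^-1 => n.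
rewrite -[leRHS]mul1r ler_pdivlMr ?subr_gt0//.
under eq_bigr do rewrite cabs1 mul1r.
have := subrX1 r n; have := exprn_ge0 n r0; lra.
Qed.

Lemma disc_summable_poly c : (forall n, cabs (c n) <= n.+1%:R) -> disc_summable c.
Proof.
move=> H; apply: disc_summable_le (disc_summable_deriv disc_summable1) => n.
by rewrite /deriv_coef mulr1 cabs_nat.
Qed.

Local Notation leb := (@lebesgue_measure R).
Local Notation I01 := (`[0%R, 1%R]%classic : set (measurableTypeR R)).
Local Notation T := (measurableTypeR R).
Local Notation nice f := (@cbounded_meas _ T R I01 f).
Local Notation rn f := (@bounded_meas _ T R I01 f).
Local Notation lI f := (cintegral leb I01 f).

Lemma leb01 : leb I01 = 1%E.
Proof. by rewrite lebesgue_measure_itv/= lte_fin ltr01 oppr0 adde0. Qed.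
Lemma fin01 : (leb I01 < +oo)%E.
Proof. by rewrite leb01 ltry. Qed.
Lemma m01 : measurable I01. Proof. exact: measurable_itv. Qed.
Hint Resolve fin01 m01 : core.

Lemma in01 (x : R) : I01 x -> 0 <= x <= 1. Proof. by rewrite /= in_itv. Qed.

Lemma lI_ext (f g : T -> R[i]) : (forall x, I01 x -> f x = g x) -> lI f = lI g.
Proof.
by move=> H; rewrite /cintegral; congr (_ +i* _); apply: eq_Rintegral => x; rewrite inE => /H ->.
Qed.
Lemma lI_sum n (F : nat -> T -> R[i]) : (forall i, nice (F i)) ->
  lI (fun x => \sum_(i < n) F i x) = \sum_(i < n) lI (F i).
Proof. by move=> nF; exact: cI_sum. Qed.
Lemma lRI_sum n (F : nat -> T -> R) : (forall i, rn (F i)) ->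
  (\int[leb]_(x in I01) \sum_(i < n) F i x)%R = \sum_(i < n) (\int[leb]_(x in I01) F i x)%R.
Proof. by move=> nF; exact: RI_sum. Qed.

Lemma rn_pow n : rn (fun x => x ^+ n).
Proof.
split; first exact: measurable_funX.
by exists 1 => x /in01/andP[x0 x1]; rewrite ger0_norm ?exprn_ge0// exprn_ile1.
Qed.

Lemma RI_pow n : (\int[leb]_(x in I01) (x ^+ n))%R = n.+1%:R^-1.
Proof.
have n0 : (n.+1%:R : R) != 0 by rewrite pnatr_eq0.
pose F (x : R) : R := n.+1%:R^-1 * x ^+ n.+1.
have dF (x : R) : is_derive x 1 F (x ^+ n).
  have h := is_derive_scale n.+1%:R^-1 (@is_derive_pow _ id x 1 n.+1 (is_derive_id x 1)).
  by apply: (is_derive_eq h); rewrite /= mulr1 mulKf.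
have cF (x : R) : {for x, continuous F}.
  by apply/differentiable_continuous; rewrite -derivable1_diffP; case: (dF x).
have : (\int[leb]_(x in I01) (x ^+ n)%:E = (F 1)%:E - (F 0)%:E)%E.
  apply: (@continuous_FTC2 _ (fun x => x ^+ n) F) => //.
  - by apply: continuous_subspaceT => x; exact: exprn_continuous.
  - split.
    + by move=> x _; case: (dF x).
    + by apply: cvg_at_right_filter; exact: cF.
    + by apply: cvg_at_left_filter; exact: cF.
  - by move=> x _; rewrite derive1E; case: (dF x).
by move=> /(congr1 fine) /=; rewrite /F expr1n expr0n/= mulr0 mulr1 subr0.
Qed.

(** The moments of [1 + s + ... + s^(m-1)] on the unit interval. *)
Definition moment (m n : nat) : R := \sum_(i < m) (n + i).+1%:R^-1.

Lemma moment_ge0 m n : 0 <= moment m n.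
Proof. by apply: sumr_ge0 => i _; rewrite invr_ge0. Qed.
Lemma moment_le m n : moment m n <= m%:R / n.+1%:R.
Proof.
rewrite -[m in X in _ <= X](card_ord m) mulrC mulr_natr -sumr_const; apply: ler_sum => i _.
by rewrite lef_pV2 ?posrE ?ltr0n// ler_nat ltnS leq_addr.
Qed.

Definition ray z (s : R) : R[i] := s%:C * z.

Lemma nice_cpartial c n z : nice (fun s => cpartial c n (ray z s)).
Proof.
apply: (@cbounded_meas_sum _ _ _ _ _ (fun i s => c i * (ray z s) ^+ i)) => i.
apply: cbounded_measM; first exact: cbounded_meas_cst.
apply: cbounded_measX; apply: cbounded_measM; last exact: cbounded_meas_cst.
by apply: cbounded_meas_real; exact: (rn_pow 1).
Qed.

Lemma cabs_ray z s : I01 s -> cabs (ray z s) <= cabs z.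
Proof.
by move=> /in01/andP[s0 s1]; rewrite cabsM cabs_ge0_real// ler_piMl ?cabs_ge0.
Qed.

Lemma nice_cpseries c z : disc_summable c -> cabs z < 1 -> nice (fun s => cpseries c (ray z s)).
Proof.
move=> ac z1; have z01 : 0 <= cabs z < 1 by rewrite cabs_ge0.
have [B HB] := disc_summable_cvg ac z01.
have cb s : I01 s -> forall i, cabs (c i) * cabs (ray z s) ^+ i <= cabs (c i) * cabs z ^+ i.
  by move=> s01 i; rewrite ler_wpM2l ?cabs_ge0// lerXn2r ?nnegrE ?cabs_ge0// cabs_ray.
split.
- apply: (@measurable_fun_cvg _ _ _ _ (fun n s => complex.Re (cpartial c n (ray z s)))).
    by move=> n; have [] := nice_cpartial c n z.
  by move=> s s01; have [] := cpseries_cvg (cb s s01) HB.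
- apply: (@measurable_fun_cvg _ _ _ _ (fun n s => complex.Im (cpartial c n (ray z s)))).
    by move=> n; have [] := nice_cpartial c n z.
  by move=> s s01; have [] := cpseries_cvg (cb s s01) HB.
by exists B => s s01; exact: cpseries_bound (cb s s01) HB.
Qed.

Lemma nice_dirichlet01 m : nice (fun s => dirichlet m s%:C).
Proof.
apply: (@cbounded_meas_sum _ _ _ _ _ (fun i s => s%:C ^+ i)) => i.
by apply: cbounded_measX; apply: cbounded_meas_real; exact: (rn_pow 1).
Qed.

Lemma top_cpartial c m n z : lI (fun s => dirichlet m s%:C * cpartial c n (ray z s)) =
  cpartial (fun k => c k * (moment m k)%:C) n z.
Proof.
pose F k s := (c k * z ^+ k) * (\sum_(i < m) s ^+ (k + i))%:C.
have nS k : rn (fun s => \sum_(i < m) s ^+ (k + i)).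
  by apply: (@bounded_meas_sum _ _ _ _ _ (fun i s => s ^+ (k + i))) => i; exact: rn_pow.
have nF k : nice (F k) by apply: cbounded_measM (cbounded_meas_real (nS k)); exact: cbounded_meas_cst.
rewrite (@lI_ext _ (fun s => \sum_(k < n) F k s)).
  rewrite lI_sum//; apply: eq_bigr => k _.
  rewrite cIZ//; last exact: cbounded_meas_real.
  rewrite cI_real// (@lRI_sum m (fun i s => s ^+ (k + i)))//; last by move=> i; exact: rn_pow.
  under eq_bigr do rewrite RI_pow.
  by rewrite -/(moment m k); ring.
move=> s _; rewrite /cpartial mulr_sumr; apply: eq_bigr => k _.
rewrite /F /dirichlet mulr_suml rmorph_sum mulr_sumr; apply: eq_bigr => i _.
by rewrite rmorphXn/= /ray exprMn exprD; ring.
Qed.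

Lemma disc_summable_moment c m : disc_summable c -> disc_summable (fun k => c k * (moment m k)%:C).
Proof.
move=> ac; apply: (@disc_summable_le _ (fun k => (m%:R)%:C * c k)); last exact: disc_summable_scale.
move=> n; rewrite !cabsM !cabs_ge0_real ?moment_ge0// mulrC ler_wpM2r ?cabs_ge0//.
apply: le_trans (moment_le m n) _; rewrite ler_piMr// invf_le1 ?ltr0n// ler1n//.
Qed.

(** On polynomials the operator multiplies Taylor coefficients by moments; the
    interchange of sum and integral is the uniform convergence on the disc of
    radius [|z|]. *)
Lemma top_cpseries c m z : disc_summable c -> disc z -> Top (cpseries c) (dirichlet m) z =
  cpseries (fun k => c k * (moment m k)%:C) z.
Proof.
move=> ac z1; have ad := disc_summable_moment m ac.
have z01 : 0 <= cabs z < 1 by rewrite cabs_ge0.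
have nD := nice_dirichlet01 m; have nP := nice_cpseries ac z1.
pose W := Top (cpseries c) (dirichlet m) z - cpseries (fun k => c k * (moment m k)%:C) z.
suff : cabs W <= 0 by rewrite le_eqVlt ltNge cabs_ge0 orbF cabs_eq0 subr_eq0 => /eqP.
apply/ler_addgt0Pr => e e0; rewrite add0r.
have e1 : 0 < e / (m%:R + 1) by rewrite divr_gt0// ltr_wpDl.
have [N1 H1] := cpseries_approx ac z01 e1.
have [N2 H2] := cpseries_approx ad z01 e1.
pose n := (N1 + N2)%N.
have -> : W = lI (fun s => dirichlet m s%:C * (cpseries c (ray z s) - cpartial c n (ray z s))) -
   (cpseries (fun k => c k * (moment m k)%:C) z - cpartial (fun k => c k * (moment m k)%:C) n z).
  rewrite -top_cpartial (@lI_ext (fun s => dirichlet m s%:C * (cpseries c (ray z s) - cpartial c n (ray z s)))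
     (fun s => dirichlet m s%:C * cpseries c (ray z s) - dirichlet m s%:C * cpartial c n (ray z s))).
    have nDp : nice (fun s => dirichlet m s%:C * cpartial c n (ray z s)) by apply: cbounded_measM nD (nice_cpartial _ _ _).
    have nDs : nice (fun s => dirichlet m s%:C * cpseries c (ray z s)) by apply: cbounded_measM nD nP.
    rewrite cIB// /W /Top opprB addrA subrK//.
  by move=> s _; rewrite mulrBr.
have b1 : cabs (lI (fun s => dirichlet m s%:C * (cpseries c (ray z s) - cpartial c n (ray z s)))) <= m%:R * (e / (m%:R + 1)).
  rewrite -[leRHS]mulr1 -[X in _ * X](_ : fine (leb I01) = 1); last by rewrite leb01.
  apply: cI_abs => //; first by apply: cbounded_measM nD (cbounded_measB nP (nice_cpartial _ _ _)).
  move=> s s01; rewrite cabsM; apply: ler_pM; rewrite ?cabs_ge0//.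
    by move/in01: s01 => /andP[s0 s1]; rewrite cabs_dirichlet// cabs_ge0_real.
  by apply: ltW; apply: H1; [exact: leq_addr|exact: cabs_ray].
have b2 := H2 n z (leq_addl _ _) (lexx _).
apply: le_trans (cabsD _ _) _; rewrite cabsN.
have -> : e = m%:R * (e / (m%:R + 1)) + e / (m%:R + 1).
  by rewrite -[X in _ + X]mul1r -mulrDl mulrC divfK// gt_eqF// ltr_wpDl.
by rewrite lerD// ltW.
Qed.

(** Uniform convergence on the closed disc makes the sum continuous up to the
    circle, so its radial limits exist and are its values. *)
Lemma boundary_cpseries c (b : nat -> R) (B : R) zeta : cabs zeta = 1 ->
  (forall i, cabs (c i) <= b i) -> (fun n => \sum_(i < n) b i) @ \oo --> B ->
  boundary (cpseries c) zeta = cpseries c zeta.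
Proof.
move=> z1 cb bB; apply: boundaryP => e e0.
have cb' w : cabs w <= 1 -> forall i, cabs (c i) * cabs w ^+ i <= b i.
  move=> w1 i; apply: le_trans (cb i); rewrite ler_piMr ?cabs_ge0// exprn_ile1 ?cabs_ge0//.
have e3 : 0 < e / 3 by rewrite divr_gt0.
move/cvgrPdist_lt: (bB) => /(_ _ e3)[n _ /(_ n (leqnn n)) hn].
have {}hn : B - \sum_(i < n) b i < e / 3 := le_lt_trans (ler_norm _) hn.
have dp : derivable (cpartial c n : R[i]^o -> R[i]^o) zeta 1 by exact: (@poly_derivable R n id c).
have [d d0 H] := derivable_cont dp e3.
exists (Num.min d 1); first by rewrite lt_min d0 ltr01.
move=> r dr r1.
have /andP[dr' r0] : (1 - r < d) && (0 <= r).
  have dd : Num.min d 1 <= d by rewrite ge_min lexx.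
  have d1 : Num.min d 1 <= 1 by rewrite ge_min lexx orbT.
  by clear -dr dd d1; apply/andP; split; lra.
have rz : cabs (r%:C * zeta) <= 1 by rewrite cabsM z1 mulr1 cabs_ge0_real// ltW.
have t1 := le_lt_trans (cpseries_tail n (cb' _ rz) bB) hn.
have z1' : cabs zeta <= 1 by rewrite z1.
have t2 := le_lt_trans (cpseries_tail n (cb' _ z1') bB) hn.
have t3 : cabs (cpartial c n zeta - cpartial c n (r%:C * zeta)) < e / 3.
  apply: H; have -> : zeta - r%:C * zeta = (1 - r)%:C * zeta by rewrite rmorphB rmorph1 mulrBl mul1r.
  by rewrite cabsM z1 mulr1 cabs_ge0_real// subr_ge0 ltW.
clear - t1 t2 t3; move: t1 t2 t3.
move: (cpseries c zeta) (cpseries c (r%:C * zeta)) (cpartial c n zeta) (cpartial c n (r%:C * zeta)) => u v u' v' t1 t2 t3.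
have -> : u - v = (u - u') + (u' - v') + - (v - v') by ring.
have h1 := cabsD (u - u' + (u' - v')) (- (v - v')); rewrite cabsN in h1.
have h2 := cabsD (u - u') (u' - v').
by apply: le_lt_trans h1 _; apply: le_lt_trans (lerD h2 (lexx _)) _; lra.
Qed.
End top.

(** * Coefficients supported on sparse dyadic blocks *)

Lemma dyadic_uniq i j n : (2 ^ i <= n < 2 ^ i.+1)%N -> (2 ^ j <= n < 2 ^ j.+1)%N -> i = j.
Proof.
move=> /andP[i1 i2] /andP[j1 j2]; apply/eqP; rewrite eqn_leq -ltnS -[(j <= i)%N]ltnS.
by rewrite -(@ltn_exp2l 2 i)// -(@ltn_exp2l 2 j)// (leq_ltn_trans i1 j2) (leq_ltn_trans j1 i2).
Qed.

Lemma sum_delta (V : pzRingType) a b m (F : nat -> V) : (a <= m < b)%N ->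
  \sum_(a <= n < b) (n == m)%:R * F n = F m.
Proof.
move=> mab; rewrite (bigD1_seq m) ?mem_index_iota ?iota_uniq//= eqxx mul1r.
by rewrite big1 ?addr0// => i /negbTE ->; rewrite mul0r.
Qed.

Section coefs.
Variable R : realType.
Implicit Types (z : R[i]).
Variables (J L N : nat -> nat) (A : nat -> R).
Hypotheses (Jinc : forall k, (J k < J k.+1)%N) (N0 : forall k, (0 < N k)%N)
  (fit : forall k, (N k * L k <= 2 ^ J k)%N)
  (A0 : forall k, 0 <= A k) (A1 : forall k, A k <= (2 ^ J k)%:R).

Definition node k l := (2 ^ J k + N k * l)%N.
Definition piece k n : R := A k * \sum_(l < L k) (n == node k l)%:R.
(** Index [k] contributes only to frequencies at least [2 ^ J k > k], so the sum
    up to [n] is the full sum. *)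
Definition coef n : R := \sum_(k < n.+1) piece k n.

Lemma J_mono : {mono J : m n / (m < n)%N}.
Proof. exact: (leqW_mono (leq_mono (homo_ltn ltn_trans Jinc))). Qed.
Lemma J_ge k : (k <= J k)%N.
Proof. by elim: k => // k IH; apply: leq_ltn_trans IH (Jinc k). Qed.

Lemma node_range k l : (l < L k)%N -> (2 ^ J k <= node k l < 2 ^ (J k).+1)%N.
Proof.
move=> lL; rewrite leq_addr/= expnS mul2n -addnn ltn_add2l.
by apply: leq_trans (fit k); rewrite ltn_pmul2l.
Qed.

Lemma piece_off k n j : (2 ^ j <= n < 2 ^ j.+1)%N -> J k != j -> piece k n = 0.
Proof.
move=> nj kj; rewrite /piece big1 ?mulr0// => l _.
case: eqP => // e; move: kj; rewrite (@dyadic_uniq (J k) j n) ?eqxx//.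
by rewrite e; exact: node_range.
Qed.

Lemma piece_ge0 k n : 0 <= piece k n.
Proof. by rewrite mulr_ge0// sumr_ge0. Qed.
Lemma coef_ge0 n : 0 <= coef n.
Proof. by apply: sumr_ge0 => k _; exact: piece_ge0. Qed.

Lemma node_inj k l l' : node k l = node k l' -> l = l'.
Proof. by move=> /addnI/eqP; rewrite eqn_pmul2l// => /eqP. Qed.

Lemma piece_node k l : (l < L k)%N -> piece k (node k l) = A k.
Proof.
move=> lL; rewrite /piece (bigD1 (Ordinal lL))//= eqxx big1 ?addr0 ?mulr1// => i il.
case: eqP => // /node_inj e; move: il; rewrite -val_eqE/= -e eqxx//.
Qed.

Lemma piece_le k n : piece k n <= A k.
Proof.
have [[l ->]|H] := pselect (exists l : 'I_(L k), n = node k l); first by rewrite piece_node.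
rewrite /piece big1 ?mulr0// => l _; case: eqP => // e; exfalso; apply: H; by exists l.
Qed.

(** Distinct indices use distinct dyadic blocks. *)
Lemma coef_block k n : (2 ^ J k <= n < 2 ^ (J k).+1)%N -> coef n = piece k n.
Proof.
move=> nk; have kn : (k < n.+1)%N.
  case/andP: nk => nk _; rewrite ltnS (leq_trans (J_ge k))// (leq_trans _ nk)//.
  by rewrite ltnW// ltn_expl.
rewrite /coef (bigD1 (Ordinal kn))//= big1 ?addr0// => i ik.
apply: piece_off nk _; apply: contraNneq ik => e; rewrite -val_eqE/=.
by case: (ltngtP i k) => //; rewrite -J_mono e ltnn.
Qed.

Lemma coef_off j n : (2 ^ j <= n < 2 ^ j.+1)%N -> (forall k, J k != j) -> coef n = 0.
Proof. by move=> nj H; rewrite /coef big1// => k _; exact: piece_off nj (H k). Qed.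

Lemma coef_node k l : (l < L k)%N -> coef (node k l) = A k.
Proof. by move=> lL; rewrite (coef_block (node_range lL)) piece_node. Qed.

Lemma coef_le n : coef n <= n.+1%:R.
Proof.
case: n => [|n].
  rewrite /coef big1// => k _; rewrite /piece big1 ?mulr0// => l _.
  by case: eqP => // e; have := node_range (ltn_ord l); rewrite -e leqn0 expn_eq0.
have nj : (2 ^ trunc_log 2 n.+1 <= n.+1 < 2 ^ (trunc_log 2 n.+1).+1)%N.
  by rewrite trunc_logP//= trunc_log_ltn.
have [[k Jk]|H] := pselect (exists k, J k = trunc_log 2 n.+1).
  rewrite (@coef_block k) ?Jk//; apply: le_trans (piece_le _ _) _.
  by apply: le_trans (A1 k) _; rewrite Jk ler_nat; case/andP: nj => /leqW.
rewrite (coef_off nj)// => k; apply/eqP => Jk; by apply: H; exists k.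
Qed.

Lemma disc_summable_coef : disc_summable (fun n => (coef n)%:C).
Proof. by apply: disc_summable_poly => n; rewrite cabs_ge0_real ?coef_ge0// coef_le. Qed.

Lemma coef_block_sum k z : \sum_(2 ^ J k <= n < 2 ^ (J k).+1) (coef n)%:C * z ^+ n =
  (A k)%:C * (z ^+ (2 ^ J k) * dirichlet (L k) (z ^+ N k)).
Proof.
rewrite (eq_big_nat _ _ (F2 := fun n => (A k)%:C * \sum_(l < L k) (n == node k l)%:R * z ^+ n)).
  rewrite -mulr_sumr exchange_big/=; congr (_ * _).
  rewrite /dirichlet mulr_sumr; apply: eq_bigr => l _.
  by rewrite sum_delta ?node_range// exprD exprM.
move=> n nk; rewrite (coef_block nk) /piece rmorphM/= -mulrA; congr (_ * _).
by rewrite rmorph_sum mulr_suml; apply: eq_bigr => l _; rewrite rmorph_nat.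
Qed.

Lemma coef_block_off j z : (forall k, J k != j) ->
  \sum_(2 ^ j <= n < 2 ^ j.+1) (coef n)%:C * z ^+ n = 0.
Proof.
move=> H; rewrite big_nat big1// => n nj.
by rewrite (coef_off nj)// mul0r.
Qed.

(** Dividing by the frequency gains [2 ^ J k] on the block [k]. *)
Lemma sum_coef_le X : \sum_(n < X) coef n / n.+1%:R <= \sum_(k < X) A k * (L k)%:R / (2 ^ J k)%:R.
Proof.
apply: (@le_trans _ _ (\sum_(n < X) \sum_(k < X) piece k n / n.+1%:R)).
  apply: ler_sum => n _; rewrite mulr_suml.
  rewrite (big_ord_widen X (fun k => piece k n / n.+1%:R)); last exact: ltn_ord.
  rewrite [leRHS](bigID (fun k : 'I_X => (k < n.+1)%N))/= lerDl.
  by apply: sumr_ge0 => k _; rewrite divr_ge0// piece_ge0.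
rewrite exchange_big/=; apply: ler_sum => k _.
have pk n : piece k n / n.+1%:R <= piece k n / (2 ^ J k)%:R.
  have [nk|nk] := leqP (2 ^ J k) n.
    by rewrite ler_wpM2l ?piece_ge0// lef_pV2 ?posrE ?ltr0n ?expn_gt0// ler_nat leqW.
  have -> : piece k n = 0.
    rewrite /piece big1 ?mulr0// => l _; case: eqP => // e.
    by have /andP[] := node_range (ltn_ord l); rewrite -e leqNgt nk.
  by rewrite !mul0r.
apply: (@le_trans _ _ (\sum_(n < X) piece k n / (2 ^ J k)%:R)); first exact: ler_sum.
rewrite -mulr_suml ler_wpM2r ?invr_ge0// /piece -mulr_sumr ler_wpM2l//.
rewrite exchange_big/= -[in leRHS](card_ord (L k)) -sumr_const; apply: ler_sum => l _.
have [[n e]|H] := pselect (exists n : 'I_X, (n : nat) = node k l).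
  rewrite (bigD1 n)//= e eqxx big1 ?addr0// => i ni.
  case: eqP => // ei; move: ni; rewrite -val_eqE/= e ei eqxx//.
rewrite big1// => n _; case: eqP => // e; exfalso; apply: H; by exists n.
Qed.
End coefs.

(** * Series of norms *)

Section sums.
Variable R : realType.
Implicit Types (h : R[i] -> R[i]).

Lemma poweR_le_root (x : \bar R) (u c : R) : 0 < u -> (0 <= x)%E -> (x `^ u <= c%:E)%E ->
  (x <= (c `^ u^-1)%:E)%E.
Proof.
move=> u0 x0 xc; have -> : x = ((x `^ u) `^ u^-1)%E.
  by rewrite -poweRrM mulfV ?gt_eqF// poweRe1.
have c0 : (0 <= c%:E)%E by apply: le_trans xc; exact: poweR_ge0.
rewrite -poweR_EFin gt0_ler_poweR ?invr_ge0 ?(ltW u0)//.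
  by rewrite in_itv/= leey andbT poweR_ge0.
by rewrite in_itv/= leey andbT.
Qed.

Lemma circle_norm_zero (u : R) : 0 < u -> circle_norm u (fun=> 0 : R[i]) = 0%E.
Proof.
move=> u0; apply/eqP; rewrite eq_le circle_norm_ge0 andbT.
by apply: circle_norm_le_bound => // x; rewrite cabs0.
Qed.

Lemma hardy_norm_zero (u : R) : 0 < u -> hardy_norm u (fun=> 0 : R[i]) = 0%E.
Proof.
move=> u0; rewrite /hardy_norm -(circle_norm_zero u0); congr circle_norm.
apply/funext => z; apply: boundaryP => e e0; exists 1 => // r _ _.
by rewrite subrr cabs0.
Qed.

Section summable.
Variables (J : nat -> nat) (B : nat -> R).
Hypothesis (Jinc : forall k, (J k < J k.+1)%N) (B0 : forall k, 0 <= B k).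

(** At most one term is present, since [J] is injective, and none off the range
    of [J]. *)
Definition spread j : R := \sum_(k < j.+1 | J k == j) B k.

Lemma spread_ge0 j : 0 <= spread j. Proof. exact: sumr_ge0. Qed.

Lemma spread_ge k : B k <= spread (J k).
Proof.
have kJ : (k < (J k).+1)%N by rewrite ltnS J_ge.
by rewrite /spread (bigD1 (Ordinal kJ))//= lerDl sumr_ge0.
Qed.

Lemma spread_sum n : \sum_(j < n) spread j <= \sum_(k < n) B k.
Proof.
apply: (@le_trans _ _ (\sum_(j < n) \sum_(k < n | J k == j) B k)).
  apply: ler_sum => j _; rewrite /spread.
  rewrite (big_ord_widen_cond n (fun k => J k == j) B); last exact: ltn_ord.
  rewrite [leRHS](bigID (fun k : 'I_n => (k < j.+1)%N))/= lerDl.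
  exact: sumr_ge0.
rewrite (exchange_big_dep xpredT)//=; apply: ler_sum => k _.
have [kn|nk] := ltnP (J k) n.
  rewrite (bigD1 (Ordinal kn))//= big1 ?addr0// => j /andP[/eqP e]; rewrite -val_eqE/= e eqxx//.
by rewrite big1// => j /eqP e; move: nk; rewrite e leqNgt ltn_ord.
Qed.
End summable.

Lemma geom2_sum n : \sum_(k < n) (2%:R ^- k) <= 2%:R :> R.
Proof.
have : \sum_(k < n) (2%:R ^- k) = 2 - 2 / 2 ^+ n :> R.
  elim: n => [|n IH]; first by rewrite big_ord0 expr0 divr1 subrr.
  rewrite big_ord_recr/= IH exprS.
  have h : (2 ^+ n : R) != 0 by rewrite expf_neq0.
  by field.
move=> ->; have : 0 <= 2 / 2 ^+ n :> R by rewrite divr_ge0// exprn_ge0.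
lra.
Qed.

Lemma nneseries_le_tail (u : nat -> \bar R) (v : nat -> R) (S : R) n :
  (forall j, (0 <= u j)%E) -> (forall j, (u j <= (v j)%:E)%E) ->
  (fun n => \sum_(j < n) v j) @ \oo --> S ->
  (\sum_(n <= j <oo) u j <= (S - \sum_(j < n) v j)%:E)%E.
Proof.
move=> u0 uv vS.
have v0 j : 0 <= v j by rewrite -lee_fin (le_trans (u0 j)).
have nd : nondecreasing_seq (fun n => \sum_(i < n) v i).
  by apply/nondecreasing_seqP => m; rewrite big_ord_recr/= lerDl.
have sS m : \sum_(i < m) v i <= S.
  have cvb : cvgn (fun n => \sum_(i < n) v i) by apply/cvg_ex; exists S.
  by rewrite -(cvg_lim _ vS)//; apply: nondecreasing_cvgn_le.
apply: lime_le; first by apply: is_cvg_nneseries => j _ _.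
near=> m.
apply: (@le_trans _ _ (\sum_(n <= j < m) (v j)%:E)%E); first exact: lee_sum.
rewrite sumEFin lee_fin lerBrDl.
have nm : (n <= m)%N by near: m; exists n.
by apply: le_trans (sS m); rewrite -!(big_mkord xpredT) -big_cat_nat.
Unshelve. all: by end_near.
Qed.

Lemma powR_cvg0 (u : nat -> R) (s : R) : 0 < s -> (forall n, 0 <= u n) ->
  u @ \oo --> (0 : R) -> (fun n => u n `^ s) @ \oo --> (0 : R).
Proof.
move=> s0 u0 uc; apply/cvgrPdist_lt => e e0.
have e1 : 0 < e `^ s^-1 by rewrite powR_gt0.
move/cvgrPdist_lt: uc => /(_ _ e1); apply: filterS => n.
rewrite !sub0r !normrN !ger0_norm ?powR_ge0// => h.
have -> : e = (e `^ s^-1) `^ s by rewrite -powRrM mulVf ?gt_eqF// powRr1// ltW.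
by rewrite gt0_ltr_powR ?nnegrE ?powR_ge0.
Qed.
End sums.

(** * Lower bound by pairing with a spread Fejer sum *)

Section unbounded.
Variable R : realType.
Local Notation cj z := (@Num.conj R[i] z).
Implicit Types (z w : R[i]) (x y : R).
Local Notation mu := (haar R).
Local Notation T := (measurableTypeR R).
Local Notation nice f := (@cbounded_meas _ T R setT f).
Local Notation rn f := (@bounded_meas _ T R setT f).
Local Notation hI f := (cintegral mu setT f).
Local Notation RI u := (\int[mu]_x u x)%R.

Lemma RI_EFin (v : T -> R) : rn v -> (\int[mu]_x (v x)%:E = (RI v)%:E)%E.
Proof.
move=> nv; rewrite fineK//.
have := integrable_fin_num measurableT (bounded_meas_integrable measurableT (haar_fin R) nv).
by apply.
Qed.

(** Interpolates between the maximum [m] and the mean square [m]. *)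
Lemma circle_norm_dirichlet (u : R) (m N : nat) : 2 <= u -> (0 < m)%N -> (0 < N)%N ->
  (circle_norm u (fun z => dirichlet m (z ^+ N))%R <= ((m%:R `^ (u - 1)) `^ u^-1)%:E)%E.
Proof.
move=> u2 m0 N0; have u0 : 0 < u by lra.
have mp : (0 : R) < m%:R by rewrite ltr0n.
apply: poweR_le_root => //; first exact: circle_norm_ge0.
pose v x := m%:R `^ (u - 2) * cabs (dirichlet m (cis x ^+ N)) ^+ 2.
have nv : rn v by apply: bounded_measM (rn_dirichlet2 R m N); exact: bounded_meas_cst.
have v0 x : 0 <= v x by rewrite mulr_ge0 ?powR_ge0 ?sqr_ge0.
apply: le_trans (@circle_norm_pow_le R u _ v u0 v0 nv.1 _) _.
  apply: nearW => x; rewrite /v; set D := dirichlet _ _.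
  have Dm : cabs D <= m%:R by rewrite cabs_dirichlet// cabs_cisX.
  have -> : u = (u - 2) + 2 by ring.
  have [D0|D0] := eqVneq (cabs D) 0.
    by rewrite D0 powR0 ?mulr_ge0 ?powR_ge0 ?sqr_ge0//; apply/eqP; lra.
  rewrite powRD ?D0 ?implybT// -[X in _ * (_ `^ X)]/(2%:R) powR_mulrn ?cabs_ge0//.
  have -> : u - 2 + 2 - 2 = u - 2 by ring.
  rewrite ler_wpM2r ?sqr_ge0// ge0_ler_powR ?nnegrE ?cabs_ge0//; lra.
rewrite RI_EFin// lee_fin RIZ//; last exact: rn_dirichlet2.
rewrite RI_dirichlet2// -{2}[m%:R]powRr1// -powRD ?(gt_eqF mp) ?implybT//.
by have -> : u - 2 + 1 = u - 1 by ring.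
Qed.

(** The square of a Dirichlet sum has modulus at most [L^2] and mean [L], which
    gives the norm for every exponent [q >= 1] without estimating Dirichlet
    kernels in spaces with exponent below two. *)
Lemma circle_norm_fejer (q : R) (J L N : nat) : 1 <= q -> (0 < L)%N -> (0 < N)%N ->
  (circle_norm q (fun z => z ^+ J * dirichlet L (z ^+ N) ^+ 2)%R <= (L%:R `^ (2 - q^-1))%:E)%E.
Proof.
move=> q1 L0 N0; have q0 : 0 < q by lra.
have Lp : (0 : R) < L%:R by rewrite ltr0n.
have -> : L%:R `^ (2 - q^-1) = (L%:R `^ (2 * q - 1)) `^ q^-1.
  by rewrite -powRrM; congr (_ `^ _); field; exact: lt0r_neq0.
apply: poweR_le_root => //; first exact: circle_norm_ge0.
pose v x := L%:R `^ (2 * (q - 1)) * cabs (dirichlet L (cis x ^+ N)) ^+ 2.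
have nv : rn v by apply: bounded_measM (rn_dirichlet2 R L N); exact: bounded_meas_cst.
have v0 x : 0 <= v x by rewrite mulr_ge0 ?powR_ge0 ?sqr_ge0.
apply: le_trans (@circle_norm_pow_le R q _ v q0 v0 nv.1 _) _.
  apply: nearW => x; rewrite /v cabsM cabs_cisX mul1r cabsX; set D := cabs _.
  have D0 : 0 <= D by exact: cabs_ge0.
  have DL : D <= L%:R by rewrite cabs_dirichlet// cabs_cisX.
  have -> : (D ^+ 2) `^ q = (D ^+ 2) `^ (q - 1) * D ^+ 2.
    have [->|Dn] := eqVneq D 0; first by rewrite expr0n/= mulr0 powR0// gt_eqF.
    rewrite -{3}[D ^+ 2]powRr1 ?sqr_ge0// -powRD ?expf_neq0 ?implybT//.
    by have -> : q - 1 + 1 = q by ring.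
  rewrite ler_wpM2r ?sqr_ge0// powRrM -[X in L%:R `^ X]/(2%:R) powR_mulrn//.
  by rewrite ge0_ler_powR ?nnegrE ?sqr_ge0 ?subr_ge0// lerXn2r ?nnegrE.
rewrite RI_EFin// lee_fin RIZ//; last exact: rn_dirichlet2.
rewrite RI_dirichlet2// -{2}[L%:R]powRr1// -powRD ?(gt_eqF Lp) ?implybT//.
by have -> : 2 * (q - 1) + 1 = 2 * q - 1 by ring.
Qed.

Lemma moment_ge (m n : nat) : (0 < m)%N -> (n < 2 * m)%N -> 3^-1 <= moment R m n.
Proof.
move=> m0 nm; have mp : (0 : R) < m%:R by rewrite ltr0n.
have -> : 3^-1 = \sum_(i < m) (3 * m%:R)^-1 :> R.
  rewrite sumr_const card_ord -[RHS]mulr_natl; field; exact: lt0r_neq0.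
apply: ler_sum => i _; rewrite lef_pV2 ?posrE ?ltr0n ?mulr_gt0//.
by rewrite -natrM ler_nat; have := ltn_ord i; lia.
Qed.

Section pairing.
Variables (d : nat -> R) (b : nat -> R) (B : R) (J L N : nat) (delta : R).
Hypotheses (d0 : forall n, 0 <= d n) (db : forall n, d n <= b n)
  (bB : (fun n => \sum_(i < n) b i) @ \oo --> B)
  (L0 : (0 < L)%N) (N0 : (0 < N)%N)
  (dlow : forall l, (l < 2 * L)%N -> delta <= d (J + N * l)%N).
Let G z := cpseries (fun n => (d n)%:C) z.
Let g z : R[i] := z ^+ J * dirichlet L (z ^+ N) ^+ 2.

Let db' z : cabs z <= 1 -> forall i, cabs (d i)%:C * cabs z ^+ i <= b i.
Proof.
move=> z1 i; rewrite cabs_ge0_real//; apply: le_trans (db i).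
by rewrite ler_piMr// exprn_ile1 ?cabs_ge0.
Qed.

Lemma nice_cpseries_circle : nice (fun x => G (cis x)).
Proof.
have c1 x : cabs (cis x) <= 1 by rewrite cabs_cis.
have npp n : nice (fun x => cpartial (fun n => (d n)%:C) n (cis x)).
  apply: (@cbounded_meas_sum _ _ _ _ _ (fun i x => (d i)%:C * cis x ^+ i)) => i.
  by apply: cbounded_measM (nice_cisX R i); exact: cbounded_meas_cst.
split.
- apply: (@measurable_fun_cvg _ _ _ _ (fun n x => complex.Re (cpartial (fun n => (d n)%:C) n (cis x)))).
    by move=> n; have [] := npp n.
  by move=> x _; have [] := cpseries_cvg (db' (c1 x)) bB.
- apply: (@measurable_fun_cvg _ _ _ _ (fun n x => complex.Im (cpartial (fun n => (d n)%:C) n (cis x)))).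
    by move=> n; have [] := npp n.
  by move=> x _; have [] := cpseries_cvg (db' (c1 x)) bB.
by exists B => x _; exact: cpseries_bound (db' (c1 x)) bB.
Qed.

Lemma nice_g : nice (fun x => g (cis x)).
Proof. by apply: cbounded_measM (nice_cisX R J) _; apply: cbounded_measX; exact: nice_dirichlet. Qed.

Lemma gE z : g z = \sum_(i < L) \sum_(j < L) z ^+ (J + N * (i + j)).
Proof.
rewrite /g expr2 /dirichlet mulr_suml mulr_sumr; apply: eq_bigr => i _.
rewrite mulr_sumr mulr_sumr; apply: eq_bigr => j _.
by rewrite -exprD -exprM -exprD.
Qed.

Lemma cabs_g x : cabs (g (cis x)) <= L%:R ^+ 2.
Proof.
rewrite /g cabsM cabs_cisX mul1r cabsX lerXn2r ?nnegrE ?cabs_ge0//.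
by rewrite cabs_dirichlet// cabs_cisX.
Qed.

(** Orthogonality picks the coefficients on the progression [J + N l]. *)
Lemma pair_cpartial X : (J + N * (2 * L) <= X)%N ->
  hI (fun x => cpartial (fun n => (d n)%:C) X (cis x) * cj (g (cis x))) =
  (\sum_(i < L) \sum_(j < L) d (J + N * (i + j))%N)%:C.
Proof.
move=> XJ.
pose F1 n i j x := (d n)%:C * (cis x ^+ n * cj (cis x) ^+ (J + N * (i + j))).
have n1 n i j : nice (F1 n i j).
  apply: cbounded_measM; first exact: cbounded_meas_cst.
  by apply: cbounded_measM (nice_cisX R n) (nice_cjX R _).
pose F2 n i x := \sum_(j < L) F1 n i j x.
have n2 n i : nice (F2 n i) by exact: cbounded_meas_sum.
pose F3 n x := \sum_(i < L) F2 n i x.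
have n3 n : nice (F3 n) by exact: cbounded_meas_sum.
rewrite (@hI_ext _ _ (fun x => \sum_(n < X) F3 n x)); last first.
  move=> x; rewrite /cpartial mulr_suml; apply: eq_bigr => n _.
  rewrite gE cj_sum mulr_sumr; apply: eq_bigr => i _.
  rewrite cj_sum mulr_sumr; apply: eq_bigr => j _.
  by rewrite cjX /F1 mulrA.
rewrite hI_sum//.
have -> : \sum_(n < X) hI (F3 n) =
   \sum_(n < X) \sum_(i < L) \sum_(j < L) (d n)%:C * ((n : nat) == J + N * (i + j))%N%:R.
  apply: eq_bigr => n _; rewrite hI_sum//; apply: eq_bigr => i _.
  rewrite hI_sum//; apply: eq_bigr => j _.
  rewrite /F1 cIZ ?hI_orth//.
  by apply: cbounded_measM (nice_cisX R n) (nice_cjX R _).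
rewrite exchange_big/= rmorph_sum; apply: eq_bigr => i _.
rewrite exchange_big/= rmorph_sum; apply: eq_bigr => j _.
under eq_bigr do rewrite mulrC.
rewrite -(big_mkord xpredT (fun n => ((n : nat) == J + N * (i + j))%N%:R * (d n)%:C)).
rewrite sum_delta//; apply: leq_trans XJ; rewrite ltn_add2l ltn_pmul2l//.
by have := ltn_ord i; have := ltn_ord j; lia.
Qed.

(** The [L^2] coefficients picked by the pairing are all at least [delta]. *)
Lemma pair_ge : L%:R ^+ 2 * delta <= cabs (hI (fun x => G (cis x) * cj (g (cis x)))).
Proof.
apply/ler_addgt0Pr => e e0.
have Lp : (0 : R) < L%:R ^+ 2 by rewrite exprn_gt0// ltr0n.
have e1 : 0 < e / L%:R ^+ 2 by rewrite divr_gt0.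
move/cvgrPdist_lt: (bB) => /(_ _ e1)[X0 _ HX].
pose X := (X0 + (J + N * (2 * L)))%N.
have tX : B - \sum_(i < X) b i < e / L%:R ^+ 2.
  exact: le_lt_trans (ler_norm _) (HX X (leq_addr _ _)).
have c1 x : cabs (cis x) <= 1 by rewrite cabs_cis.
have npp : nice (fun x => cpartial (fun n => (d n)%:C) X (cis x)).
  apply: (@cbounded_meas_sum _ _ _ _ _ (fun i x => (d i)%:C * cis x ^+ i)) => i.
  by apply: cbounded_measM (nice_cisX R i); exact: cbounded_meas_cst.
have nG := nice_cpseries_circle; have ng := cbounded_meas_conj nice_g.
have n1 : nice (fun x => cpartial (fun n => (d n)%:C) X (cis x) * cj (g (cis x))) by exact: cbounded_measM.
have n2 : nice (fun x => G (cis x) * cj (g (cis x))) by exact: cbounded_measM.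
have b1 : cabs (hI (fun x => G (cis x) * cj (g (cis x)))
     - hI (fun x => cpartial (fun n => (d n)%:C) X (cis x) * cj (g (cis x)))) <= e.
  rewrite -cIB//; apply: hI_abs; first exact: cbounded_measB.
  move=> x; rewrite -mulrBl cabsM cabs_conj.
  have -> : e = e / L%:R ^+ 2 * L%:R ^+ 2 by rewrite divfK// gt_eqF.
  apply: ler_pM; rewrite ?cabs_ge0 ?cabs_g//.
  by apply: le_trans (cpseries_tail X (db' (c1 x)) bB) _; exact: ltW.
rewrite pair_cpartial ?leq_addl// in b1.
have s1 : L%:R ^+ 2 * delta <= \sum_(i < L) \sum_(j < L) d (J + N * (i + j))%N.
  have -> : L%:R ^+ 2 * delta = \sum_(i < L) \sum_(j < L) delta.
    by rewrite !sumr_const !card_ord -mulrnA -[RHS]mulr_natl natrM expr2.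
  apply: ler_sum => i _; apply: ler_sum => j _; apply: dlow.
  by have := ltn_ord i; have := ltn_ord j; lia.
set S := \sum_(i < L) _ in b1 s1; set W := hI _ in b1 *.
have := cabs_sub_ge S%:C W; rewrite cabsB cabs_real => h2.
apply: le_trans s1 _; apply: le_trans (ler_norm S) _; rewrite addrC -lerBlDr.
exact: le_trans h2 b1.
Qed.

Lemma pair_le (p q : R) : 0 < p -> 0 < q -> p^-1 + q^-1 = 1 ->
  ((cabs (hI (fun x => G (cis x) * cj (g (cis x)))))%:E <=
    circle_norm p G * circle_norm q g)%E.
Proof.
move=> p0 q0 pq.
have nG := nice_cpseries_circle; have ng := cbounded_meas_conj nice_g.
have nGa := bounded_meas_cabs nG; have nga := bounded_meas_cabs nice_g.
have n2 : nice (fun x => G (cis x) * cj (g (cis x))) by exact: cbounded_measM.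
have nn := bounded_measM nGa nga.
apply: le_trans (hoelder mu nGa.1 nga.1 p0 q0 pq).
rewrite Lnorm1; under eq_integral do rewrite /= ger0_norm ?mulr_ge0 ?cabs_ge0//.
rewrite RI_EFin// lee_fin; apply: cI_le => // x _.
by rewrite cabsM cabs_conj.
Qed.
End pairing.
End unbounded.

(** * The symbol *)

Section params.
Variable R : realType.
Variables (p p' t : R).
Hypotheses (hp : 2 < p) (hp' : p^-1 + p'^-1 = 1) (ht : t = 2 * p / (p - 2)).
Local Notation mu := (haar R).
Local Notation RI u := (\int[mu]_x u x)%R.
Implicit Types (z : R[i]) (h : R[i] -> R[i]) (k : nat).

Lemma p_gt0 : 0 < p. Proof. by apply: lt_trans hp. Qed.
Lemma tV : t^-1 = 2^-1 - p^-1.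
Proof. by rewrite ht; field; rewrite !gt_eqF ?p_gt0// subr_gt0. Qed.
Lemma t_gt2 : 2 < t.
Proof. by rewrite ht ltr_pdivlMr ?subr_gt0//; have := hp; lra. Qed.
Lemma t_gt0 : 0 < t. Proof. by apply: lt_trans t_gt2. Qed.
Lemma p'V : p'^-1 = 1 - p^-1. Proof. by rewrite -hp'; ring. Qed.
Lemma pV_lt : 0 < p^-1 /\ p^-1 < 2^-1.
Proof. by rewrite invr_gt0 p_gt0 ltf_pV2 ?posrE ?p_gt0. Qed.
Lemma p'_gt1 : 1 < p'.
Proof.
have [a b] := pV_lt; have p'0 : 0 < p' by rewrite -invr_gt0 p'V; lra.
by rewrite -invf_lt1// p'V; lra.
Qed.
Lemma p'_gt0 : 0 < p'. Proof. by apply: lt_trans p'_gt1. Qed.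

(** With [L = 4^k] the amplitude is [2^(-k/t) / sqrt L] and the comb has [2 L]
    teeth, enough to contain all the frequencies of the square of a Dirichlet sum
    of length [L].  The tests see [2^-k] (lemma [test_const]) while the operator
    norm sees [2^(k/t)] (lemma [growth]). *)
Definition base_amp k : R := 2 `^ (- (k%:R * (t^-1 + 1))).
Definition comb_length k : nat := (2 * 4 ^ k)%N.

Lemma base_amp_gt0 k : 0 < base_amp k. Proof. by rewrite powR_gt0. Qed.
Lemma base_amp_le1 k : base_amp k <= 1.
Proof.
rewrite -(@powRr0 R 2) ler_powR ?ler1n// oppr_le0 mulr_ge0// addr_ge0// invr_ge0.
exact: ltW t_gt0.
Qed.
Lemma pow2E n : (2 ^ n)%:R = 2 `^ n%:R :> R.
Proof. by rewrite natrX powR_mulrn. Qed.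
Lemma pow4E n : (4 ^ n)%:R = 2 `^ (2 * n%:R) :> R.
Proof. by rewrite -natrM -pow2E expnM. Qed.
Lemma comb_lengthE k : (comb_length k)%:R = 2 `^ (2 * k%:R + 1) :> R.
Proof.
rewrite natrM pow4E powRD ?pnatr_eq0 ?implybT// powRr1//.
by rewrite mulrC.
Qed.
Lemma pow2V n : 2 ^- n = 2 `^ (- n%:R) :> R.
Proof. by rewrite powRN powR_mulrn. Qed.
Let two_neq0 : (2 : R) != 0. Proof. by rewrite pnatr_eq0. Qed.
Lemma pow2D (x y : R) : 2 `^ x * 2 `^ y = 2 `^ (x + y) :> R.
Proof. by rewrite powRD ?two_neq0 ?implybT. Qed.

Lemma test_const K k : (base_amp k ^+ 2 * (K%:R * (3 * (comb_length k)%:R))) `^ (t / 2) =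
  (6 * K%:R) `^ (t / 2) * 2 ^- k.
Proof.
have t0 : t != 0 by rewrite gt_eqF ?t_gt0.
have -> : base_amp k ^+ 2 * (K%:R * (3 * (comb_length k)%:R)) = (6 * K%:R) * 2 `^ (- (2 * k%:R / t)).
  have -> : base_amp k ^+ 2 = 2 `^ (- (2 * k%:R * (t^-1 + 1))).
    by rewrite -powR_mulrn ?powR_ge0// -powRrM; congr (_ `^ _); ring.
  rewrite natrM pow4E.
  have -> : 2 `^ (- (2 * k%:R * (t^-1 + 1))) * (K%:R * (3 * (2%:R * 2 `^ (2 * k%:R)))) =
    6 * K%:R * (2 `^ (- (2 * k%:R * (t^-1 + 1))) * 2 `^ (2 * k%:R)) by ring.
  by rewrite pow2D; congr (_ * _ `^ _); field.
rewrite powRM ?powR_ge0 ?mulr_ge0// -powRrM pow2V; congr (_ * _ `^ _).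
by field.
Qed.

Lemma growth k : base_amp k * (4 ^ k)%:R `^ p'^-1 = 2 `^ (k%:R / t).
Proof.
rewrite pow4E -powRrM pow2D; congr (_ `^ _).
have e : p'^-1 = 2^-1 + t^-1 by rewrite p'V tV; field; exact: lt0r_neq0 p_gt0.
by rewrite e; move: (t^-1) => T; field.
Qed.

Lemma growth_unbounded (M : R) : exists k, M < 2 `^ (k%:R / t).
Proof.
have ln20 : 0 < ln 2 / t :> R by rewrite divr_gt0 ?t_gt0// ln_gt0// ltr1n.
have [k kM] : exists k, M / (ln 2 / t) < k%:R.
  by exists (Num.truncn (M / (ln 2 / t))).+1; rewrite truncnS_gt.
exists k; rewrite ltr_pdivrMr// in kM; apply: lt_le_trans kM _.
rewrite /powR (negbTE two_neq0); apply: le_trans (expR_ge1Dx _).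
by rewrite mulrA [_ / t * _]mulrAC; lra.
Qed.

(** First the spacing [N k], from the one-kernel test; then the dyadic level
    [J k], large enough for the comb to fit in one block and for the images of
    polynomials to have absolutely summable coefficients. *)
Lemma exists_params : exists J N : nat -> nat,
  [/\ forall k, (J k < J k.+1)%N, forall k, (0 < N k)%N,
      forall k, (N k * comb_length k <= 2 ^ J k)%N,
      forall k a, cabs a < 1 ->
       RI (fun x => cabs (dirichlet (comb_length k) (cis x ^+ N k)) ^+ 2 * poisson a (cis x) `^ (2 / t)) <= 3 * (comb_length k)%:R
    & forall k, p * (3 * k%:R + 1) <= (J k)%:R].
Proof.
have s0 : 0 < 2 / t by rewrite divr_gt0 ?t_gt0.
have s1 : 2 / t < 1 by rewrite ltr_pdivrMr ?t_gt0// mul1r t_gt2.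
have comb_length0 k : (0 < comb_length k)%N by rewrite muln_gt0 expn_gt0.
have /choice[N HN] : forall k, exists N, (0 < N)%N /\ forall a, cabs a < 1 ->
    RI (fun x => cabs (dirichlet (comb_length k) (cis x ^+ N)) ^+ 2 * poisson a (cis x) `^ (2 / t)) <= 3 * (comb_length k)%:R.
  by move=> k; have [N N0 H] := spread_test s0 s1 (comb_length0 k); exists N.
(* The second term of [B] serves [p (3 k + 1) <= J k]. *)
pose B k := (N k * comb_length k + (Num.truncn p).+1 * (3 * k + 1))%N.
pose J k := (k + \sum_(i < k.+1) B i)%N.
have BJ k : (B k <= J k)%N.
  by rewrite /J big_ord_recr/= addnA leq_addl.
exists J, N; split.
- move=> k; have -> : J k.+1 = (J k + B k.+1).+1.
    by rewrite /J [in LHS]big_ord_recr/= addSn addnA.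
  by rewrite ltnS leq_addr.
- by move=> k; have [] := HN k.
- move=> k; apply: (@leq_trans (B k)); first exact: leq_addr.
  by apply: leq_trans (BJ k) _; apply: ltnW; exact: ltn_expl.
- by move=> k; have [] := HN k.
- move=> k; apply: (@le_trans _ _ (B k)%:R); last by rewrite ler_nat.
  rewrite /B natrD; apply: ler_wpDl; first by [].
  have -> : ((Num.truncn p).+1 * (3 * k + 1))%:R = (Num.truncn p).+1%:R * (3 * k%:R + 1) :> R.
    by rewrite natrM natrD natrM.
  rewrite ler_wpM2r//.
  exact: ltW (truncnS_gt _).
Qed.

Section phi.
Variables (J N : nat -> nat).
Hypotheses (Jinc : forall k, (J k < J k.+1)%N) (N0 : forall k, (0 < N k)%N)
  (fit : forall k, (N k * comb_length k <= 2 ^ J k)%N)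
  (test : forall k a, cabs a < 1 ->
       RI (fun x => cabs (dirichlet (comb_length k) (cis x ^+ N k)) ^+ 2 * poisson a (cis x) `^ (2 / t)) <= 3 * (comb_length k)%:R)
  (Jbig : forall k, p * (3 * k%:R + 1) <= (J k)%:R).

(** The second factor cancels the weight of the block [J k] in [X_j]. *)
Definition amp k : R := base_amp k * 2 `^ ((J k)%:R / p').
Lemma amp_ge0 k : 0 <= amp k.
Proof. by rewrite mulr_ge0 ?powR_ge0. Qed.
Lemma amp_le k : amp k <= (2 ^ J k)%:R.
Proof.
rewrite pow2E /amp -[leRHS]mul1r; apply: ler_pM; rewrite ?powR_ge0 ?base_amp_le1//.
rewrite ler_powR ?ler1n// ler_piMr// invf_le1 ?p'_gt0//; exact: ltW p'_gt1.
Qed.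
(** This is what makes the images of polynomials continuous on the closed disc. *)
Lemma amp_sum k : amp k * (comb_length k)%:R / (2 ^ J k)%:R <= 2 ^- k.
Proof.
rewrite comb_lengthE pow2E -powRN /amp /base_amp pow2V !pow2D ler_powR ?ler1n//.
have kT : 0 <= k%:R * t^-1 by rewrite mulr_ge0// invr_ge0 ltW ?t_gt0.
have := Jbig k; rewrite mulrC -ler_pdivlMr ?p_gt0// => h.
rewrite p'V mulrDr mulr1 mulrBr mulr1.
by have k0 : 0 <= k%:R :> R by []; lra.
Qed.

Local Notation cf := (coef J comb_length N amp).
Definition phi z : R[i] := cpseries (fun n => (cf n)%:C) z.

Lemma phi_disc_summable : disc_summable (fun n => (cf n)%:C).
Proof. exact: (disc_summable_coef Jinc N0 fit amp_ge0 amp_le). Qed.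
Lemma phi_holo : holomorphic_on_disc (phi : R[i]^o -> R[i]^o).
Proof. exact: cpseries_holo phi_disc_summable. Qed.

Lemma block_phi j z : dyadic_block phi j z = \sum_(2 ^ j <= n < 2 ^ j.+1) (cf n)%:C * z ^+ n.
Proof. by apply: eq_bigr => n _; rewrite (taylor_cpseries n phi_disc_summable). Qed.

Lemma Xblock_on k : Xblock p' phi (J k) = comb_block (base_amp k) (2 ^ J k) (comb_length k) (N k).
Proof.
apply/funext => z; rewrite /Xblock block_phi (coef_block_sum amp Jinc N0 fit).
rewrite /comb_block mulrA -rmorphM; congr (_%:C * _).
by rewrite /amp mulrCA pow2D addNr powRr0 mulr1.
Qed.

Lemma Xblock_off j : (forall k, J k != j) -> Xblock p' phi j = fun=> 0.
Proof.
move=> H; apply/funext => z.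
by rewrite /Xblock block_phi (@coef_block_off _ _ _ _ amp N0 fit _ _ H) mulr0.
Qed.

Section blocks.
Variable K : nat.
Definition block_bound k : R := (6 * K%:R) `^ (t / 2) * 2 ^- k.
Lemma block_bound_ge0 k : 0 <= block_bound k.
Proof. by rewrite mulr_ge0 ?powR_ge0// invr_ge0 exprn_ge0. Qed.
Local Notation sp := (spread J block_bound).

(** On the levels [J k] this is [test_block]; the other blocks vanish. *)
Lemma block_le h j : test_family t K h ->
  (hardy_norm 2 (fun z => Xblock p' phi j z * h z)%R `^ t <= (sp j)%:E)%E.
Proof.
move=> th; have [[k <-]|H] := pselect (exists k, J k = j).
  have tb := @test_block R t K h (base_amp k) (2 ^ J k) (comb_length k) (N k) t_gt2 th (ltW (base_amp_gt0 k)) (@test k).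
  rewrite Xblock_on; apply: le_trans tb _.
  by rewrite lee_fin test_const; exact: (spread_ge Jinc block_bound_ge0).
rewrite Xblock_off => [|k]; last by apply/eqP => Jk; apply: H; exists k.
rewrite (_ : (fun z => _) = fun=> 0); last by apply/funext => z; rewrite mul0r.
by rewrite hardy_norm_zero// poweR0r ?gt_eqF ?t_gt0// lee_fin spread_ge0//; exact: block_bound_ge0.
Qed.

Lemma spread_cvg : exists S : R, (fun n => \sum_(j < n) sp j) @ \oo --> S.
Proof.
apply/cvg_ex; apply: nondecreasing_is_cvgn.
  apply/nondecreasing_seqP => n; rewrite big_ord_recr/= lerDl.
  by apply: spread_ge0; exact: block_bound_ge0.
exists ((6 * K%:R) `^ (t / 2) * 2) => _ [n _ <-].
apply: le_trans (spread_sum J block_bound_ge0 n) _.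
by rewrite -mulr_sumr ler_wpM2l ?powR_ge0// geom2_sum.
Qed.

Lemma block_series_le h (S : R) n : test_family t K h ->
  (fun n => \sum_(j < n) sp j) @ \oo --> S ->
  (\sum_(n <= j <oo) hardy_norm 2 (fun z => Xblock p' phi j z * h z)%R `^ t
    <= (S - \sum_(j < n) sp j)%:E)%E.
Proof.
move=> th HS; apply: nneseries_le_tail HS => j; first exact: poweR_ge0.
exact: block_le.
Qed.

Lemma block_sum_le h (S : R) n : test_family t K h ->
  (fun n => \sum_(j < n) sp j) @ \oo --> S ->
  (block_sum p' t phi n h <= ((S - \sum_(j < n) sp j) `^ t^-1)%:E)%E.
Proof.
move=> th HS; rewrite /block_sum -poweR_EFin.
have s0 : (0 <= \sum_(n <= j <oo) hardy_norm 2 (fun z => Xblock p' phi j z * h z)%R `^ t)%E.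
  by apply: nneseries_ge0 => j _ _; exact: poweR_ge0.
have sle := block_series_le n th HS.
apply: (gt0_ler_poweR _ _ _ sle); rewrite ?invr_ge0 ?(ltW t_gt0)// in_itv/= leey andbT//.
exact: le_trans s0 sle.
Qed.
End blocks.

Lemma disc0 : disc (0 : R[i]).
Proof. by change (is_true (cabs (0 : R[i]) < 1)); rewrite cabs0. Qed.

Lemma one_test K : (0 < K)%N -> test_family t K (fun=> 1 : R[i]).
Proof.
move=> K0; apply: (@scaled_test R t 0 1) => //.
- exact: t_gt0.
- exact: disc0.
- exact: cabs1.
move=> z z1; rewrite mul1r kernelE; last exact: disc0.
rewrite cabs0 expr0n/= subr0 ln1 mulr0 conjC0 mul0r subr0 clog1 mulr0 subr0.
by rewrite cexp0.
Qed.

(** Test on [1 + z + ... + z^(m-1)] with [m = 2 ^ J k]: its moments on the block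
    [J k] lie between [1/3] and [1], and its norm is at most [m^(1/p')].  Pairing
    the image with [z^m D(z^N)^2] isolates that block, and a bound [M] would
    force [2^(k/t) <= 3 |M|]. *)
Lemma phi_unbounded : ~ bounded_on_hardy p (Top phi).
Proof.
move=> [M HM].
have [k kM] := growth_unbounded (3 * `|M|).
pose m := (2 ^ J k)%N.
have m0 : (0 < m)%N by rewrite expn_gt0.
have mp : (0 : R) < m%:R by rewrite ltr0n.
pose L := (4 ^ k)%N.
have L0 : (0 < L)%N by rewrite expn_gt0.
have Lp : (0 : R) < L%:R by rewrite ltr0n.
pose d n := cf n * moment R m n.
(* The majorant [moment_le] divides by the frequency, as needed for [sum_coef_le]. *)
pose b n := m%:R * (cf n / n.+1%:R).
have cf0 n : 0 <= cf n by exact: (@coef_ge0 _ _ _ _ _ amp_ge0).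
have d0 n : 0 <= d n by rewrite mulr_ge0// moment_ge0.
have db n : d n <= b n.
  by rewrite /b mulrCA ler_wpM2l// moment_le.
have [B bB] : exists B : R, (fun n => \sum_(i < n) b i) @ \oo --> B.
  apply/cvg_ex; apply: nondecreasing_is_cvgn.
    by apply/nondecreasing_seqP => n; rewrite big_ord_recr/= lerDl mulr_ge0// divr_ge0.
  exists (m%:R * 2) => _ [n _ <-]; rewrite -mulr_sumr ler_wpM2l//.
  apply: le_trans (sum_coef_le N0 fit amp_ge0 n) _.
  by apply: le_trans (geom2_sum R n); apply: ler_sum => i _; exact: amp_sum.
pose G z := cpseries (fun n => (d n)%:C) z.
have TG z : disc z -> Top phi (dirichlet m) z = G z.
  move=> z1; rewrite (top_cpseries m phi_disc_summable z1); congr cpseries; apply/funext => n.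
  by rewrite -rmorphM.
have bdT x : boundary (Top phi (dirichlet m)) (cis x) = G (cis x).
  rewrite (@boundary_ext _ _ G) ?cabs_cis//.
  apply: (@boundary_cpseries _ _ b B) => //; first exact: cabs_cis.
  by move=> i; rewrite cabs_ge0_real.
have Dpd z : derivable (@dirichlet R m : R[i]^o -> R[i]^o) z 1.
  have := @poly_derivable R m id (fun=> 1) z.
  rewrite (_ : (fun w => _) = dirichlet m)//; apply/funext => w.
  by apply: eq_bigr => i _; rewrite mul1r.
have hD : hardy p (@dirichlet R m).
  split; first by move=> z _; exact: Dpd.
  apply: (@le_lt_trans _ _ (m%:R)%:E); last by rewrite ltry.
  apply: ge_ereal_sup => _ [r /= /andP[r0 r1] <-].
  apply: circle_norm_le_bound => //; first exact: p_gt0.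
  move=> x; apply: cabs_dirichlet; rewrite cabsM cabs_cis mulr1 cabs_ge0_real//; exact: ltW.
have [_ HT] := HM _ hD.
have hN : (hardy_norm p (@dirichlet R m) <= (m%:R `^ p'^-1)%:E)%E.
  rewrite /hardy_norm.
  have -> : circle_norm p (boundary (@dirichlet R m)) = circle_norm p (fun z => dirichlet m (z ^+ 1)).
    rewrite /circle_norm; congr Lnorm; apply/funext => x.
    by rewrite boundary_derivable ?cabs_cis// expr1.
  have := @circle_norm_dirichlet R p m 1 (ltW hp) m0 isT.
  have -> : (m%:R `^ (p - 1)) `^ p^-1 = m%:R `^ p'^-1 :> R; last by [].
  rewrite -powRrM; congr (_ `^ _); rewrite p'V; field; exact: lt0r_neq0 p_gt0.
have ET : hardy_norm p (Top phi (dirichlet m)) = circle_norm p G.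
  by rewrite /hardy_norm /circle_norm; congr Lnorm; apply/funext => x; rewrite bdT.
have dlow l : (l < 2 * L)%N -> amp k / 3 <= d (m + N k * l)%N.
  move=> lL; rewrite /d (coef_node amp Jinc N0 fit lL) ler_wpM2l ?amp_ge0//.
  by have /andP[_] := node_range N0 fit lL; rewrite expnS; exact: moment_ge.
have h1 := pair_ge d0 db bB L0 (N0 k) dlow.
have h2 := @pair_le R d b B m L (N k) d0 db bB p p' p_gt0 p'_gt0 hp'.
have h3 := @circle_norm_fejer R p' m L (N k) (ltW p'_gt1) L0 (N0 k).
have h4 : (circle_norm p G <= (`|M| * m%:R `^ p'^-1)%:E)%E.
  rewrite -ET; apply: le_trans HT _; rewrite EFinM.
  apply: (@le_trans _ _ (`|M|%:E * hardy_norm p (dirichlet m))%E).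
    by rewrite lee_wpmul2r ?circle_norm_ge0// lee_fin ler_norm.
  by rewrite lee_wpmul2l ?lee_fin.
have h5 : L%:R ^+ 2 * (amp k / 3) <= `|M| * m%:R `^ p'^-1 * L%:R `^ (2 - p'^-1).
  apply: le_trans h1 _; rewrite -lee_fin; apply: le_trans h2 _; rewrite [leRHS]EFinM.
  by apply: lee_pmul; rewrite ?circle_norm_ge0.
have : base_amp k * L%:R `^ p'^-1 <= 3 * `|M|.
  have mq : 0 < m%:R `^ p'^-1 :> R by rewrite powR_gt0.
  have Lq : 0 < L%:R `^ (2 - p'^-1) :> R by rewrite powR_gt0.
  have L2 : L%:R ^+ 2 = L%:R `^ (2 - p'^-1) * L%:R `^ p'^-1 :> R.
    rewrite -powRD ?(gt_eqF Lp) ?implybT// subrK -[X in _ `^ X]/(2%:R) powR_mulrn//.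
  have ampE : amp k = base_amp k * m%:R `^ p'^-1 by rewrite /amp /m pow2E -powRrM.
  rewrite L2 ampE in h5.
  rewrite -(ler_pM2r (mulr_gt0 mq Lq)).
  have -> : base_amp k * L%:R `^ p'^-1 * (m%:R `^ p'^-1 * L%:R `^ (2 - p'^-1)) =
     3 * (L%:R `^ (2 - p'^-1) * L%:R `^ p'^-1 * (base_amp k * m%:R `^ p'^-1 / 3)) by field.
  by rewrite -[leRHS]mulrA ler_pM2l// [leRHS]mulrA.
by rewrite growth leNgt kM.
Qed.

Lemma phi_works (K0 : nat) : (1 <= K0)%N ->
  [/\ holomorphic_on_disc phi,
      (ereal_sup [set block_sum p' t phi 0 h | h in test_family t K0] < +oo)%E,
      ereal_sup [set block_sum p' t phi N.+1 h | h in test_family t K0]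
        @[N --> \oo] --> 0%E,
      ~ bounded_on_hardy p (Top phi) &
      (\sum_(0 <= j <oo) hardy_norm 2 (Xblock p' phi j) `^ t < +oo)%E /\
      ((\sum_(N.+1 <= j <oo) hardy_norm 2 (Xblock p' phi j) `^ t) `^ t^-1)%E
        @[N --> \oo] --> 0%E].
Proof.
move=> K1; have [S HS] := spread_cvg K0.
have one := one_test K1.
pose tl n := (S - \sum_(j < n) spread J (block_bound K0) j) `^ t^-1.
have nd : nondecreasing_seq (fun n => \sum_(j < n) spread J (block_bound K0) j).
  apply/nondecreasing_seqP => m; rewrite big_ord_recr/= lerDl.
  by apply: spread_ge0; exact: block_bound_ge0.
have sS m : \sum_(j < m) spread J (block_bound K0) j <= S.
  have cvb : cvgn (fun n => \sum_(j < n) spread J (block_bound K0) j) by apply/cvg_ex; exists S.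
  by rewrite -(cvg_lim _ HS)//; apply: nondecreasing_cvgn_le.
have tl0 : (fun n => (tl n.+1)%:E) @ \oo --> 0%E.
  apply/fine_cvgP; split; first by apply: nearW.
  apply: powR_cvg0; first by rewrite invr_gt0 t_gt0.
    by move=> n; rewrite subr_ge0.
  have HS1 : (fun n => \sum_(j < n.+1) spread J (block_bound K0) j) @ \oo --> S.
    by rewrite (cvg_shiftS (fun n => \sum_(j < n) spread J (block_bound K0) j)).
  rewrite -[X in _ --> X](subrr S); apply: cvgB; [exact: cvg_cst|exact: HS1].
have bs_ge0 n h : (0 <= block_sum p' t phi n h)%E by exact: poweR_ge0.
split.
- exact: phi_holo.
- apply: (@le_lt_trans _ _ (tl 0%N)%:E); last by rewrite ltry.
  by apply: ge_ereal_sup => _ [h th <-]; exact: block_sum_le.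
- apply: (@squeeze_cvge _ _ _ _ (fun=> 0%E) _ (fun n => (tl n.+1)%:E)) => //; last exact: cvg_cst.
  apply: nearW => n; apply/andP; split.
    apply: (@le_trans _ _ (block_sum p' t phi n.+1 (fun=> 1))) => //.
    by apply: ereal_sup_ubound; exists (fun=> 1).
  by apply: ge_ereal_sup => _ [h th <-]; exact: block_sum_le.
- exact: phi_unbounded.
have X1 j : Xblock p' phi j = (fun z => Xblock p' phi j z * 1).
  by apply/funext => z; rewrite mulr1.
split.
  have := block_series_le 0 one HS; under eq_eseriesr do rewrite -X1.
  by move=> /le_lt_trans; apply; rewrite ltry.
apply: (@squeeze_cvge _ _ _ _ (fun=> 0%E) _ (fun n => (tl n.+1)%:E)) => //; last exact: cvg_cst.
apply: nearW => n; apply/andP; split; first exact: poweR_ge0.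
have := block_sum_le n.+1 one HS; rewrite /block_sum.
by under eq_eseriesr do rewrite -X1.
Qed.
End phi.
End params.

Theorem theorem6p4 (R : realType) (p p' t : R)
    (hp : 2 < p) (hp' : p^-1 + p'^-1 = 1) (ht : t = 2 * p / (p - 2)) :
  (forall K0 : nat, (1 <= K0)%N ->
    exists phi : R[i] -> R[i],
      [/\ holomorphic_on_disc phi,
          (ereal_sup [set block_sum p' t phi 0 h | h in test_family t K0]
            < +oo)%E,
          ereal_sup [set block_sum p' t phi N.+1 h | h in test_family t K0]
            @[N --> \oo] --> 0%E,
          ~ bounded_on_hardy p (Top phi) &
          (\sum_(0 <= j <oo) hardy_norm 2 (Xblock p' phi j) `^ t < +oo)%E /\
          ((\sum_(N.+1 <= j <oo) hardy_norm 2 (Xblock p' phi j) `^ t) `^ t^-1)%E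
            @[N --> \oo] --> 0%E]) /\
  (forall h : R[i] -> R[i],
    test_family t 1 h <->
    exists a lambda : R[i],
      [/\ disc a, cabs lambda = 1 &
          forall z, disc z -> h z = lambda * kernel_fun t a z]) /\
  (forall a zeta : R[i], disc a -> cabs zeta = 1 ->
    cabs (kernel_fun t a zeta) `^ t = poisson a zeta).
Proof.
have t0 := t_gt0 hp ht; split; last split.
- have [J [N [Jinc N0 fit tst Jbig]]] := exists_params hp ht.
  by move=> K0 K1; exists (phi p' t J N); apply: phi_works.
- by move=> h; exact: test_family1.
- move=> a zeta a1 z1; apply: kernel_pow => //; first by rewrite gt_eqF.
  by apply: lin_neq0; rewrite ?z1.
Qed.
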